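(* Let $g\ge1$ and $(\bm w,\bm\rho)\in\mathfrak C_g$ with Schottky group $\Gamma$. Then $$\det(I-A)=\prod_{k\ge1}\prod_{\gamma_p}\big(1-q_{\gamma_p}^k\big),$$ where $\gamma_p$ ranges over representatives of the primitive conjugacy classes of $\Gamma$ excluding the identity and $q_{\gamma_p}$ is the multiplier of $\gamma_p$.
   Context: $\mathcal I=\{\pm1,\ldots,\pm g\}$. Parameters $w_a\in\mathbb C$ ($a\in\mathcal I$), $\rho_a\in\mathbb C\setminus\{0\}$ with $\rho_{-a}=\rho_a$. $\mathfrak C_g\subset\mathbb C^{3g}$ is the set of $(\bm w,\bm\rho)=(w_1,w_{-1},\rho_1,\ldots,w_g,w_{-g},\rho_g)$ with $|w_a-w_b|>|\rho_a|^{1/2}+|\rho_b|^{1/2}$ for all $a\ne b$ in $\mathcal I$. The Möbius maps $\gamma_az=w_{-a}+\rho_a/(z-w_a)$, $a\in\mathcal I$, satisfy $\gamma_{-a}=\gamma_a^{-1}$, and $\Gamma$ is the Schottky group, the free group generated by $\gamma_1,\ldots,\gamma_g$. Each $\gamma\in\Gamma$, $\gamma\neq1$, is conjugate in $\mathrm{SL}_2(\mathbb C)$ (as a Möbius map) to $\mathrm{diag}(q_\gamma^{1/2},q_\gamma^{-1/2})$ with $|q_\gamma|<1$; $q_\gamma$ is called the multiplier of $\gamma$. An element $\gamma_p\in\Gamma$ is primitive if $\gamma_p\ne\gamma^m$ for every $m>1$ and $\gamma\in\Gamma$. $A=(A_{ab}(k,l))$ is the infinite matrix doubly indexed by $a,b\in\mathcal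 I$ and $k,l\ge1$, with $A_{ab}(k,l)=\dfrac{(-1)^k(k+l-1)!}{\sqrt{kl}\,(k-1)!(l-1)!}\dfrac{\rho_a^{k/2}\rho_b^{l/2}}{(w_{-a}-w_b)^{k+l}}$ if $a\ne-b$ and $A_{ab}(k,l)=0$ if $a=-b$ (with fixed square roots, $\rho_{-a}^{1/2}=\rho_a^{1/2}$). $I$ is the infinite identity matrix with the same indexing, and $\det(I-A)$ is defined by $\log\det(I-A)=\mathrm{Tr}\log(I-A)=-\sum_{k\ge1}\frac1k\mathrm{Tr}A^k$. *)

(* Defs.v *)
From HB Require Import structures.
From mathcomp Require Import all_boot all_order all_algebra.
From mathcomp Require Import complex.
From mathcomp Require Import all_classical all_reals all_analysis.

Set Implicit Arguments.
Unset Strict Implicit.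
Unset Printing Implicit Defensive.

Import Order.TTheory GRing.Theory Num.Theory.
Import numFieldNormedType.Exports.

Local Open Scope classical_set_scope.
Local Open Scope ring_scope.

(* Typing the complex numbers as a numClosedFieldType (rather than as the bare
   carrier R[i]) lets the norm topology of mathcomp-analysis be inferred. *)
Definition Cplx (R : realType) : numClosedFieldType := R[i].

Definition cexp (R : realType) (z : Cplx R) : Cplx R :=
  let: Complex x y := z in Complex (expR x * cos y) (expR x * sin y).

(* The set {+-1, ..., +-g}: (i, false) stands for i + 1, (i, true) for
   -(i + 1). *)
Notation idx g := ('I_g * bool)%type.

Definition opp_idx (g : nat) (a : idx g) : idx g := (a.1, ~~ a.2).

Section Schottky.
Variables (R : realType) (g : nat).
Local Notation C := (Cplx R).
Local Notation I := (idx g).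

(* rho is indexed by all of {+-1, ..., +-g}, subject to rho_{-a} = rho_a. *)
Definition schottky_domain (w rho : I -> C) : Prop :=
  [/\ forall a, rho a != 0,
      forall a, rho (opp_idx a) = rho a &
      forall a b, a != b ->
        sqrtC `|rho a| + sqrtC `|rho b| < `|w a - w b|].

(* The Riemann sphere, None being the point at infinity. *)
Definition sphere : Type := option C.

Definition mobius (M : 'M[C]_2) (z : sphere) : sphere :=
  if z is Some x then
    if M 1 0 * x + M 1 1 == 0 then None
    else Some ((M 0 0 * x + M 0 1) / (M 1 0 * x + M 1 1))
  else if M 1 0 == 0 then None else Some (M 0 0 / M 1 0).

(* z |-> w_{-a} + rho_a / (z - w_a) *)
Definition gamma (w rho : I -> C) (a : I) (z : sphere) : sphere :=
  if z is Some x then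
    if x == w a then None
    else Some (w (opp_idx a) + rho a / (x - w a))
  else Some (w (opp_idx a)).

Definition word (w rho : I -> C) (s : seq I) : sphere -> sphere :=
  foldr (fun a f => gamma w rho a \o f) id s.

(* As gamma_{-a} is the inverse of gamma_a, the composites of the gamma_a for
   a in {+-1, ..., +-g} form the group generated by gamma_1, ..., gamma_g. *)
Definition schottky_group (w rho : I -> C) : set (sphere -> sphere) :=
  range (word w rho).

Definition conjugate (G : set (sphere -> sphere)) (f f' : sphere -> sphere) :
  Prop := exists2 h, G h & h \o f = f' \o h.

Definition primitive (G : set (sphere -> sphere)) (f : sphere -> sphere) :
  Prop := G f /\ forall h m, G h -> (1 < m)%N -> f <> iter m h.

Definition primitive_representatives (G P : set (sphere -> sphere)) : Prop :=
  (forall p, P p -> primitive G p /\ p <> id) /\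
  (forall f, primitive G f -> f <> id ->
     exists! p, P p /\ conjugate G f p).

Definition is_multiplier (f : sphere -> sphere) (q : C) : Prop :=
  `|q| < 1 /\
  exists (S : 'M[C]_2) (h : C),
    [/\ \det S = 1, h != 0, h ^+ 2 = q &
        f = mobius (S *m diag_mx (\row_(i < 2) if i == 0 then h else h^-1)
                      *m invmx S)].

Definition multiplier (f : sphere -> sphere) : C := xget 0 (is_multiplier f).

(* Matrices doubly indexed by a, b in {+-1, ..., +-g} and k, l >= 1; the
   entries with k = 0 or l = 0 are never used. *)
Definition infmx : Type := I -> I -> nat -> nat -> C.

Definition infmx_id : infmx :=
  fun a b k l => ((a == b) && (k == l))%:R.

Definition infmx_mul (X Y : infmx) : infmx := fun a b k l =>
  \sum_(c : I) limn (series (fun m => X a c k m.+1 * Y c b m.+1 l)).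

Definition infmx_exp (X : infmx) (n : nat) : infmx :=
  iter n (infmx_mul X) infmx_id.

Definition infmx_tr (X : infmx) : C :=
  \sum_(a : I) limn (series (fun k => X a a k.+1 k.+1)).

(* det (I - X) := exp (- \sum_(n >= 1) Tr (X ^ n) / n) *)
Definition det1B_series (X : infmx) : nat -> C :=
  series (fun n => infmx_tr (infmx_exp X n.+1) / n.+1%:R).

Definition det1B (X : infmx) : C := cexp (- limn (det1B_series X)).

(* limn returns an arbitrary value on a divergent sequence; this says that
   every series occurring in det1B X converges, the entries of the powers of X
   and the traces absolutely. *)
Definition det1B_defined (X : infmx) : Prop :=
  [/\ forall n a b c k l, (0 < k)%N -> (0 < l)%N ->
        cvgn (series (fun m =>
          `|X a c k m.+1 * infmx_exp X n c b m.+1 l|)),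
      forall n a, cvgn (series (fun k => `|infmx_exp X n.+1 a a k.+1 k.+1|)) &
      cvgn (det1B_series X)].

(* srho a is the chosen square root of rho a. *)
Definition Amx (w srho : I -> C) : infmx := fun a b k l =>
  if a == opp_idx b then 0 else
  (-1) ^+ k * ((k + l).-1)`!%:R
    / (sqrtC (k * l)%:R * (k.-1)`!%:R * (l.-1)`!%:R)
  * (srho a ^+ k * srho b ^+ l / (w (opp_idx a) - w b) ^+ (k + l)).

(* The elements of P whose conjugacy class in the Schottky group contains a
   word of length at most N in the gamma_a, i.e. whose cyclically reduced word
   has length at most N. *)
Definition length_le (w rho : I -> C) (P : set (sphere -> sphere)) (N : nat) :
  set (sphere -> sphere) :=
  [set p | P p /\ exists2 s : seq I,
     (size s <= N)%N & conjugate (schottky_group w rho) (word w rho s) p].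

Definition exhaustion (T : Type) (F : nat -> set T) (P : set T) : Prop :=
  [/\ forall N, finite_set (F N),
      forall N, F N `<=` F N.+1 &
      \bigcup_N F N = P].

(* The iterated product \prod_(k >= 1) \prod_p (1 - q_p ^ k) has the value l,
   the inner products being limits of the products over p in F N. *)
Definition iterated_product_cvg (F : nat -> set (sphere -> sphere)) (l : C) :
  Prop :=
  exists2 Pi : nat -> C,
    forall k, (0 < k)%N ->
      (fun N => \big[*%R/1]_(p \in F N) (1 - multiplier p ^+ k)) @ \oo --> Pi k
    & (fun K => \prod_(1 <= k < K.+1) Pi k) @ \oo --> l.

Definition multipliers_summable (P : set (sphere -> sphere)) : Prop :=
  summable P (fun p => (ComplexField.Normc.normc (multiplier p))%:E).

End Schottky.

(* Main.v *)
(* Up to conjugation by the diagonal matrix of the square roots of k, the block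
   A_ab is the matrix, on the monomials z^k with k >= 1, of composition with a
   Moebius map carrying the disc of one letter into that of another. Hence
   Tr A^n is a sum over closed paths of n letters, where paths containing a
   cancelling pair contribute 0 and a cyclically reduced word of multiplier q
   contributes q / (1 - q), the trace of composition with a map conjugate to
   z |-> q z on functions modulo constants. Cyclically reduced words up to
   rotation are the conjugacy classes of the free group Gamma, and each is a
   power of a primitive one, so that
     sum_n Tr A^n / n = sum_p sum_m q_p^m / (m (1 - q_p^m))
                      = - sum_p sum_k log (1 - q_p^k).
   For convergence, positivity of the logarithmic energy of charges on the
   boundary circles (Grunsky's inequality) shows that A is a contraction for a
   norm which is gained geometrically when the discs are dilated a little. This
   makes the sum of |q|^2 over the words of length n geometrically small in n.
   Everything is then absolutely convergent except the sum of the q_p itself,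
   which therefore has to be taken in the order of the word length. *)

Require Import Defs.
From mathcomp Require Import all_boot all_order all_algebra.
From mathcomp Require Import complex.
From mathcomp Require Import all_classical all_reals all_analysis.
From mathcomp Require Import finmap cyclic separable cyclotomic.
From mathcomp Require Import ring lra zify.

Set Implicit Arguments.
Unset Strict Implicit.
Unset Printing Implicit Defensive.

Import Order.TTheory GRing.Theory Num.Theory.
Import numFieldNormedType.Exports.

Local Open Scope classical_set_scope.
Local Open Scope ring_scope.

(** Estimating each word on its own is not enough: the number of words of length n grows
    exponentially, while the separation ratio t of the discs may be close to 1, so the bound by
    powers of t for one word need not beat their number. The norm therefore has to control all words
    at once. A vector supported on one block is sent by the contraction into all blocks
    simultaneously, so the squared norms of all its continuations by a letter add up to at most its
    own squared norm. Only squares are summed in this way, which is why the first powers q_p escape.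
    Grunsky's inequality is reached without integrals. Point charges sit at the vertices of regular
    polygons on the circles, the logarithm is regularised to log (|z|^2 + e), and orthogonality of
    roots of unity replaces integration. The outcome is the positivity of a quadratic form whose
    matrix is symmetric once the rows are relabelled by a -> -a; polarisation turns it into an
    operator bound. Analysis over the complex numbers is done through real and imaginary parts, and
    log (1 - q) only ever appears as a power series. *)

Lemma cvg_sum_seq (K : numFieldType) (I : Type) (r : seq I) (P : pred I)
    (F : I -> nat -> K) (l : I -> K) :
  (forall i, P i -> F i @ \oo --> l i) ->
  (fun n => \sum_(i <- r | P i) F i n) @ \oo --> \sum_(i <- r | P i) l i.
Proof.
move=> Fl; elim: r => [|i r IH].
  by under eq_fun do rewrite big_nil; rewrite big_nil; exact: cvg_cst.
rewrite big_cons; under eq_fun do rewrite big_cons.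
by case: ifP => // Pi; apply: cvgD => //; exact: Fl.
Qed.

(** * Complex numbers and geometric series *)

Section ComplexModulus.
Variable R : realType.
Local Notation C := (Cplx R).
Implicit Types (x y z : C) (r : R).

Definition cmod (z : C) : R := ComplexField.Normc.normc z.
Definition cre (z : C) : R := complex.Re z.
Definition cim (z : C) : R := complex.Im z.
Definition rtoc (r : R) : C := r%:C%C.
Definition cconj (z : C) : C := (z^*)%C.

Lemma normE z : `|z| = rtoc (cmod z).
Proof. by case: z. Qed.

Lemma cmod0 : cmod 0 = 0.
Proof. exact: ComplexField.Normc.normc0. Qed.

Lemma cmod1 : cmod 1 = 1.
Proof. exact: ComplexField.Normc.normc1. Qed.

Lemma cmodM x y : cmod (x * y) = cmod x * cmod y.
Proof. exact: ComplexField.Normc.normcM. Qed.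

Lemma cmodV x : cmod x^-1 = (cmod x)^-1.
Proof. exact: ComplexField.Normc.normcV. Qed.

Lemma cmod_div x y : cmod (x / y) = cmod x / cmod y.
Proof. by rewrite cmodM cmodV. Qed.

Lemma cmodN x : cmod (- x) = cmod x.
Proof. exact: normcN. Qed.

Lemma cmodD x y : cmod (x + y) <= cmod x + cmod y.
Proof. exact: le_normcD. Qed.

Lemma cmodB x y : cmod (x - y) = cmod (y - x).
Proof. by rewrite -cmodN opprB. Qed.

Lemma cmod_ge0 x : 0 <= cmod x.
Proof. by case: x => a b; rewrite sqrtr_ge0. Qed.

Lemma cmod_eq0 x : (cmod x == 0) = (x == 0).
Proof.
by apply/eqP/eqP => [|->]; [exact: ComplexField.Normc.eq0_normc | exact: cmod0].
Qed.

Lemma cmod_gt0 x : (0 < cmod x) = (x != 0).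
Proof. by rewrite lt_def cmod_eq0 cmod_ge0 andbT. Qed.

Lemma cmodX x n : cmod (x ^+ n) = cmod x ^+ n.
Proof. by elim: n => [|n IH]; rewrite ?expr0 ?cmod1 // !exprS cmodM IH. Qed.

Lemma cmod_sum (I : Type) (r : seq I) (P : pred I) (F : I -> C) :
  cmod (\sum_(i <- r | P i) F i) <= \sum_(i <- r | P i) cmod (F i).
Proof.
elim/big_rec2: _ => [|i u v _ uv]; first by rewrite cmod0.
by apply: le_trans (cmodD _ _) _; rewrite lerD2l.
Qed.

Lemma cmod_le1D x y : cmod x - cmod y <= cmod (x + y).
Proof.
rewrite lerBlDr; apply: le_trans (_ : cmod (x + y - y) <= _).
  by rewrite addrK.
by apply: le_trans (cmodD _ _) _; rewrite cmodN.
Qed.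

Lemma cmod_real r : 0 <= r -> cmod (rtoc r) = r.
Proof. by move=> r0; rewrite /cmod /= expr0n addr0 sqrtr_sqr ger0_norm. Qed.

Lemma cmod_rtoc r : cmod (rtoc r) = `|r|.
Proof. by rewrite /cmod /= expr0n addr0 sqrtr_sqr. Qed.

Lemma rtoc_nat n : rtoc n%:R = n%:R.
Proof. exact: (rmorph_nat (real_complex R)). Qed.

Lemma cmod_nat n : cmod n%:R = n%:R.
Proof. by rewrite -rtoc_nat cmod_real. Qed.

Lemma cmod_norm z : cmod `|z| = cmod z.
Proof. by rewrite normE cmod_real // cmod_ge0. Qed.

Lemma ltr_cmod1 x : (`|x| < 1) = (cmod x < 1).
Proof. by rewrite normE -[1]/(rtoc 1) ltcR. Qed.

Lemma cmod_sqr z : cmod z ^+ 2 = cre z ^+ 2 + cim z ^+ 2.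
Proof. by case: z => a b; rewrite sqr_sqrtr // addr_ge0 // sqr_ge0. Qed.

Lemma cre_le z : `|cre z| <= cmod z.
Proof.
case: z => a b /=; rewrite /cmod /cre /= -sqrtr_sqr ler_wsqrtr //.
by rewrite lerDl sqr_ge0.
Qed.

Lemma cim_le z : `|cim z| <= cmod z.
Proof.
case: z => a b /=; rewrite /cmod /cim /= -sqrtr_sqr ler_wsqrtr //.
by rewrite lerDr sqr_ge0.
Qed.

Lemma cmod_le_sum z : cmod z <= `|cre z| + `|cim z|.
Proof.
rewrite -(@ler_pXn2r _ 2) ?nnegrE ?addr_ge0 ?cmod_ge0 //.
rewrite cmod_sqr sqrrD !real_normK ?num_real // lerD2r lerDl.
by rewrite mulrn_wge0 // mulr_ge0.
Qed.

Lemma creD x y : cre (x + y) = cre x + cre y. Proof. by case: x; case: y. Qed.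
Lemma cimD x y : cim (x + y) = cim x + cim y. Proof. by case: x; case: y. Qed.
Lemma creN x : cre (- x) = - cre x. Proof. by case: x. Qed.
Lemma cimN x : cim (- x) = - cim x. Proof. by case: x. Qed.
Lemma creB x y : cre (x - y) = cre x - cre y. Proof. by rewrite creD creN. Qed.
Lemma cimB x y : cim (x - y) = cim x - cim y. Proof. by rewrite cimD cimN. Qed.
Lemma creM x y : cre (x * y) = cre x * cre y - cim x * cim y.
Proof. by case: x; case: y. Qed.
Lemma cimM x y : cim (x * y) = cre x * cim y + cim x * cre y.
Proof. by case: x => a b; case: y => c d; rewrite /cim /cre /= addrC; ring. Qed.
Lemma cre1 : cre 1 = 1. Proof. by []. Qed.
Lemma cim1 : cim 1 = 0. Proof. by []. Qed.
Lemma cre_sum (I : Type) (r : seq I) (P : pred I) (F : I -> C) :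
  cre (\sum_(i <- r | P i) F i) = \sum_(i <- r | P i) cre (F i).
Proof. exact: (big_morph cre creD). Qed.
Lemma cim_sum (I : Type) (r : seq I) (P : pred I) (F : I -> C) :
  cim (\sum_(i <- r | P i) F i) = \sum_(i <- r | P i) cim (F i).
Proof. exact: (big_morph cim cimD). Qed.
Lemma cre_rtoc r : cre (rtoc r) = r. Proof. by []. Qed.
Lemma cim_rtoc r : cim (rtoc r) = 0. Proof. by []. Qed.
Lemma cre_rtocM r z : cre (rtoc r * z) = r * cre z.
Proof. by rewrite creM cim_rtoc mul0r subr0. Qed.
Lemma cim_rtocM r z : cim (rtoc r * z) = r * cim z.
Proof. by rewrite cimM cim_rtoc mul0r addr0. Qed.

Lemma rtocM (r s : R) : rtoc (r * s) = rtoc r * rtoc s.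
Proof. exact: (rmorphM (real_complex R)). Qed.
Lemma rtocD (r s : R) : rtoc (r + s) = rtoc r + rtoc s.
Proof. exact: (rmorphD (real_complex R)). Qed.
Lemma rtocN (r : R) : rtoc (- r) = - rtoc r.
Proof. exact: (rmorphN (real_complex R)). Qed.
Lemma rtocX r n : rtoc (r ^+ n) = rtoc r ^+ n.
Proof. exact: (rmorphXn (real_complex R)). Qed.
Lemma rtocV r : rtoc r^-1 = (rtoc r)^-1.
Proof. exact: (fmorphV (real_complex R)). Qed.
Lemma rtoc_sum (I : Type) (r : seq I) (P : pred I) (F : I -> R) :
  rtoc (\sum_(i <- r | P i) F i) = \sum_(i <- r | P i) rtoc (F i).
Proof. exact: (rmorph_sum (real_complex R)). Qed.
Lemma rtoc_inj : injective rtoc.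
Proof. exact: complexI. Qed.

Lemma cplx_ext x y : cre x = cre y -> cim x = cim y -> x = y.
Proof. by case: x => a b; case: y => c d /= -> ->. Qed.

Lemma cmod_conj z : cmod (cconj z) = cmod z.
Proof. by case: z => a b; rewrite /cmod /= sqrrN. Qed.
Lemma cconj0 : cconj 0 = 0.
Proof. exact: (rmorph0 conjc). Qed.
Lemma cconj1 : cconj 1 = 1.
Proof. exact: (rmorph1 conjc). Qed.
Lemma cconjM x y : cconj (x * y) = cconj x * cconj y.
Proof. exact: (rmorphM conjc). Qed.
Lemma cconjX x n : cconj (x ^+ n) = cconj x ^+ n.
Proof. exact: (rmorphXn conjc). Qed.
Lemma cconj_sum (I : Type) (r : seq I) (P : pred I) (F : I -> C) :
  cconj (\sum_(i <- r | P i) F i) = \sum_(i <- r | P i) cconj (F i).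
Proof. exact: (rmorph_sum conjc). Qed.
Lemma cconjK z : cconj (cconj z) = z.
Proof. exact: conjcK. Qed.
Lemma mul_cconj z : z * cconj z = rtoc (cmod z ^+ 2).
Proof.
rewrite cmod_sqr; apply: cplx_ext.
  by rewrite creM cre_rtoc; case: z => a b; rewrite /cre /cim /=; ring.
by rewrite cimM cim_rtoc; case: z => a b; rewrite /cre /cim /=; ring.
Qed.
Lemma addr_cconj z : z + cconj z = rtoc (2 * cre z).
Proof.
apply: cplx_ext; rewrite ?creD ?cimD ?cre_rtoc ?cim_rtoc.
  by case: z => a b; rewrite /cre /=; ring.
by case: z => a b; rewrite /cim /=; ring.
Qed.

Lemma cvg_cmod (u : nat -> C) (l : C) :
  u @ \oo --> l <-> (fun n => cmod (u n - l)) @ \oo --> (0 : R).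
Proof.
split => [/cvgrPdist_lt ul|/cvgrPdist_lt ul].
  apply/cvgrPdist_lt => e e0.
  have e0' : (0 : C) < rtoc e by rewrite -[0]/(rtoc 0) ltcR.
  near=> n.
  have : `|l - u n| < rtoc e by near: n; exact: ul.
  by rewrite normE ltcR sub0r normrN ger0_norm ?cmod_ge0 // cmodB.
apply/cvgrPdist_lt => e e0.
have [eIm eRe] : cim e = 0 /\ 0 < cre e.
  by move: e0; case: e => a b; rewrite ltcE /= => /andP[/eqP -> ?].
have eE : e = rtoc (cre e) by apply: cplx_ext.
rewrite eE; near=> n.
rewrite normE ltcR cmodB -[cmod _]ger0_norm ?cmod_ge0 // -normrN -sub0r.
by near: n; exact: ul.
Unshelve. all: by end_near. Qed.

Lemma cvg_cmodP (u : nat -> C) (l : C) :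
  u @ \oo --> l <->
  forall e : R, 0 < e -> exists N, forall n, (N <= n)%N -> cmod (u n - l) < e.
Proof.
rewrite cvg_cmod; split => [/cvgrPdist_lt ul e e0|ul].
  have [N _ NP] := ul e e0; exists N => n Nn.
  by have := NP n Nn; rewrite sub0r normrN ger0_norm ?cmod_ge0.
apply/cvgrPdist_lt => e e0; have [N NP] := ul e e0.
by exists N => // n /NP; rewrite sub0r normrN ger0_norm ?cmod_ge0.
Qed.

Lemma cvg_reim (u : nat -> C) (l : C) :
  (fun n => cre (u n)) @ \oo --> cre l -> (fun n => cim (u n)) @ \oo --> cim l ->
  u @ \oo --> l.
Proof.
move=> ur ui; apply/cvg_cmod.
apply: (@squeeze_cvgr _ _ _ _ (cst 0)
  (fun n => `|cre (u n) - cre l| + `|cim (u n) - cim l|)).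
- by near=> n; rewrite cmod_ge0 /= -creB -cimB cmod_le_sum.
- exact: cvg_cst.
- rewrite -[0]addr0; apply: cvgD; apply/norm_cvg0P/subr_cvg0 => //.
Unshelve. all: by end_near. Qed.

Lemma cvg_cre (u : nat -> C) (l : C) :
  u @ \oo --> l -> (fun n => cre (u n)) @ \oo --> cre l.
Proof.
move=> /cvg_cmodP ul; apply/cvgrPdist_lt => e /ul[N NP].
by exists N => // n /NP; rewrite -creB cmodB; apply: le_lt_trans (cre_le _).
Qed.

Lemma cvg_cim (u : nat -> C) (l : C) :
  u @ \oo --> l -> (fun n => cim (u n)) @ \oo --> cim l.
Proof.
move=> /cvg_cmodP ul; apply/cvgrPdist_lt => e /ul[N NP].
by exists N => // n /NP; rewrite -cimB cmodB; apply: le_lt_trans (cim_le _).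
Qed.

Lemma cvg_cmod_fun (u : nat -> C) (l : C) :
  u @ \oo --> l -> (fun n => cmod (u n)) @ \oo --> cmod l.
Proof.
move=> /cvg_cmodP ul; apply/cvgrPdist_lt => e /ul[N NP].
exists N => // n /NP; apply: le_lt_trans; rewrite ler_norml.
have h1 := cmod_le1D l (u n - l); have h2 := cmod_le1D (u n) (l - u n).
rewrite addrCA subrr addr0 in h1; rewrite addrCA subrr addr0 in h2.
rewrite [cmod (l - _)]cmodB in h2.
by apply/andP; split; lra.
Qed.

Lemma cvg_cmod_le (u : nat -> C) (l : C) (B : R) :
  u @ \oo --> l -> (forall n, cmod (u n) <= B) -> cmod l <= B.
Proof.
move=> /cvg_cmod_fun ul uB; rewrite -(cvg_lim _ ul) //.
by apply: limr_le; [apply: cvgP ul | near=> n; exact: uB].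
Unshelve. all: by end_near. Qed.

End ComplexModulus.

(** * Complex series, the exponential and the series of -log (1 - z) *)

Section ComplexSeries.
Variable R : realType.
Local Notation C := (Cplx R).

Lemma cvgn_series_dom (u : nat -> C) (v : nat -> R) :
  (forall n, cmod (u n) <= v n) -> cvgn (series v) -> cvgn (series u).
Proof.
move=> uv cv.
have v0 n : 0 <= v n by exact: le_trans (cmod_ge0 _) (uv n).
have aux (f : C -> R) : (forall z, `|f z| <= cmod z) -> cvgn (series (f \o u)).
  move=> fle; apply: (@normed_cvg _ R^o).
  apply: (@series_le_cvg _ _ v) => // n; first exact: normr_ge0.
  exact: le_trans (fle _) (uv n).
have cr := aux _ (@cre_le R); have ci := aux _ (@cim_le R).
apply/cvg_ex; exists (Complex (limn (series (@cre R \o u)))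
                              (limn (series (@cim R \o u))) : C).
apply: cvg_reim => /=.
  rewrite /cre /= -/(cre _); apply: cvg_trans cr.
  by apply: near_eq_cvg; near=> n; rewrite /series /= -cre_sum.
rewrite /cim /= -/(cim _); apply: cvg_trans ci.
by apply: near_eq_cvg; near=> n; rewrite /series /= -cim_sum.
Unshelve. all: by end_near. Qed.

Lemma sum_geo_le (t : R) n : 0 <= t -> t < 1 ->
  \sum_(0 <= i < n) t ^+ i <= (1 - t)^-1.
Proof.
move=> t0 t1; have t1' : 0 < 1 - t by rewrite subr_gt0.
rewrite -[leRHS]mul1r ler_pdivlMr// mulrC big_mkord.
by rewrite -opprB mulNr -subrX1 opprB gerBl exprn_ge0.
Qed.

Lemma is_cvg_geo (K t : R) : 0 <= t -> t < 1 ->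
  cvgn (series (fun n => K * t ^+ n)).
Proof. by move=> t0 t1; apply: is_cvg_geometric_series; rewrite ger0_norm. Qed.

Lemma cvgn_series_geo (u : nat -> C) (K t : R) : 0 <= t -> t < 1 ->
  (forall n, cmod (u n) <= K * t ^+ n) -> cvgn (series u).
Proof. by move=> t0 t1 /cvgn_series_dom; apply; exact: is_cvg_geo. Qed.

Lemma series_geo_le (u : nat -> C) (K t : R) : 0 <= t -> t < 1 ->
  (forall n, cmod (u n) <= K * t ^+ n) ->
  forall n, cmod (series u n) <= K / (1 - t).
Proof.
move=> t0 t1 uK n; apply: le_trans (cmod_sum _ _ _) _.
have K0 : 0 <= K by have := le_trans (cmod_ge0 _) (uK 0%N); rewrite expr0 mulr1.
apply: le_trans (_ : \sum_(0 <= i < n) K * t ^+ i <= _).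
  by apply: ler_sum => i _; exact: uK.
by rewrite -mulr_sumr ler_wpM2l // sum_geo_le.
Qed.

Lemma limn_series_geo_le (u : nat -> C) (K t : R) : 0 <= t -> t < 1 ->
  (forall n, cmod (u n) <= K * t ^+ n) ->
  cmod (limn (series u)) <= K / (1 - t).
Proof.
move=> t0 t1 uK; apply: cvg_cmod_le (series_geo_le t0 t1 uK).
exact: cvgn_series_geo uK.
Qed.

Lemma series_tail_geo_le (u : nat -> C) (K t : R) N : 0 <= t -> t < 1 ->
  (forall n, cmod (u n) <= K * t ^+ n) ->
  cmod (limn (series u) - series u N) <= K * t ^+ N / (1 - t).
Proof.
move=> t0 t1 uK; pose v n := u (n + N)%N.
have vK n : cmod (v n) <= K * t ^+ N * t ^+ n.
  by rewrite -mulrA -exprD addnC uK.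
apply: (@cvg_cmod_le _ (fun n => series u (n + N)%N - series u N)).
  apply: cvgB; last exact: cvg_cst.
  by have := cvgn_series_geo t0 t1 uK; rewrite -(cvg_shiftn N).
move=> n.
have -> : series u (n + N)%N - series u N = series v n.
  by rewrite sub_series_geq ?leq_addl // -{1}(add0n N) big_addn addnK.

exact: series_geo_le.
Qed.

Lemma cexpD (x y : C) : cexp (x + y) = cexp x * cexp y.
Proof.
case: x => a b; case: y => c d; apply: cplx_ext.
  by rewrite creM /cre /cim /= expRD cosD; ring.
by rewrite cimM /cre /cim /= expRD sinD; ring.
Qed.

Lemma cexp0 : cexp 0 = 1 :> C.
Proof. by rewrite /cexp /= expR0 cos0 sin0 mul1r mul1r. Qed.

Lemma cexpNl (x : C) : cexp (- x) * cexp x = 1.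
Proof. by rewrite -cexpD addNr cexp0. Qed.

Lemma cexp_sum (I : Type) (r : seq I) (P : pred I) (F : I -> C) :
  cexp (\sum_(i <- r | P i) F i) = \prod_(i <- r | P i) cexp (F i).
Proof. exact: (big_morph _ cexpD cexp0). Qed.

Lemma cmod_cexp (x : C) : cmod (cexp x) = expR (cre x).
Proof.
case: x => a b; rewrite /cmod /cre /= !exprMn -mulrDr cos2Dsin2 mulr1 sqrtr_sqr.
by rewrite ger0_norm // expR_ge0.
Qed.

Lemma cre_cexp (x : C) : cre (cexp x) = expR (cre x) * cos (cim x).
Proof. by case: x. Qed.

Lemma cim_cexp (x : C) : cim (cexp x) = expR (cre x) * sin (cim x).
Proof. by case: x. Qed.

Lemma cvg_cexp (u : nat -> C) (l : C) :
  u @ \oo --> l -> (fun n => cexp (u n)) @ \oo --> cexp l.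
Proof.
move=> ul; have ur := cvg_cre ul; have ui := cvg_cim ul.
apply: cvg_reim.
  rewrite cre_cexp; under eq_fun do rewrite cre_cexp.
  apply: cvgM; first exact: (continuous_cvg _ (@continuous_expR R _) ur).
  exact: (continuous_cvg _ (@continuous_cos R _) ui).
rewrite cim_cexp; under eq_fun do rewrite cim_cexp.
apply: cvgM; first exact: (continuous_cvg _ (@continuous_expR R _) ur).
exact: (continuous_cvg _ (@continuous_sin R _) ui).
Qed.

(** The N-th partial sum of the power series of -log (1 - z). *)
Definition plog (N : nat) (z : C) : C := \sum_(n < N) z ^+ n.+1 / n.+1%:R.

Lemma cmod_plog N z : cmod z < 1 -> cmod (plog N z) <= cmod z / (1 - cmod z).
Proof.
move=> z1; rewrite /plog -(big_mkord xpredT (fun n => z ^+ n.+1 / n.+1%:R)).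
apply: (@series_geo_le _ (cmod z) (cmod z)) => // [|n]; first exact: cmod_ge0.
rewrite cmod_div cmod_nat cmodX -exprS ler_pdivrMr ?ltr0n //.
by rewrite ler_peMr ?exprn_ge0 ?cmod_ge0 // ler1n.
Qed.

(** The polynomial in the real variable t with value f (plog_N (t q)), for f the real or the
    imaginary part: real derivatives and the mean value theorem then apply. *)
Let rpl N (f : C -> R) (q : C) : {poly R} :=
  \sum_(n < N) (f (q ^+ n.+1) / n.+1%:R) *: 'X^(n.+1).

Let rpl_deriv N f q (t : R) :
  (rpl N f q)^`().[t] = \sum_(n < N) f (q ^+ n.+1) * t ^+ n.
Proof.
rewrite /rpl linear_sum /= horner_sum; apply: eq_bigr => n _.
rewrite derivZ derivXn hornerZ hornerMn hornerXn mulrnAr -mulrnAl.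
by rewrite -[_ / _ *+ _]mulr_natr divfK ?pnatr_eq0.
Qed.

Let rplE N f q (t : R) : (forall r z, f (rtoc r * z) = r * f z) ->
  (forall u v, f (u + v) = f u + f v) -> f 0 = 0 ->
  (rpl N f q).[t] = f (plog N (rtoc t * q)).
Proof.
move=> fZ fD f0; rewrite /rpl horner_sum /plog (big_morph f fD f0).
apply: eq_bigr => n _; rewrite hornerZ hornerXn exprMn -rtocX.
by rewrite [X in _ = f X]mulrAC -rtoc_nat -rtocV -rtocM fZ mulrC mulrA [RHS]mulrAC.
Qed.

(** G (t) = exp (plog_N (t q)) (1 - t q) has the derivative E (t) = - exp (plog_N (t q)) q (t q)^N,
    since the derivative of the partial sum telescopes against 1 - t q. The mean value theorem on
    [0, 1], used once for the real and once for the imaginary part, gives the factor 2. *)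
Lemma cexp_plog_err N (q : C) : cmod q < 1 ->
  cmod (cexp (plog N q) * (1 - q) - 1) <=
  2 * expR (cmod q / (1 - cmod q)) * cmod q ^+ N.
Proof.
move=> q1; set K := expR _.
pose A := rpl N (@cre R) q; pose B := rpl N (@cim R) q.
pose q1' := cre q; pose q2 := cim q.
pose E t := - cexp (plog N (rtoc t * q)) * q * (rtoc t * q) ^+ N.
pose G t := cexp (plog N (rtoc t * q)) * (1 - rtoc t * q).
have AE t : A.[t] = cre (plog N (rtoc t * q)).
  by apply: rplE; [exact: cre_rtocM | exact: creD |].
have BE t : B.[t] = cim (plog N (rtoc t * q)).
  by apply: rplE; [exact: cim_rtocM | exact: cimD |].
have key t : let S := \sum_(n < N) q ^+ n.+1 * rtoc t ^+ n in
    S * (1 - rtoc t * q) = q - q * (rtoc t * q) ^+ N.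
  rewrite /=; under eq_bigr do rewrite exprS -mulrA -exprMn [q * rtoc t]mulrC.
  rewrite -mulr_sumr -mulrA -[1 - _]opprB mulrN [_ * (_ - 1)]mulrC -subrX1.
  by rewrite opprB mulrBr mulr1.
have dA t : A^`().[t] = cre (\sum_(n < N) q ^+ n.+1 * rtoc t ^+ n).
  rewrite rpl_deriv cre_sum; apply: eq_bigr => n _.
  by rewrite -rtocX [q ^+ _ * rtoc _]mulrC cre_rtocM mulrC.
have dB t : B^`().[t] = cim (\sum_(n < N) q ^+ n.+1 * rtoc t ^+ n).
  rewrite rpl_deriv cim_sum; apply: eq_bigr => n _.
  by rewrite -rtocX [q ^+ _ * rtoc _]mulrC cim_rtocM mulrC.
have reG t : cre (G t) =
    expR A.[t] * (cos B.[t] * (1 - t * q1') + sin B.[t] * (t * q2)).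
  rewrite /G creM creB cimB cre_rtocM cim_rtocM cre_cexp cim_cexp -AE -BE.
  by rewrite cre1 cim1 /q1' /q2; ring.
have imG t : cim (G t) =
    expR A.[t] * (sin B.[t] * (1 - t * q1') - cos B.[t] * (t * q2)).
  rewrite /G cimM creB cimB cre_rtocM cim_rtocM cre_cexp cim_cexp -AE -BE.
  by rewrite cre1 cim1 /q1' /q2; ring.
have kre t : A^`().[t] * (1 - t * q1') + B^`().[t] * (t * q2)
    = q1' - cre (q * (rtoc t * q) ^+ N).
  rewrite dA dB -creB -key creM creB cimB cre_rtocM cim_rtocM.
  by rewrite cre1 cim1 /q1' /q2; ring.
have kim t : B^`().[t] * (1 - t * q1') - A^`().[t] * (t * q2)
    = q2 - cim (q * (rtoc t * q) ^+ N).
  rewrite dA dB -cimB -key cimM creB cimB cre_rtocM cim_rtocM.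
  by rewrite cre1 cim1 /q1' /q2; ring.
have reE t : cre (E t) = - expR A.[t] *
  (cos B.[t] * cre (q * (rtoc t * q) ^+ N) -
   sin B.[t] * cim (q * (rtoc t * q) ^+ N)).
  by rewrite /E -mulrA [LHS]creM creN cimN cre_cexp cim_cexp -AE -BE; ring.
have imE t : cim (E t) = - expR A.[t] *
  (cos B.[t] * cim (q * (rtoc t * q) ^+ N) +
   sin B.[t] * cre (q * (rtoc t * q) ^+ N)).
  by rewrite /E -mulrA [LHS]cimM creN cimN cre_cexp cim_cexp -AE -BE; ring.
have tq t : t \in `]0, 1[ -> cmod (rtoc t * q) <= cmod q.
  move=> /itvP t01; rewrite cmodM cmod_real ?t01 // ler_piMl ?cmod_ge0 //.
  by rewrite t01.
have EK t : t \in `]0, 1[ -> cmod (E t) <= K * cmod q ^+ N.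
  move=> t01; have tqq := tq t t01.
  rewrite /E !cmodM cmodN cmodX cmod_cexp -mulrA.
  apply: ler_pM; rewrite ?expR_ge0 ?mulr_ge0 ?exprn_ge0 ?cmod_ge0 //.
    rewrite ler_expR; apply: le_trans (ler_norm _) _.
    apply: le_trans (cre_le _) _.
    apply: le_trans (cmod_plog _ (le_lt_trans tqq q1)) _.
    have h0 := cmod_ge0 (rtoc t * q).
    by apply: ler_pM; rewrite ?invr_ge0 ?lef_pV2 ?posrE; lra.
  rewrite -[leRHS]mul1r; apply: ler_pM; rewrite ?exprn_ge0 ?cmod_ge0 //.
    exact: ltW.
  by rewrite lerXn2r ?nnegrE ?cmod_ge0.
have cont (f : R -> R) (df : R -> R) :
    (forall x : R, is_derive x (1 : R) f (df x)) -> {within `[0, 1], continuous f}.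
  move=> fd; apply: derivable_within_continuous => x _.
  exact: ex_derive.
have reD (t : R) : is_derive t (1 : R) (fun t => cre (G t)) (cre (E t)).
  rewrite (_ : (fun t => cre (G t)) = (fun t => expR A.[t] *
    (cos B.[t] * (1 - t * q1') + sin B.[t] * (t * q2)))); last exact/funext.
  apply: is_derive_eq; rewrite reE /GRing.scale /= /GRing.scale /=.
  have := kre t; have := kim t; set a' := A^`().[t]; set b' := B^`().[t].
  move=> h2 h1.
  have -> : cre (q * (rtoc t * q) ^+ N) =
    q1' - (a' * (1 - t * q1') + b' * (t * q2)) by rewrite h1; ring.
  have -> : cim (q * (rtoc t * q) ^+ N) =
    q2 - (b' * (1 - t * q1') - a' * (t * q2)) by rewrite h2; ring.
  ring.
have imD (t : R) : is_derive t (1 : R) (fun t => cim (G t)) (cim (E t)).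
  rewrite (_ : (fun t => cim (G t)) = (fun t => expR A.[t] *
    (sin B.[t] * (1 - t * q1') - cos B.[t] * (t * q2)))); last exact/funext.
  apply: is_derive_eq; rewrite imE /GRing.scale /= /GRing.scale /=.
  have := kre t; have := kim t; set a' := A^`().[t]; set b' := B^`().[t].
  move=> h2 h1.
  have -> : cre (q * (rtoc t * q) ^+ N) =
    q1' - (a' * (1 - t * q1') + b' * (t * q2)) by rewrite h1; ring.
  have -> : cim (q * (rtoc t * q) ^+ N) =
    q2 - (b' * (1 - t * q1') - a' * (t * q2)) by rewrite h2; ring.
  ring.
have G0 : G 0 = 1.
  rewrite /G mul0r subr0 mulr1 /plog big1 ?cexp0 // => i _.
  by rewrite expr0n mul0r.
have G1 : G 1 = cexp (plog N q) * (1 - q) by rewrite /G mul1r.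
rewrite -G1 -G0; apply: le_trans (cmod_le_sum _) _.
rewrite creB cimB -mulrA mulrDl mul1r.
apply: lerD.
  have [t t01 ->] := MVT ltr01 (fun x _ => reD x) (cont _ _ reD).
  by rewrite subr0 mulr1; apply: le_trans (cre_le _) (EK t t01).
have [t t01 ->] := MVT ltr01 (fun x _ => imD x) (cont _ _ imD).
by rewrite subr0 mulr1; apply: le_trans (cim_le _) (EK t t01).
Qed.

(** The value of -log (1 - q) given by its power series, so that no branch has to be chosen. *)
Definition clog1 (q : C) : C := limn (plog ^~ q).

Lemma plog_series q : plog ^~ q = series (fun n => q ^+ n.+1 / n.+1%:R).
Proof. by apply/funext => N; rewrite /plog /series /= big_mkord. Qed.

Lemma plog_term_le (q : C) n :
  cmod (q ^+ n.+1 / n.+1%:R) <= cmod q * cmod q ^+ n.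
Proof.
rewrite cmod_div cmod_nat cmodX -exprS ler_pdivrMr ?ltr0n //.
by rewrite ler_peMr ?exprn_ge0 ?cmod_ge0 // ler1n.
Qed.

Lemma cvg_plog q : cmod q < 1 -> (plog ^~ q) @ \oo --> clog1 q.
Proof.
move=> q1; rewrite /clog1 plog_series.
exact: cvgn_series_geo (cmod_ge0 q) q1 (plog_term_le q).
Qed.

Lemma clog1_tail q N : cmod q < 1 ->
  cmod (clog1 q - plog N q) <= cmod q ^+ N.+1 / (1 - cmod q).
Proof.
move=> q1; rewrite /clog1 plog_series exprS -[plog N q]/(plog ^~ q N).
by rewrite plog_series; apply: series_tail_geo_le (cmod_ge0 q) q1 (plog_term_le q).
Qed.

Lemma cexpN_clog1 q : cmod q < 1 -> cexp (- clog1 q) = 1 - q.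
Proof.
move=> q1.
have qn : (fun N => cexp (plog N q) * (1 - q)) @ \oo --> (1 : C).
  apply/cvg_cmod; set K := 2 * expR (cmod q / (1 - cmod q)).
  apply: (@squeeze_cvgr _ _ _ _ (cst 0) (geometric K (cmod q))).
  - near=> n; rewrite cmod_ge0 /=; exact: cexp_plog_err.
  - exact: cvg_cst.
  - by apply: cvg_geometric; rewrite ger0_norm // cmod_ge0.
have qn' : (fun N => cexp (plog N q) * (1 - q)) @ \oo -->
    cexp (clog1 q) * (1 - q).
  by apply: cvgM; [apply: cvg_cexp; exact: cvg_plog | exact: cvg_cst].
have e : cexp (clog1 q) * (1 - q) = 1 .
  exact: cvg_unique qn' qn.
by rewrite -[LHS]mulr1 -[X in _ * X = _]e [LHS]mulrA cexpNl mul1r.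
Unshelve. all: by end_near. Qed.

(** The bridge from the real logarithms in the energy of charges to power series. *)
Lemma ln_cmod_1B q : cmod q < 1 -> ln (cmod (1 - q) ^+ 2) = - (2 * cre (clog1 q)).
Proof.
move=> q1; rewrite -cexpN_clog1 // cmod_cexp creN.
by rewrite -expRM_natl expRK mulrN.
Qed.

End ComplexSeries.

(** * Grunsky's inequality *)

Section LogEnergy.
Variable R : realType.
Local Notation C := (Cplx R).

(** Schur's product theorem for entrywise powers: one factor of the Gram matrix is absorbed into the
    charges, which become c_i u_mi for each m. *)
Lemma gram_exp_ge0 (I D : finType) (u : D -> I -> R) n (c : I -> R) :
  0 <= \sum_i \sum_j c i * c j * (\sum_m u m i * u m j) ^+ n.
Proof.
elim: n c => [|n IH] c.
  under eq_bigr do (under eq_bigr do rewrite expr0 mulr1).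
  by rewrite -big_distrlr /= -expr2 sqr_ge0.
have -> : \sum_i \sum_j c i * c j * (\sum_m u m i * u m j) ^+ n.+1 =
    \sum_m \sum_i \sum_j (c i * u m i) * (c j * u m j) *
       (\sum_m' u m' i * u m' j) ^+ n.
  rewrite [RHS]exchange_big /=; apply: eq_bigr => i _.
  rewrite [RHS]exchange_big /=; apply: eq_bigr => j _.
  by rewrite exprS mulrA mulr_sumr mulr_suml; apply: eq_bigr => m _; ring.
by apply: sumr_ge0 => m _; exact: IH.
Qed.

(* With D_i = |z_i|^2 + e one has |z_i - z_j|^2 + e = D_i D_j (1 - k_ij) / e
   for a Gram matrix k. The entrywise powers of k are Gram matrices, so
   -log (1 - k) is positive semidefinite; the terms in D_i drop out because the
   charges sum to 0. *)
Lemma log_energy_ge0 (I : finType) (z : I -> C) (c : I -> R) (e : R) :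
  \sum_i c i = 0 -> 0 < e ->
  0 <= \sum_i \sum_j c i * c j * - ln (cmod (z i - z j) ^+ 2 + e).
Proof.
move=> c0 e0.
pose D i := cmod (z i) ^+ 2 + e.
have D0 i : 0 < D i by rewrite ltr_wpDl // sqr_ge0.
pose k i j := 1 - (cmod (z i - z j) ^+ 2 + e) * e / (D i * D j).
(* The numerator of k_ij is |z_i|^2 |z_j|^2 + 2 e Re (z_i conj z_j), an inner product of vectors
   with these three real coordinates. *)
pose u (m : 'I_3) i : R :=
  (if m == 0 :> nat then cmod (z i) ^+ 2
   else Num.sqrt (2 * e) * (if m == 1 :> nat then cre (z i) else cim (z i)))
  / D i.
have kE i j : k i j = \sum_m u m i * u m j.
  rewrite !big_ord_recl big_ord0 /u /= addr0.
  have De i' : D i' != 0 by rewrite gt_eqF.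
  have := De i; have := De j; rewrite /k /D !cmod_sqr creB cimB => dj di.
  have s2 : Num.sqrt (2 * e) ^+ 2 = 2 * e by rewrite sqr_sqrtr ?mulr_ge0 ?ltW.
  move: s2; set s := Num.sqrt _ => s2.
  transitivity (((cre (z i) ^+ 2 + cim (z i) ^+ 2) * (cre (z j) ^+ 2 + cim (z j) ^+ 2)
   + s ^+ 2 * (cre (z i) * cre (z j) + cim (z i) * cim (z j))) /
   ((cre (z i) ^+ 2 + cim (z i) ^+ 2 + e) * (cre (z j) ^+ 2 + cim (z j) ^+ 2 + e))).
    by rewrite s2; field; apply/andP; split.
  by field; apply/andP; split.
have k1 i j : `|k i j| < 1.
  have DD : 0 < D i * D j by rewrite mulr_gt0.
  rewrite ltr_norml /k; apply/andP; split; last first.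
    by rewrite ltrBlDr ltrDl divr_gt0 // mulr_gt0 // ltr_wpDl // sqr_ge0.
  rewrite ltrBrDl -ltrBrDr opprK ltr_pdivrMr // /D.
  have h : cmod (z i - z j) ^+ 2 <= 2 * cmod (z i) ^+ 2 + 2 * cmod (z j) ^+ 2.
    rewrite !cmod_sqr creB cimB.
    have := sqr_ge0 (cre (z i) + cre (z j)).
    have := sqr_ge0 (cim (z i) + cim (z j)).
    by nra.
  have := sqr_ge0 (cmod (z i)); have := sqr_ge0 (cmod (z j)).
  move: h; set a := cmod (z i) ^+ 2; set b := cmod (z j) ^+ 2; set d := _ ^+ 2.
  by move=> h a0 b0; nra.
have kc i j : cmod (rtoc (k i j)) < 1 by rewrite cmod_rtoc.
have lnk i j : ln (1 - k i j) = - cre (clog1 (rtoc (k i j))).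
  have := ln_cmod_1B (kc i j); rewrite -rtocN -[1]/(rtoc 1) -rtocD cmod_rtoc.
  have k0 : 0 < 1 - k i j.
    by rewrite subr_gt0; apply: le_lt_trans (ler_norm _) (k1 i j).
  rewrite gtr0_norm // lnXn // mulr2n => h; lra.
have Le i j : - ln (cmod (z i - z j) ^+ 2 + e) =
    cre (clog1 (rtoc (k i j))) - ln (D i) - ln (D j) + ln e.
  have -> : cmod (z i - z j) ^+ 2 + e = (1 - k i j) * (D i * D j) / e.
    rewrite /k opprB addrCA subrr addr0 divfK ?mulf_neq0 ?gt_eqF //.
    by rewrite mulfK // gt_eqF.
  have k0 : 0 < 1 - k i j.
    by rewrite subr_gt0; apply: le_lt_trans (ler_norm _) (k1 i j).
  rewrite ln_div ?lnM ?posrE ?mulr_gt0 // lnk; ring.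
have -> : \sum_i \sum_j c i * c j * - ln (cmod (z i - z j) ^+ 2 + e) =
    \sum_i \sum_j c i * c j * cre (clog1 (rtoc (k i j))).
  transitivity (\sum_i \sum_j c i * c j * cre (clog1 (rtoc (k i j))) +
     ((\sum_i c i * (ln e - ln (D i))) * \sum_j c j -
     (\sum_i c i) * (\sum_j c j * ln (D j)))); last by rewrite c0; ring.
  rewrite !mulr_suml -sumrB -big_split /=; apply: eq_bigr => i _.
  rewrite !mulr_sumr -sumrB -big_split /=; apply: eq_bigr => j _.
  by rewrite Le; ring.
have cv : (fun N => \sum_i \sum_j c i * c j * cre (plog N (rtoc (k i j)))) @ \oo
   --> \sum_i \sum_j c i * c j * cre (clog1 (rtoc (k i j))).
  apply: cvg_sum_seq => i _; apply: cvg_sum_seq => j _.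
  by apply: cvgMr; apply: cvg_cre; exact: cvg_plog.
rewrite -(cvg_lim _ cv) //; apply: limr_ge; first exact: cvgP cv.
near=> N.
have -> : \sum_i \sum_j c i * c j * cre (plog N (rtoc (k i j))) =
   \sum_(n < N) n.+1%:R^-1 *
     \sum_i \sum_j c i * c j * (\sum_m u m i * u m j) ^+ n.+1.
  under [RHS]eq_bigr do rewrite mulr_sumr.
  rewrite [RHS]exchange_big /=; apply: eq_bigr => i _.
  under [RHS]eq_bigr do rewrite mulr_sumr.
  rewrite [RHS]exchange_big /=; apply: eq_bigr => j _.
  rewrite /plog cre_sum mulr_sumr; apply: eq_bigr => n _.
  by rewrite -rtocX -rtoc_nat -rtocV -rtocM cre_rtoc kE; ring.
apply: sumr_ge0 => n _; rewrite mulr_ge0 ?invr_ge0 ?ler0n //.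
exact: gram_exp_ge0.
Unshelve. all: by end_near. Qed.

End LogEnergy.

Lemma sum_ord_widen (V : nmodType) (F : nat -> V) m n :
  (m <= n)%N -> (forall l, (m <= l)%N -> F l = 0) ->
  \sum_(l < n) F l = \sum_(l < m) F l.
Proof.
move=> mn F0; rewrite (big_ord_widen n F mn) [RHS]big_mkcond /=.
by apply: eq_bigr => l _; case: ltnP => // /F0.
Qed.

(** A finitely supported double series summed by total degree n + 1. As the support has degree at
    most 2 K, the bound on M lets every term occur. *)
Lemma sum_triangle (V : nmodType) (f : nat -> nat -> V) K M :
  (forall k l, (K < k)%N || (K < l)%N || (k == 0)%N || (l == 0)%N -> f k l = 0) ->
  (2 * K <= M)%N ->
  \sum_(n < M) \sum_(l < n.+2) f (n.+1 - l)%N l =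
  \sum_(k < K) \sum_(l < K) f k.+1 l.+1.
Proof.
move=> f0 KM.
pose F n l := \sum_(k < K.+1) (if (k + l == n.+1)%N then f k l else 0).
have FE n l : (l < n.+2)%N -> f (n.+1 - l)%N l = F n l.
  move=> ln; rewrite /F; have [kK|Kk] := leqP (n.+1 - l) K.
    rewrite (bigD1 (Ordinal (kK : (n.+1 - l < K.+1)%N))) //= subnK // eqxx.
    rewrite big1 ?addr0 // => k /negbTE kn; case: ifP => // /eqP e.
    by move: kn; rewrite -val_eqE /= -e addnK eqxx.
  rewrite f0 ?Kk // big1 // => k _; case: ifP => // /eqP e.
  by move: Kk; rewrite -e addnK ltnNge -ltnS ltn_ord.
have FK n : \sum_(l < n.+2) f (n.+1 - l)%N l = \sum_(l < K.+1) F n l.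
  transitivity (\sum_(l < n.+2) F n l).
    by apply: eq_bigr => l _; exact: FE.
  rewrite -(@sum_ord_widen _ (F n) n.+2 (n.+2 + K.+1)) ?leq_addr //; last first.
    move=> l nl; rewrite /F big1 // => k _; case: ifP => // /eqP e.
    by move: nl; rewrite -e ltnNge leq_addl.
  rewrite -(@sum_ord_widen _ (F n) K.+1 (n.+2 + K.+1)) ?leq_addl // => l Kl.
  by rewrite /F big1 // => k _; case: ifP => // _; rewrite f0 // Kl orbT.
under eq_bigr do rewrite FK.
rewrite exchange_big /= big_ord_recl /= big1 ?add0r; last first.
  move=> n _; rewrite /F big1 // => k _; case: ifP => // _.
  by rewrite f0 // eqxx !orbT.
rewrite [RHS]exchange_big /=; apply: eq_bigr => l _.
rewrite exchange_big /= big_ord_recl /= big1 ?add0r; last first.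
  by move=> n _; case: ifP => // _; rewrite f0 // orbT.
apply: eq_bigr => k _; rewrite /bump /= !add1n.
have klM : (k + l.+1 < M)%N.
  by apply: leq_trans KM; have := ltn_ord k; have := ltn_ord l; lia.
rewrite (bigD1 (Ordinal klM)) //= addSn eqxx big1 ?addr0 // => n.
by rewrite -val_eqE /= eqSS eq_sym => /negbTE ->.
Qed.

(** * Roots of unity and charges with prescribed Fourier coefficients *)

Section RootsOfUnity.
Variable R : realType.
Local Notation C := (Cplx R).

Lemma prim_root_exists n : (0 < n)%N -> exists z : C, n.-primitive_root z.
Proof.
move=> n0; have [r] := closed_field_poly_normal ('X^n - 1 : {poly C}).
rewrite (monicP (monicXnsubC 1 n0)) scale1r => rE.
have ur : uniq r.
  by rewrite -separable_prod_XsubC -rE separable_Xn_sub_1 // pnatr_eq0 -lt0n.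
have /hasP[z _ zn] : has n.-primitive_root r; last by exists z.
apply: has_prim_root => //.
  by apply/allP => z; rewrite -root_prod_XsubC -rE.
by rewrite -ltnS -(size_prod_XsubC r id) -rE size_XnsubC.
Qed.

Variables (N : nat) (om : C).
Hypotheses (N0 : (0 < N)%N) (om_prim : N.-primitive_root om).

Lemma prim_root_cmod : cmod om = 1.
Proof.
have h : cmod om ^+ N = 1 by rewrite -cmodX (prim_expr_order om_prim) cmod1.
by apply/eqP; rewrite -(@pexpr_eq1 _ _ N) ?cmod_ge0 ?h.
Qed.

Lemma prim_root_cconj : om * cconj om = 1.
Proof. by rewrite mul_cconj prim_root_cmod expr1n. Qed.

Lemma dft_orth m n : (m < N)%N -> (n < N)%N ->
  \sum_(j < N) om ^+ (j * m) * cconj (om ^+ (j * n)) = N%:R * (m == n)%:R.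
Proof.
move=> mN nN; pose x := om ^+ m * cconj om ^+ n.
under eq_bigr => j _ do rewrite cconjX ![(j * _)%N]mulnC !exprM -exprMn -/x.
have [mn|mn] := eqVneq m n.
  have -> : x = 1 by rewrite /x mn -exprMn prim_root_cconj expr1n.
  under eq_bigr do rewrite expr1n.
  by rewrite sumr_const card_ord mulr1.
have x1 : x != 1.
  apply/negP => /eqP x1; case/negP: mn.
  have : om ^+ m = om ^+ n.
    by rewrite -[RHS]mul1r -x1 /x -mulrA -exprMn [cconj _ * _]mulrC
       prim_root_cconj expr1n mulr1.
  by move/eqP; rewrite (eq_prim_root_expr om_prim) !modn_small.
have : (x - 1) * \sum_(j < N) x ^+ j = 0.
  rewrite -subrX1 /x exprMn -!exprM ![(_ * N)%N]mulnC !exprM -cconjX.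
  by rewrite (prim_expr_order om_prim) cconj1 !expr1n mul1r subrr.
by move/eqP; rewrite mulf_eq0 subr_eq0 (negbTE x1) /= mulr0 => /eqP.
Qed.

(** Without conjugation the sum is nonzero exactly when N divides m + n, and m + n < N leaves only m
    = n = 0. *)
Lemma dft_orth_add m n : (m + n < N)%N ->
  \sum_(j < N) om ^+ (j * m) * om ^+ (j * n) = N%:R * (m + n == 0)%N%:R.
Proof.
move=> mnN; rewrite -(dft_orth mnN N0); apply: eq_bigr => j _.
by rewrite -exprD -mulnDr muln0 expr0 cconj1 mulr1.
Qed.

(* Real charges whose n-th discrete Fourier coefficient is N * Y n, for n
   small enough not to be affected by aliasing. *)
Definition charge_at (K : nat) (Y : nat -> C) (j : nat) : R :=
  2 * cre (\sum_(k < K.+1) cconj (Y k) * om ^+ (j * k)).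

(** The charge is the sum of the terms cconj (Y k) om^(j k) and of their conjugates. Against om^(j
    n) the conjugates yield N Y_n, while the former survive only for k + n divisible by N, which n +
    K < N reduces to k = n = 0, where Y vanishes. *)
Lemma charge_dft K Y n : Y 0%N = 0 -> (forall k, (K < k)%N -> Y k = 0) ->
  (n + K < N)%N ->
  \sum_(j < N) rtoc (charge_at K Y j) * om ^+ (j * n) = N%:R * Y n.
Proof.
move=> Y0 YK nKN.
transitivity (\sum_(k < K.+1)
   (cconj (Y k) * (\sum_(j < N) om ^+ (j * k) * om ^+ (j * n)) +
    Y k * (\sum_(j < N) om ^+ (j * n) * cconj (om ^+ (j * k))))).
  under [RHS]eq_bigr => k _ do rewrite !mulr_sumr -big_split /=.
  rewrite exchange_big /=; apply: eq_bigr => j _.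
  rewrite /charge_at -addr_cconj cconj_sum -big_split /= mulr_suml.
  by apply: eq_bigr => k _; rewrite cconjM cconjK; ring.
have kn (k : 'I_K.+1) : (k + n < N)%N.
  by rewrite addnC (leq_ltn_trans _ nKN) // leq_add2l -ltnS.
have nN : (n < N)%N by apply: leq_ltn_trans nKN; rewrite leq_addr.
have kN (k : 'I_K.+1) : (k < N)%N.
  by apply: leq_ltn_trans (kn k); rewrite leq_addr.
transitivity (\sum_(k < K.+1) (if n == k then N%:R * Y n else 0)).
  apply: eq_bigr => k _; rewrite dft_orth_add // dft_orth //.
  rewrite addn_eq0; have [k0|k0] := eqVneq (k : nat) 0%N.
    rewrite k0 Y0 cconj0 !mul0r addr0.
    by case: eqP => // ->; rewrite Y0 mulr0.
  rewrite /= mulr0 mulr0 add0r.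
  by case: eqP => [->|_]; rewrite ?mulr1 ?mulr0 ?mulr0 // mulrC.
have [nK|Kn] := leqP n K; last first.
  rewrite YK // mulr0 big1 // => k _; by case: ifP.
rewrite (bigD1 (Ordinal (nK : (n < K.+1)%N))) //= eqxx big1 ?addr0 // => k.
by rewrite -val_eqE /= eq_sym => /negbTE ->.
Qed.

Lemma charge_le K Y j :
  `|charge_at K Y j| <= 2 * \sum_(k < K.+1) cmod (Y k).
Proof.
rewrite normrM ger0_norm // ler_wpM2l //.
apply: le_trans (cre_le _) _; apply: le_trans (cmod_sum _ _ _) _.
apply: ler_sum => k _; rewrite cmodM cmod_conj cmodX prim_root_cmod.
by rewrite expr1n mulr1.
Qed.

End RootsOfUnity.

(** * Energies of charges on one circle and on two disjoint circles *)

Section Grunsky.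
Variable R : realType.
Local Notation C := (Cplx R).

Lemma double_sum_approx (I J : finType) (c : I -> R) (d : J -> R)
    (L L' : I -> J -> R) (Bc Bd eta : R) :
  (forall i, `|c i| <= Bc) -> (forall j, `|d j| <= Bd) ->
  (forall i j, `|L i j - L' i j| <= eta) ->
  \sum_i \sum_j c i * d j * L i j <=
  \sum_i \sum_j c i * d j * L' i j + #|I|%:R * #|J|%:R * (Bc * Bd * eta).
Proof.
move=> cB dB LL; rewrite -lerBlDl -sumrB.
apply: le_trans (_ : \sum_(i : I) \sum_(j : J) (Bc * Bd * eta) <= _); last first.
  by rewrite !sumr_const -mulrnA mulnC -natrM mulr_natl.
apply: ler_sum => i _; rewrite -sumrB; apply: ler_sum => j _.
rewrite -mulrBr; apply: le_trans (ler_norm _) _; rewrite !normrM.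
by rewrite ler_pM ?mulr_ge0 // ler_pM.
Qed.

(** The constant [k0] is multiplied by the total charge of [c], hence drops out. Splitting the rest
    by degree prepares it for the discrete Fourier transform. *)
Lemma charges_plog (I J : finType) (c : I -> R) (d : J -> R)
    (q : I -> J -> C) (k0 : R) M :
  \sum_i c i = 0 ->
  \sum_i \sum_j c i * d j * (k0 + 2 * cre (plog M (q i j))) =
  2 * cre (\sum_(n < M) n.+1%:R^-1 *
     \sum_i \sum_j rtoc (c i) * rtoc (d j) * q i j ^+ n.+1).
Proof.
move=> c0.
transitivity ((\sum_i c i) * (\sum_j d j * k0) +
    2 * \sum_i \sum_j c i * d j * cre (plog M (q i j))).
  rewrite mulr_suml mulr_sumr -big_split /=; apply: eq_bigr => i _.
  rewrite !mulr_sumr -big_split /=; apply: eq_bigr => j _; ring.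
rewrite c0 mul0r add0r; congr (_ * _).
rewrite cre_sum; under [RHS]eq_bigr do
  rewrite -rtoc_nat -rtocV cre_rtocM cre_sum mulr_sumr.
rewrite [RHS]exchange_big /=; apply: eq_bigr => i _.
under [RHS]eq_bigr do rewrite cre_sum mulr_sumr.
rewrite [RHS]exchange_big /=; apply: eq_bigr => j _.
rewrite /plog cre_sum mulr_sumr; apply: eq_bigr => n _.
by rewrite -rtocM cre_rtocM -rtoc_nat -rtocV [_ * rtoc _]mulrC cre_rtocM; ring.
Qed.

(** With x = e / r^2, [be] is the smaller root of be^2 - (2 + x) be + 1 = 0. The regularised
    distance on a circle thus becomes exactly |1 - be u conj v|^2 up to a constant, and its
    logarithm expands in powers of be u conj v, uniformly since be < 1. *)
Lemma circle_kernel (r e : R) : 0 < r -> 0 < e ->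
  exists be : R, [/\ 0 < be, be < 1 &
  forall u v : C, cmod u = 1 -> cmod v = 1 ->
    r ^+ 2 * cmod (u - v) ^+ 2 + e =
    r ^+ 2 / be * cmod (1 - rtoc be * (u * cconj v)) ^+ 2].
Proof.
move=> r0 e0; pose x := e / r ^+ 2.
have x0 : 0 < x by rewrite divr_gt0 ?exprn_gt0.
pose s := Num.sqrt (x ^+ 2 + 4 * x).
have s2 : s ^+ 2 = x ^+ 2 + 4 * x by rewrite sqr_sqrtr // addr_ge0 ?sqr_ge0 // mulr_ge0 // ltW.
have s0 : 0 <= s by rewrite sqrtr_ge0.
have sx : x < s.
  rewrite ltNge; apply/negP => h.
  have : s ^+ 2 <= x ^+ 2 by rewrite lerXn2r ?nnegrE // ltW.
  by rewrite s2; lra.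
have s2x : s < 2 + x.
  rewrite ltNge; apply/negP => h.
  have : (2 + x) ^+ 2 <= s ^+ 2.
    by rewrite lerXn2r ?nnegrE //; apply: addr_ge0 => //; exact: ltW.
  by rewrite s2 sqrrD; lra.
pose be := (2 + x - s) / 2.
have be0 : 0 < be by rewrite /be; lra.
have be1 : be < 1 by rewrite /be; lra.
exists be; split => // u v u1 v1.
have beE : be ^+ 2 + 1 = (2 + x) * be.
  have -> : be ^+ 2 = ((2 + x) ^+ 2 - 2 * (2 + x) * s + s ^+ 2) / 4.
    by rewrite /be; field.
  by rewrite s2 /be; field.
have eE : e = r ^+ 2 * x by rewrite /x mulrC divfK // expf_neq0 // gt_eqF.
rewrite eE -mulrDr -mulrA; congr (_ * _).
have u2 : cre u ^+ 2 + cim u ^+ 2 = 1 by rewrite -cmod_sqr u1 expr1n.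
have v2 : cre v ^+ 2 + cim v ^+ 2 = 1 by rewrite -cmod_sqr v1 expr1n.
have pE : cre (u * cconj v) = cre u * cre v + cim u * cim v.
  by rewrite creM; case: (v) => a b; rewrite /cre /cim /=; ring.
have pq : cre (u * cconj v) ^+ 2 + cim (u * cconj v) ^+ 2 = 1.
  by rewrite -cmod_sqr cmodM cmod_conj u1 v1 mulr1 expr1n.
rewrite !cmod_sqr !creB !cimB cre_rtocM cim_rtocM cre1 cim1.
move: pq pE; set p := cre (u * _); set q := cim (u * _) => pq pE.
have -> : (cre u - cre v) ^+ 2 + (cim u - cim v) ^+ 2 = 2 - 2 * p.
  transitivity ((cre u ^+ 2 + cim u ^+ 2) + (cre v ^+ 2 + cim v ^+ 2) - 2 * p).
    by rewrite pE; ring.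
  by rewrite u2 v2.
have -> : (1 - be * p) ^+ 2 + (0 - be * q) ^+ 2 = be * (2 + x - 2 * p).
  transitivity (1 - 2 * be * p + be ^+ 2 * (p ^+ 2 + q ^+ 2)); first ring.
  by rewrite pq mulr1 -[be ^+ 2](addrK 1) beE; ring.
by rewrite mulKf ?gt_eqF //; ring.
Qed.

Lemma sum_charge0 (N K : nat) (om : C) (Y : nat -> C) :
  N.-primitive_root om -> Y 0%N = 0 -> (forall k, (K < k)%N -> Y k = 0) ->
  (K < N)%N -> \sum_(j < N) charge_at om K Y j = 0.
Proof.
move=> omP Y0 YK KN; apply: (@rtoc_inj R); rewrite rtoc_sum.
have N0 : (0 < N)%N by exact: leq_ltn_trans KN.
have := charge_dft N0 omP Y0 YK (KN : (0 + K < N)%N).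
rewrite Y0 mulr0 => h; rewrite -[RHS]h; apply: eq_bigr => j _.
by rewrite muln0 expr0 mulr1.
Qed.

(** In Fourier coefficients the energy is diagonal, with the terms be^n |Y_n|^2 / n; the factors
    be^n < 1 are dropped. [eta] comes from cutting the logarithm at degree M, and N = M + K + 1 is
    just large enough to exclude aliasing up to that degree. [eta] may depend on [e], but not on
    M. *)
Lemma self_energy (K : nat) (Y : nat -> C) (sg : C) (e : R) :
  Y 0%N = 0 -> (forall k, (K < k)%N -> Y k = 0) -> sg != 0 -> 0 < e ->
  exists2 eta : nat -> R, eta @ \oo --> (0 : R) &
  forall M N om, N = (M + K).+1 -> N.-primitive_root om -> (2 * K <= M)%N ->
  \sum_(j < N) \sum_(i < N) charge_at om K Y j * charge_at om K Y i *
     - ln (cmod (sg * om ^+ j - sg * om ^+ i) ^+ 2 + e) <=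
  2 * N%:R ^+ 2 * \sum_(k < K) cmod (Y k.+1) ^+ 2 / k.+1%:R +
  N%:R ^+ 2 * (2 * \sum_(k < K.+1) cmod (Y k)) ^+ 2 * eta M.
Proof.
move=> Y0 YK sg0 e0; pose r := cmod sg.
have r0 : 0 < r by rewrite cmod_gt0.
have [be [be0 be1 beE]] := circle_kernel r0 e0.
exists (fun M => 2 * (be ^+ M.+1 / (1 - be))).
  rewrite -[0](mulr0 2); apply: cvgMr; rewrite -[0](mul0r (1 - be)^-1).
  apply: cvgMl; rewrite (cvg_shiftS (fun n => be ^+ n)).
  by apply: cvg_expr; rewrite ger0_norm // ltW.
move=> M N om NE omP KM; set c := charge_at om K Y; set Bd := 2 * \sum_(k < K.+1) _.
have N0 : (0 < N)%N by rewrite NE.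
have om1 n : cmod (om ^+ n) = 1 by rewrite cmodX (prim_root_cmod N0 omP) expr1n.
pose q (j i : 'I_N) : C := rtoc be * (om ^+ j * cconj (om ^+ i)).
have qb j i : cmod (q j i) = be.
  by rewrite /q !cmodM cmod_conj !om1 !mulr1 cmod_real // ltW.
pose k0 := - ln (r ^+ 2 / be).
have LL (j i : 'I_N) :
    `|- ln (cmod (sg * om ^+ j - sg * om ^+ i) ^+ 2 + e) -
     (k0 + 2 * cre (plog M (q j i)))| <= 2 * (be ^+ M.+1 / (1 - be)).
  rewrite -mulrBr cmodM exprMn -/r beE ?om1 // -/(q j i).
  have q1 : cmod (q j i) < 1 by rewrite qb.
  have p1 : 0 < cmod (1 - q j i) ^+ 2.
    rewrite exprn_gt0 // cmod_gt0 subr_eq0; apply/eqP => /(congr1 (@cmod R)).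
    by rewrite cmod1 => h; move: q1; rewrite -h ltxx.
  rewrite lnM ?posrE //; last by rewrite divr_gt0 // exprn_gt0.
  rewrite ln_cmod_1B //.
  have -> : - (ln (r ^+ 2 / be) - 2 * cre (clog1 (q j i))) -
     (k0 + 2 * cre (plog M (q j i))) =
     2 * cre (clog1 (q j i) - plog M (q j i)) by rewrite creB /k0; ring.
  rewrite normrM ger0_norm // ler_wpM2l //; apply: le_trans (cre_le _) _.
  by apply: le_trans (clog1_tail M q1) _; rewrite qb.
apply: le_trans (double_sum_approx
  (fun j : 'I_N => charge_le N0 omP K Y j)
  (fun j : 'I_N => charge_le N0 omP K Y j) LL) _.
rewrite -/Bd card_ord -!expr2 mulrA lerD2r.
have KN : (K < N)%N by rewrite NE ltnS leq_addl.
rewrite charges_plog; last exact: sum_charge0 omP Y0 YK KN.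
rewrite -mulrA ler_wpM2l //.
have dftq (n : 'I_M) : \sum_(j < N) \sum_(i < N)
    rtoc (c j) * rtoc (c i) * q j i ^+ n.+1 =
    rtoc (N%:R ^+ 2 * (be ^+ n.+1 * cmod (Y n.+1) ^+ 2)).
  have nK : (n.+1 + K < N)%N by rewrite NE ltnS leq_add2r.
  have h := charge_dft N0 omP Y0 YK nK.
  transitivity (rtoc be ^+ n.+1 *
    ((\sum_(j < N) rtoc (c j) * om ^+ (j * n.+1)) *
     cconj (\sum_(j < N) rtoc (c j) * om ^+ (j * n.+1)))).
    rewrite cconj_sum big_distrlr /= mulr_sumr; apply: eq_bigr => j _.
    rewrite mulr_sumr; apply: eq_bigr => i _.
    rewrite /q !exprMn cconjM cconjX -!exprM.
    have -> : cconj (rtoc (c i)) = rtoc (c i) by exact: conjc_real.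
    by rewrite cconjX; ring.
  rewrite h mul_cconj cmodM cmod_nat -rtocX -rtocM exprMn.
  by congr rtoc; ring.
under eq_bigr do rewrite dftq -rtoc_nat -rtocV -rtocM.
rewrite -rtoc_sum cre_rtoc.
rewrite -(@sum_ord_widen _ (fun k => cmod (Y k.+1) ^+ 2 / k.+1%:R) K M); last 2 first.
- by apply: leq_trans KM; rewrite leq_pmull.
- by move=> l Kl; rewrite YK ?cmod0 ?expr0n ?mul0r.
rewrite mulr_sumr; apply: ler_sum => n _.
rewrite mulrC -mulrA ler_wpM2l ?sqr_ge0 // ler_wpM2r ?invr_ge0 ?ler0n //.
by rewrite ler_piMl ?sqr_ge0 // exprn_ile1 // ltW.
Qed.

(* The coefficients of [-log (1 + (s1 * x - s2 * y) / W)] as a double power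
   series in x and y. *)
Definition log_coef (s1 s2 W : C) (k l : nat) : C :=
  'C(k + l, l)%:R / (k + l)%:R * ((- s1 / W) ^+ k * (s2 / W) ^+ l).

Lemma log_coef_sym s1 s2 W k l : log_coef s1 s2 W k l = log_coef s2 s1 (- W) l k.
Proof.
rewrite /log_coef -bin_sub ?leq_addl // addnK [(l + k)%N]addnC.
by rewrite invrN !mulrN !mulNr opprK [_ ^+ k * _]mulrC.
Qed.

(** For disjoint circles the difference of two points is W (1 - q) with |q| <= t < 1, so the
    logarithm expands without regularisation; the powers of q, linear in both points, give the
    binomials of [log_coef]. Adding [e] changes the logarithm by at most [e * del], and here neither
    [eta] nor [del] depends on [e]. *)
Lemma cross_energy (K : nat) (Y1 Y2 : nat -> C) (s1 s2 W : C) :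
  Y1 0%N = 0 -> (forall k, (K < k)%N -> Y1 k = 0) ->
  Y2 0%N = 0 -> (forall k, (K < k)%N -> Y2 k = 0) ->
  cmod s1 + cmod s2 < cmod W ->
  exists2 eta : nat -> R, eta @ \oo --> (0 : R) &
  exists2 del : R, 0 <= del &
  forall e M N om, 0 < e ->
  N = (M + K).+1 -> N.-primitive_root om -> (2 * K <= M)%N ->
  \sum_(j < N) \sum_(i < N) charge_at om K Y1 j * charge_at om K Y2 i *
     - ln (cmod (W + s1 * om ^+ j - s2 * om ^+ i) ^+ 2 + e) <=
  2 * N%:R ^+ 2 * cre (\sum_(k < K) \sum_(l < K)
     log_coef s1 s2 W k.+1 l.+1 * Y1 k.+1 * Y2 l.+1) +
  N%:R ^+ 2 * ((2 * \sum_(k < K.+1) cmod (Y1 k)) *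
    (2 * \sum_(k < K.+1) cmod (Y2 k))) * (eta M + e * del).
Proof.
move=> Y10 Y1K Y20 Y2K sep.
have W0 : 0 < cmod W by apply: le_lt_trans sep; rewrite addr_ge0 ?cmod_ge0.
have Wn0 : W != 0 by rewrite -cmod_gt0.
pose t := (cmod s1 + cmod s2) / cmod W.
have t0 : 0 <= t by rewrite divr_ge0 ?addr_ge0 ?cmod_ge0.
have t1 : t < 1 by rewrite ltr_pdivrMr // mul1r.
(* The distance between the two circles; the regularisation changes each logarithm by at most e /
   d^2. *)
pose d := cmod W - (cmod s1 + cmod s2).
have d0 : 0 < d by rewrite subr_gt0.
exists (fun M => 2 * (t ^+ M.+1 / (1 - t))).
  rewrite -[0](mulr0 2); apply: cvgMr; rewrite -[0](mul0r (1 - t)^-1).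
  apply: cvgMl; rewrite (cvg_shiftS (fun n => t ^+ n)).
  by apply: cvg_expr; rewrite ger0_norm.
exists (d ^+ 2)^-1; first by rewrite invr_ge0 sqr_ge0.
move=> e M N om e0 NE omP KM.
set c1 := charge_at om K Y1; set c2 := charge_at om K Y2.
set B1 := 2 * \sum_(k < K.+1) cmod (Y1 k).
set B2 := 2 * \sum_(k < K.+1) cmod (Y2 k).
have N0 : (0 < N)%N by rewrite NE.
have om1 n : cmod (om ^+ n) = 1 by rewrite cmodX (prim_root_cmod N0 omP) expr1n.
pose q (j i : 'I_N) : C := (- s1 / W) * om ^+ j + (s2 / W) * om ^+ i.
have qt j i : cmod (q j i) <= t.
  apply: le_trans (cmodD _ _) _; rewrite !cmodM !om1 !mulr1 cmodN cmodV.
  by rewrite -mulrDl.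
have zE (j i : 'I_N) : W + s1 * om ^+ j - s2 * om ^+ i = W * (1 - q j i).
  by rewrite /q; field.
have zd (j i : 'I_N) : d <= cmod (W * (1 - q j i)).
  rewrite cmodM /d; have := cmod_le1D 1 (- q j i); rewrite cmodN cmod1 => h.
  apply: le_trans (_ : cmod W * (1 - t) <= _).
    by rewrite mulrBr mulr1 /t mulrC divfK ?gt_eqF.
  rewrite ler_wpM2l ?cmod_ge0 //; apply: le_trans h.
  by rewrite lerD2l lerN2.
pose k0 := - ln (cmod W ^+ 2).
have LL (j i : 'I_N) :
    `|- ln (cmod (W + s1 * om ^+ j - s2 * om ^+ i) ^+ 2 + e) -
     (k0 + 2 * cre (plog M (q j i)))| <=
     2 * (t ^+ M.+1 / (1 - t)) + e * (d ^+ 2)^-1.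
  rewrite zE; set X := cmod _.
  have X0 : 0 < X by apply: lt_le_trans d0 (zd j i).
  have q1 : cmod (q j i) < 1 := le_lt_trans (qt j i) t1.
  have X2 : 0 < X ^+ 2 by rewrite exprn_gt0.
  have x0 : 0 <= e / X ^+ 2 by rewrite divr_ge0 // ltW.
  have -> : X ^+ 2 + e = X ^+ 2 * (1 + e / X ^+ 2).
    by rewrite mulrDr mulr1 [_ * (e / _)]mulrC divfK // gt_eqF.
  have p1 : 0 < cmod (1 - q j i).
    by move: X0; rewrite /X cmodM pmulr_rgt0.
  rewrite lnM ?posrE //; last by rewrite ltr_wpDr.
  rewrite {1}/X cmodM exprMn lnM ?posrE ?exprn_gt0 // ln_cmod_1B //.
  have -> : - (ln (cmod W ^+ 2) - 2 * cre (clog1 (q j i)) +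
      ln (1 + e / X ^+ 2)) - (k0 + 2 * cre (plog M (q j i))) =
     2 * cre (clog1 (q j i) - plog M (q j i)) - ln (1 + e / X ^+ 2).
    by rewrite creB /k0; ring.
  apply: le_trans (ler_normB _ _) _; apply: lerD.
    rewrite normrM ger0_norm // ler_wpM2l //; apply: le_trans (cre_le _) _.
    apply: le_trans (clog1_tail M q1) _.
    apply: ler_pM; rewrite ?exprn_ge0 ?invr_ge0 ?subr_ge0 ?cmod_ge0 //.
    - exact: ltW.
    - by rewrite lerXn2r ?nnegrE ?cmod_ge0.
    - by rewrite lef_pV2 ?posrE ?subr_gt0 // lerD2l lerN2.
  rewrite ger0_norm; last by rewrite ln_ge0 // lerDl.
  apply: le_trans (le_ln1Dx _) _; first by rewrite (lt_le_trans _ x0) // ltrN10.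
  rewrite ler_wpM2l ?(ltW e0) // lef_pV2 ?posrE ?exprn_gt0 //.
  by rewrite lerXn2r ?nnegrE ?(ltW d0) ?(ltW X0) //; exact: zd.
apply: le_trans (double_sum_approx
  (fun j : 'I_N => charge_le N0 omP K Y1 j)
  (fun j : 'I_N => charge_le N0 omP K Y2 j) LL) _.
rewrite -/B1 -/B2 card_ord -!expr2 mulrA lerD2r.
have KN : (K < N)%N by rewrite NE ltnS leq_addl.
rewrite charges_plog; last exact: sum_charge0 omP Y10 Y1K KN.
rewrite -mulrA ler_wpM2l // -cre_rtocM rtocX rtoc_nat.
pose f k l := log_coef s1 s2 W k l * Y1 k * Y2 l.
have f0 k l : (K < k)%N || (K < l)%N || (k == 0)%N || (l == 0)%N -> f k l = 0.
  rewrite /f => /orP[/orP[/orP[h|h]|/eqP ->]|/eqP ->].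
  - by rewrite Y1K // mulr0 mul0r.
  - by rewrite Y2K // mulr0.
  - by rewrite Y10 mulr0 mul0r.
  - by rewrite Y20 mulr0.
rewrite -[X in _ <= cre (_ * X)](sum_triangle f0 KM).
rewrite mulr_sumr le_eqVlt; apply/orP; left; apply/eqP; congr cre.
apply: eq_bigr => n _.
have nN (l : 'I_(n.+2)) : (l + K < N)%N /\ (n.+1 - l + K < N)%N.
  have := ltn_ord l; have := ltn_ord n; rewrite NE; lia.
transitivity (n.+1%:R^-1 * \sum_(l < n.+2)
   (- s1 / W) ^+ (n.+1 - l) * (s2 / W) ^+ l * 'C(n.+1, l)%:R *
   ((\sum_(j < N) rtoc (c1 j) * om ^+ (j * (n.+1 - l))) *
    (\sum_(i < N) rtoc (c2 i) * om ^+ (i * l)))).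
  congr (_ * _); under [RHS]eq_bigr do rewrite big_distrlr /= mulr_sumr.
  rewrite [RHS]exchange_big /=; apply: eq_bigr => j _.
  under [RHS]eq_bigr do rewrite mulr_sumr.
  rewrite [RHS]exchange_big /=; apply: eq_bigr => i _.
  rewrite /q exprDn mulr_sumr; apply: eq_bigr => l _.
  by rewrite -mulr_natr !exprMn !exprM; ring.
rewrite !mulr_sumr; apply: eq_bigr => l _.
have [h1 h2] := nN l.
rewrite (charge_dft N0 omP Y10 Y1K h2) (charge_dft N0 omP Y20 Y2K h1).
rewrite /f /log_coef subnK; last by rewrite -ltnS ltn_ord.
ring.
Qed.

End Grunsky.

(** * Grunsky's inequality as a quadratic form and as a contraction *)

Section GrunskyForm.
Variable R : realType.
Local Notation C := (Cplx R).

(* The energy of charges with Fourier coefficients y_a, placed at N equidistant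
   points of the circle |z - w a| = |sg a|, as N tends to infinity and then e
   tends to 0. *)
Lemma grunsky_form (A : finType) (w sg : A -> C) (K : nat) (y : A -> nat -> C) :
  (forall a, sg a != 0) ->
  (forall a b, a != b -> cmod (sg a) + cmod (sg b) < cmod (w a - w b)) ->
  0 <= \sum_a (\sum_(k < K) cmod (y a k) ^+ 2 / k.+1%:R +
   \sum_(b | b != a) cre (\sum_(k < K) \sum_(l < K)
     log_coef (sg a) (sg b) (w a - w b) k.+1 l.+1 * y a k * y b l)).
Proof.
move=> sg0 sep.
(* The coefficients are shifted by one and the zeroth is 0, so that the charge of every single
   circle vanishes. *)
pose Y a n := if n is k.+1 then (if (k < K)%N then y a k else 0) else 0.
have Y0 a : Y a 0%N = 0 by [].
have YK a k : (K < k)%N -> Y a k = 0.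
  by case: k => //= k; rewrite ltnS => Kk; rewrite ltnNge Kk.
have YE a (k : 'I_K) : Y a k.+1 = y a k by rewrite /= ltn_ord.
pose V (p : A * A) := if p.1 == p.2 then
    \sum_(k < K) cmod (Y p.1 k.+1) ^+ 2 / k.+1%:R
  else cre (\sum_(k < K) \sum_(l < K)
    log_coef (sg p.1) (sg p.2) (w p.1 - w p.2) k.+1 l.+1 *
    Y p.1 k.+1 * Y p.2 l.+1).
pose Bd a := 2 * \sum_(k < K.+1) cmod (Y a k).
have Bd0 a : 0 <= Bd a by rewrite mulr_ge0 // sumr_ge0 // => k _; exact: cmod_ge0.
pose bound (p : A * A) (e del : R) (eta : nat -> R) := forall M N om, 
  N = (M + K).+1 -> N.-primitive_root om -> (2 * K <= M)%N ->
  \sum_(j < N) \sum_(i < N) charge_at om K (Y p.1) j * charge_at om K (Y p.2) i *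
     - ln (cmod (w p.1 + sg p.1 * om ^+ j - (w p.2 + sg p.2 * om ^+ i)) ^+ 2 + e)
  <= 2 * N%:R ^+ 2 * V p +
     N%:R ^+ 2 * (Bd p.1 * Bd p.2) * (eta M + e * del).
(* [del] is chosen before [e], and [eta] after it: M tends to infinity for fixed [e], and [e] tends
   to 0 only afterwards. *)
have pairs (p : A * A) : exists del : R, 0 <= del /\
    forall e : R, 0 < e -> exists eta : nat -> R,
      eta @ \oo --> (0 : R) /\ bound p e del eta.
  case: p => a b; rewrite /bound /V /=; have [ab|ab] := eqVneq a b.
    subst b; exists 0; split => // e e0.
    have [eta eta0 H] := self_energy (Y0 a) (YK a) (sg0 a) e0.
    exists eta; split => // M N om NE omP KM; rewrite mulr0 addr0 -expr2.
    apply: le_trans (H M N om NE omP KM); rewrite le_eqVlt; apply/orP; left.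
    apply/eqP; apply: eq_bigr => j _; apply: eq_bigr => i _.
    by rewrite opprD addrACA subrr add0r.
  have [eta eta0 [del del0 H]] :=
    cross_energy (Y0 a) (YK a) (Y0 b) (YK b) (sep a b ab).
  exists del; split => // e e0; exists eta; split => // M N om NE omP KM.
  apply: le_trans (H e M N om e0 NE omP KM); rewrite le_eqVlt; apply/orP; left.
  apply/eqP; apply: eq_bigr => j _; apply: eq_bigr => i _.
  by do 4 congr (_ _); rewrite opprD addrACA addrA.
have {pairs}[del del_pairs] := choice pairs.
have VE : \sum_p V p = \sum_a (\sum_(k < K) cmod (y a k) ^+ 2 / k.+1%:R +
   \sum_(b | b != a) cre (\sum_(k < K) \sum_(l < K)
     log_coef (sg a) (sg b) (w a - w b) k.+1 l.+1 * y a k * y b l)).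
  rewrite -(pair_bigA _ (fun a b => V (a, b))) /=; apply: eq_bigr => a _.
  rewrite (bigD1 a) //= /V /= eqxx; congr (_ + _).
    by apply: eq_bigr => k _; rewrite ltn_ord.
  apply: eq_bigr => b ba; rewrite eq_sym (negbTE ba); congr cre.
  by apply: eq_bigr => k _; apply: eq_bigr => l _; rewrite !ltn_ord.
rewrite -VE.
pose D := \sum_(p : A * A) Bd p.1 * Bd p.2 * del p.
have D0 : 0 <= D.
  apply: sumr_ge0 => p _; apply: mulr_ge0; first exact: mulr_ge0.
  by have [] := del_pairs p.
suff H e : 0 < e -> 0 <= 2 * \sum_p V p + e * D.
  rewrite -(pmulr_rge0 _ (ltr0Sn R 1)); apply/ler_addgt0Pr => e e0.
  have e0' : 0 < e / (D + 1) by rewrite divr_gt0 // ltr_wpDl.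
  apply: le_trans (H _ e0') _; rewrite lerD2l mulrAC -mulrA ler_piMr ?(ltW e0) //.
  by rewrite ler_pdivrMr ?mul1r ?lerDl // ltr_wpDl.
move=> e0.
have /choice[eta etaP] (p : A * A) : exists eta : nat -> R,
   eta @ \oo --> (0 : R) /\ bound p e (del p) eta.
  by case: (del_pairs p) => _; exact.
have cv : (fun M => 2 * \sum_p V p +
     \sum_(p : A * A) Bd p.1 * Bd p.2 * (eta p M + e * del p)) @ \oo -->
   2 * \sum_p V p + \sum_(p : A * A) Bd p.1 * Bd p.2 * (0 + e * del p).
  apply: cvgD; first exact: cvg_cst.
  apply: cvg_sum_seq => p _; apply: cvgMr; apply: cvgD; last exact: cvg_cst.
  by case: (etaP p).
have -> : 2 * \sum_p V p + e * D =
    2 * \sum_p V p + \sum_(p : A * A) Bd p.1 * Bd p.2 * (0 + e * del p).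
  congr (_ + _); rewrite mulr_sumr; apply: eq_bigr => p _; rewrite add0r; ring.
rewrite -(cvg_lim _ cv) //; apply: limr_ge; first exact: cvgP cv.
near=> M.
have KM : (2 * K <= M)%N by near: M; exact: nbhs_infty_ge.
pose N := (M + K).+1.
have [om omP] := prim_root_exists R (ltn0Sn (M + K)).
have KN : (K < N)%N by rewrite ltnS leq_addl.
pose z (p : A * 'I_N) := w p.1 + sg p.1 * om ^+ p.2.
pose c (p : A * 'I_N) := charge_at om K (Y p.1) p.2.
have c0 : \sum_p c p = 0.
  rewrite -(pair_bigA _ (fun a j => c (a, j))) /= big1 // => a _.
  exact: sum_charge0 omP (Y0 a) (YK a) KN.
have N2 : 0 < N%:R ^+ 2 :> R by rewrite exprn_gt0 // ltr0n.
rewrite -(pmulr_rge0 _ N2); apply: le_trans (log_energy_ge0 z c0 e0) _.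
rewrite -(pair_bigA _ (fun a j => \sum_p' c (a, j) * c p' *
   - ln (cmod (z (a, j) - z p') ^+ 2 + e))) /=.
have -> : \sum_a \sum_j \sum_p' c (a, j) * c p' *
   - ln (cmod (z (a, j) - z p') ^+ 2 + e) =
   \sum_(p : A * A) \sum_j \sum_i c (p.1, j) * c (p.2, i) *
   - ln (cmod (z (p.1, j) - z (p.2, i)) ^+ 2 + e).
  rewrite -(pair_bigA _ (fun a b => \sum_j \sum_i c (a, j) * c (b, i) *
   - ln (cmod (z (a, j) - z (b, i)) ^+ 2 + e))) /=.
  apply: eq_bigr => a _; rewrite [RHS]exchange_big /=; apply: eq_bigr => j _.
  by rewrite -(pair_bigA _ (fun b i => c (a, j) * c (b, i) *
   - ln (cmod (z (a, j) - z (b, i)) ^+ 2 + e))).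
apply: le_trans (ler_sum _ (fun p _ => proj2 (etaP p) M N om erefl omP KM)) _.
rewrite mulrDr !mulr_sumr -big_split /=; apply: ler_sum => p _.
by rewrite le_eqVlt; apply/orP; left; apply/eqP; ring.
Unshelve. all: by end_near. Qed.

(* Polarisation, then testing the resulting bilinear bound against the
   conjugate of the image of z. *)
Lemma sym_form_contraction (J : finType) (S : J -> J -> C) (d : J -> R) :
  (forall i, 0 < d i) -> (forall i j, S i j = S j i) ->
  (forall y : J -> C, 0 <= \sum_i (cmod (y i) ^+ 2 / d i +
      cre (\sum_j S i j * y i * y j))) ->
  forall z : J -> C,
  \sum_i d i * cmod (\sum_j S i j * (rtoc (d j) * z j)) ^+ 2 <=
  \sum_i d i * cmod (z i) ^+ 2.
Proof.
move=> d0 Ssym Q z.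
pose v i := \sum_j S i j * (rtoc (d j) * z j).
pose X i : C := rtoc (d i) * cconj (v i).
pose Y i : C := rtoc (d i) * z i.
pose I1 : C := Complex 0 1.
have I2 : I1 * I1 = -1.
  by apply: cplx_ext; rewrite ?creM ?cimM /cre /cim /=; ring.
have cI u : cmod (I1 * u) = cmod u.
  by rewrite cmodM {1}/cmod /= expr0n expr1n add0r sqrtr1 mul1r.
(* The factor [I1] reverses the sign of the bilinear part, so the sum of both inequalities keeps
   only -4 Re S (X, Y) of it, and the squares combine by the parallelogram law. *)
have Q1 := Q (fun i => X i - Y i).
have Q2 := Q (fun i => I1 * (X i + Y i)).
have par u u' : cmod (u - u') ^+ 2 + cmod (u + u') ^+ 2 =
    2 * cmod u ^+ 2 + 2 * cmod u' ^+ 2.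
  by rewrite !cmod_sqr !creD !cimD !creN !cimN; ring.
have H : 0 <= \sum_i ((2 * cmod (X i) ^+ 2 + 2 * cmod (Y i) ^+ 2) / d i -
   4 * cre (X i * \sum_j S i j * Y j)).
  apply: le_trans (addr_ge0 Q1 Q2) _; rewrite -big_split /=.
  have cross : \sum_i cre (\sum_j S i j * Y i * X j) =
      \sum_i cre (\sum_j S i j * X i * Y j).
    rewrite -!cre_sum; congr cre; rewrite exchange_big /=.
    apply: eq_bigr => i _; apply: eq_bigr => j _.
    by rewrite Ssym mulrAC.
  rewrite le_eqVlt; apply/orP; left; apply/eqP.
  transitivity (\sum_i ((2 * cmod (X i) ^+ 2 + 2 * cmod (Y i) ^+ 2) / d i -
    2 * cre (\sum_j S i j * X i * Y j) - 2 * cre (\sum_j S i j * Y i * X j))).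
    apply: eq_bigr => i _; rewrite cI -par.
    rewrite !cre_sum !mulr_sumr addrACA -mulrDl -!addrA; congr (_ + _).
    rewrite -big_split /= -!sumrN -big_split /=; apply: eq_bigr => j _.
    have -> : S i j * (I1 * (X i + Y i)) * (I1 * (X j + Y j)) =
       - (S i j * (X i + Y i) * (X j + Y j)).
      transitivity (I1 * I1 * (S i j * (X i + Y i) * (X j + Y j))); first ring.
      by rewrite I2 mulN1r.
    rewrite !(mulrDr, mulrDl, mulrN, mulNr) !(creD, creN); ring.
  rewrite !sumrB -!mulr_sumr cross -addrA -opprD -mulrDl; congr (_ - _).
  congr (_ * _); first ring.
  apply: eq_bigr => i _; rewrite mulr_sumr; congr cre; apply: eq_bigr => j _.
  ring.
have EX i : (2 * cmod (X i) ^+ 2 + 2 * cmod (Y i) ^+ 2) / d i -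
   4 * cre (X i * \sum_j S i j * Y j) =
   2 * (d i * cmod (z i) ^+ 2) - 2 * (d i * cmod (v i) ^+ 2).
  rewrite -/(v i) /X /Y !cmodM cmod_conj !cmod_real ?(ltW (d0 i)) //.
  rewrite -mulrA [cconj _ * _]mulrC mul_cconj cre_rtocM cre_rtoc.
  by field; rewrite gt_eqF.
move: H; under eq_bigr do rewrite EX.
by rewrite sumrB -!mulr_sumr subr_ge0 ler_pM2l.
Qed.

End GrunskyForm.

(** * Matrices of composition operators *)

Section CoefMatrix.
Variable R : realType.
Local Notation C := (Cplx R).

Definition csum (u : nat -> C) : C := limn (series u).

Lemma cvg_csum (u : nat -> C) : cvgn (series u) -> series u @ \oo --> csum u.
Proof. by []. Qed.

Lemma csum_unique (u : nat -> C) l : series u @ \oo --> l -> csum u = l.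
Proof. by move=> /cvg_lim; exact. Qed.

Lemma series_add (u v : nat -> C) :
  series (fun n => u n + v n) = (fun n => series u n + series v n).
Proof. by apply/funext => n; rewrite /series /= big_split. Qed.

Lemma is_cvg_csumD (u v : nat -> C) : cvgn (series u) -> cvgn (series v) ->
  cvgn (series (fun n => u n + v n)).
Proof.
move=> cu cv; rewrite series_add; apply/cvg_ex; exists (csum u + csum v).
by apply: cvgD; exact: cvg_csum.
Qed.

Lemma csumD (u v : nat -> C) : cvgn (series u) -> cvgn (series v) ->
  csum (fun n => u n + v n) = csum u + csum v.
Proof.
move=> cu cv; apply: csum_unique; rewrite series_add.
by apply: cvgD; exact: cvg_csum.
Qed.

Lemma series_scale (a : C) (u : nat -> C) :
  series (fun n => a * u n) = (fun n => a * series u n).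
Proof. by apply/funext => n; rewrite /series /= mulr_sumr. Qed.

Lemma is_cvg_csumZ a (u : nat -> C) : cvgn (series u) ->
  cvgn (series (fun n => a * u n)).
Proof.
move=> cu; rewrite series_scale; apply/cvg_ex; exists (a * csum u).
by apply: cvgMr; exact: cvg_csum.
Qed.

Lemma csumZ a (u : nat -> C) : cvgn (series u) ->
  csum (fun n => a * u n) = a * csum u.
Proof.
move=> cu; apply: csum_unique; rewrite series_scale.
by apply: cvgMr; exact: cvg_csum.
Qed.

Lemma csum0 : csum (fun _ => 0) = 0.
Proof.
apply: csum_unique; rewrite (_ : series _ = cst 0); first exact: cvg_cst.
by apply/funext => n; rewrite /series /= big1.
Qed.

Lemma is_cvg_csum_sum (I : Type) (r : seq I) (P : pred I) (u : I -> nat -> C) :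
  (forall i, cvgn (series (u i))) ->
  cvgn (series (fun n => \sum_(i <- r | P i) u i n)).
Proof.
move=> cu; rewrite (_ : series _ = fun n => \sum_(i <- r | P i) series (u i) n).
  apply/cvg_ex; exists (\sum_(i <- r | P i) csum (u i)).
  by apply: cvg_sum_seq => i _; exact: cvg_csum.
by apply/funext => n; rewrite /series /= exchange_big.
Qed.

Lemma csum_sum (I : Type) (r : seq I) (P : pred I) (u : I -> nat -> C) :
  (forall i, cvgn (series (u i))) ->
  csum (fun n => \sum_(i <- r | P i) u i n) = \sum_(i <- r | P i) csum (u i).
Proof.
move=> cu; apply: csum_unique.
rewrite (_ : series _ = fun n => \sum_(i <- r | P i) series (u i) n).
  by apply: cvg_sum_seq => i _; exact: cvg_csum.
by apply/funext => n; rewrite /series /= exchange_big.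
Qed.

Lemma series_recl (u : nat -> C) n :
  series u n.+1 = u 0%N + series (fun n => u n.+1) n.
Proof. by rewrite /series /= big_nat_recl. Qed.

Lemma is_cvg_csumS (u : nat -> C) :
  cvgn (series u) -> cvgn (series (fun n => u n.+1)).
Proof.
move=> cu; rewrite (_ : series _ = fun n => series u n.+1 - u 0%N).
  apply/cvg_ex; exists (csum u - u 0%N); apply: cvgB; last exact: cvg_cst.
  by rewrite (cvg_shiftS (series u)); exact: cvg_csum.
by apply/funext => n; rewrite series_recl addrC addKr.
Qed.

Lemma csum_recl (u : nat -> C) : cvgn (series u) ->
  csum u = u 0%N + csum (fun n => u n.+1).
Proof.
move=> cu; have := cvg_csum (is_cvg_csumS cu) => cs.
apply: csum_unique; rewrite -cvg_shiftS.
rewrite (_ : (fun n => _) = fun n => u 0%N + series (fun n => u n.+1) n).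
  by apply: cvgD; [exact: cvg_cst | exact: cs].
by apply/funext => n; rewrite series_recl.
Qed.

(** Row j - 1, with a zero row before row 0: the effect of multiplication by z on the
    coefficients. *)
Definition prev_row (T : nat -> nat -> C) (j : nat) : nat -> C :=
  if j is j'.+1 then T j' else fun _ => 0.

(* T j k is the coefficient of z^j in the k-th power of the Moebius map of M. *)
Definition mobius_coef (M : 'M[C]_2) (T : nat -> nat -> C) : Prop :=
  (forall j, T j 0%N = (j == 0)%N%:R) /\
  (forall j k, M 1 0 * prev_row T j k.+1 + M 1 1 * T j k.+1 =
               M 0 0 * prev_row T j k + M 0 1 * T j k).

(* An l1 bound expressing that the map sends the disc of radius 1/t into the
   disc of radius t. *)
Definition coef_bound (t : R) (T : nat -> nat -> C) : Prop :=
  forall J l, \sum_(j < J) cmod (T j l) * t ^- j <= t ^+ l.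

Variable t : R.
Hypotheses (t0 : 0 < t) (t1 : t < 1).

Lemma coef_bound_le T j l : coef_bound t T -> cmod (T j l) <= t ^+ (j + l).
Proof.
move=> bT; have := bT j.+1 l; rewrite big_ord_recr /= => h.
have : cmod (T j l) * t ^- j <= t ^+ l.
  apply: le_trans h; rewrite lerDr sumr_ge0 // => i _.
  by rewrite mulr_ge0 ?cmod_ge0 // invr_ge0 exprn_ge0 // ltW.
by rewrite ler_pdivrMr ?exprn_gt0 // exprD mulrC.
Qed.

Let pow1 n : t ^+ n <= 1.
Proof. by rewrite exprn_ile1 // ltW. Qed.

Let tn0 n : 0 <= t ^+ n.
Proof. by rewrite exprn_ge0 // ltW. Qed.

Lemma coef_prod_geo T T' j l m : coef_bound t T -> coef_bound t T' ->
  cmod (T j m * T' m l) <= 1 * t ^+ m.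
Proof.
move=> bT bT'; rewrite cmodM mul1r.
apply: le_trans (ler_pM _ _ (coef_bound_le _ _ bT) (coef_bound_le _ _ bT')) _;
  rewrite ?cmod_ge0 //.
rewrite -exprD (_ : (j + m + (m + l) = m + (j + m + l))%N); last by ring.
by rewrite exprD ler_piMr.
Qed.

(** The matrix of the inner map stands on the left: expanding a power of the outer map in powers of
    the inner one is a matrix product in reverse order. *)
Definition coef_comp (T T' : nat -> nat -> C) : nat -> nat -> C :=
  fun j l => csum (fun m => T j m * T' m l).

Lemma is_cvg_coef_comp T T' j l : coef_bound t T -> coef_bound t T' ->
  cvgn (series (fun m => T j m * T' m l)).
Proof.
move=> bT bT'.
exact: cvgn_series_geo (ltW t0) t1 (fun m => coef_prod_geo j l m bT bT').
Qed.

(** Summing over the rows first leaves the weights t^m on the coefficients of T', and t^m <= t^-m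
    since t < 1. *)
Lemma coef_comp_bound T T' : coef_bound t T -> coef_bound t T' ->
  coef_bound t (coef_comp T T').
Proof.
move=> bT bT' J l.
have cv : (fun n => \sum_(j < J)
    cmod (series (fun m => T j m * T' m l) n) * t ^- j) @ \oo -->
    \sum_(j < J) cmod (coef_comp T T' j l) * t ^- j.
  apply: cvg_sum_seq => j _; apply: cvgMl; apply: cvg_cmod_fun.
  by apply: cvg_csum; exact: is_cvg_coef_comp.
rewrite -(cvg_lim _ cv) //; apply: limr_le; first exact: cvgP cv.
near=> n; apply: le_trans (bT' n l).
apply: le_trans (_ : \sum_(j < J) \sum_(m < n)
    cmod (T j m) * cmod (T' m l) * t ^- j <= _).
  apply: ler_sum => j _; rewrite -mulr_suml ler_wpM2r ?invr_ge0 //.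
  apply: le_trans (cmod_sum _ _ _) _; rewrite big_mkord.
  by apply: ler_sum => m _; rewrite cmodM.
rewrite exchange_big /=; apply: ler_sum => m _.
under eq_bigr do rewrite mulrAC.
rewrite -mulr_suml mulrC ler_wpM2l ?cmod_ge0 //.
apply: le_trans (bT J m) _; apply: le_trans (pow1 m) _.
by rewrite -exprVn exprn_ege1 // invf_ge1 // ltW.
Unshelve. all: by end_near. Qed.

Lemma prev_row_comp T T' j l :
  prev_row (coef_comp T T') j l = csum (fun m => prev_row T j m * T' m l).
Proof.
case: j => [|j] //=; rewrite -[LHS]csum0; congr csum.
by apply/funext => m; rewrite mul0r.
Qed.

Lemma is_cvg_prev_row T T' j l : coef_bound t T -> coef_bound t T' ->
  cvgn (series (fun m => prev_row T j m * T' m l)).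
Proof.
move=> bT bT'; case: j => [|j] /=; last exact: is_cvg_coef_comp.
rewrite (_ : (fun m => _) = (fun m => 0 * (T 0%N m * T' m l))).
  by apply: is_cvg_csumZ; exact: is_cvg_coef_comp.
by apply/funext => m; rewrite !mul0r.
Qed.

(** Only the two recurrences enter. That of T shifts the summation index by one, after which that of
    T' applies term by term; the term m = 0 left over by the shift is covered by the recurrence of
    T' in row 0. *)
Lemma mobius_coef_comp M M' T T' : coef_bound t T -> coef_bound t T' ->
  mobius_coef M T -> mobius_coef M' T' ->
  mobius_coef (M' *m M) (coef_comp T T').
Proof.
move=> bT bT' [T_0 TR] [T'_0 T'R]; split => [j|j l].
  rewrite /coef_comp csum_recl; last exact: is_cvg_coef_comp.
  rewrite T_0 T'_0 eqxx mulr1 (_ : (fun n => _) = fun=> 0) ?csum0 ?addr0 //.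
  by apply/funext => n; rewrite T'_0 mulr0.
pose x m := M 1 0 * prev_row T j m + M 1 1 * T j m.
pose X m := M 0 0 * prev_row T j m + M 0 1 * T j m.
have Xx m : x m.+1 = X m by exact: TR.
have cvx (a b : C) l' :
    cvgn (series (fun m => (a * prev_row T j m + b * T j m) * T' m l')).
  under eq_fun do rewrite mulrDl -!mulrA.
  apply: is_cvg_csumD; apply: is_cvg_csumZ;
    [exact: is_cvg_prev_row | exact: is_cvg_coef_comp].
have cx l' : cvgn (series (fun m => x m * T' m l')) by exact: cvx.
have cX l' : cvgn (series (fun m => X m * T' m l')) by exact: cvx.
have cXS l' : cvgn (series (fun m => X m * T' m.+1 l')).
  by under eq_fun do rewrite -Xx; exact: (is_cvg_csumS (cx l')).
have comb (a b : C) l' : a * prev_row (coef_comp T T') j l' +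
    b * coef_comp T T' j l' =
    csum (fun m => (a * prev_row T j m + b * T j m) * T' m l').
  under [in RHS]eq_fun do rewrite mulrDl -!mulrA.
  rewrite csumD; try (apply: is_cvg_csumZ;
    [exact: is_cvg_prev_row | exact: is_cvg_coef_comp]).
  - rewrite !csumZ ?prev_row_comp //; [exact: is_cvg_coef_comp|].
    exact: is_cvg_prev_row.
  - by apply: is_cvg_csumZ; exact: is_cvg_prev_row.
  - by apply: is_cvg_csumZ; exact: is_cvg_coef_comp.
have MM (i k : 'I_2) : (M' *m M) i k = M' i 0 * M 0 k + M' i 1 * M 1 k.
  rewrite mxE !big_ord_recl big_ord0 addr0.
  by have -> : lift ord0 ord0 = (1 : 'I_2) by exact: val_inj.
have main (i : 'I_2) l' : (M' *m M) i 0 * prev_row (coef_comp T T') j l' +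
    (M' *m M) i 1 * coef_comp T T' j l' =
    csum (fun m => X m * (M' i 0 * T' m l' + M' i 1 * T' m.+1 l')) +
    M' i 1 * (x 0%N * T' 0%N l').
  rewrite !MM.
  transitivity (M' i 0 * (M 0 0 * prev_row (coef_comp T T') j l' +
       M 0 1 * coef_comp T T' j l') +
     M' i 1 * (M 1 0 * prev_row (coef_comp T T') j l' +
       M 1 1 * coef_comp T T' j l')); first by ring.
  rewrite !comb -/x -/X (csum_recl (cx l')) mulrDr addrA addrAC.
  congr (_ + _); under [in X in _ + X]eq_fun do rewrite Xx.
  rewrite -csumZ // -csumZ // -csumD; try exact: is_cvg_csumZ.
  by congr csum; apply/funext => m; rewrite -/(X m); ring.
rewrite !main; congr (csum _ + _).
  by apply/funext => m; congr (_ * _); exact: (T'R m.+1 l).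
have := T'R 0%N l; rewrite /= !mulr0 !add0r => h.
by rewrite mulrCA h mulrCA.
Qed.

(* Summing the recurrence along the diagonals j - k = n gives the Laurent
   coefficients of z (M10 z + M11) / ((M10 z + M11) z - (M00 z + M01)) on the
   unit circle; the two bounds on p and r select the expansion. *)
Lemma coef_trace M T (l1 l2 p r : C) :
  coef_bound t T -> mobius_coef M T ->
  M 0 0 * p + M 0 1 = l1 * p -> M 1 0 * p + M 1 1 = l1 ->
  M 0 0 + M 0 1 * r = l2 -> M 1 0 + M 1 1 * r = l2 * r ->
  cmod p < 1 -> cmod r < 1 -> l1 != l2 ->
  csum (fun k => T k k) = l1 / (l1 - l2).
Proof.
move=> bT [T_0 TR] e1 e2 e3 e4 p1 r1 l12.
have l12' : l1 - l2 != 0 by rewrite subr_eq0.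
have rp1 : cmod (r * p) < 1.
  by rewrite cmodM; have := cmod_ge0 p; have := cmod_ge0 r; nra.
have rp0 : 1 - r * p != 0.
  rewrite subr_eq0; apply/eqP => /(congr1 (@cmod R)); rewrite cmod1 => h.
  by move: rp1; rewrite -h ltxx.
(* With this e, (M10 z + M11) z - (M00 z + M01) = e (z - p) (1 - r z). *)
pose e := (l1 - l2) / (1 - r * p).
have e0 : e != 0 by rewrite mulf_neq0 // invr_eq0.
have ge : M 1 0 = - (r * e).
  apply: (mulIf rp0); rewrite /e mulNr mulrA mulfVK //.
  transitivity ((M 1 0 + M 1 1 * r) - r * (M 1 0 * p + M 1 1)); first by ring.
  by rewrite e4 e2; ring.
have be : M 0 1 = p * e.
  apply: (mulIf rp0); rewrite /e -mulrA divfK //.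
  transitivity ((M 0 0 * p + M 0 1) - p * (M 0 0 + M 0 1 * r)); first by ring.
  by rewrite e1 e3; ring.
have dae : M 1 1 - M 0 0 = e * (1 + r * p).
  have -> : M 1 1 = l1 - M 1 0 * p by rewrite -e2; ring.
  have -> : M 0 0 = l2 - M 0 1 * r by rewrite -e3; ring.
  by rewrite ge be /e; field.
(* Rows of negative index are 0, so that the diagonals j - k = n exist for every integer n. *)
pose Tz (n : int) k := if n is Posz j then T j k else 0.
have TzR (n : int) k : M 1 0 * Tz (n - 1) k.+1 + M 1 1 * Tz n k.+1 =
    M 0 0 * Tz (n - 1) k + M 0 1 * Tz n k.
  case: n => [[|j]|j] /=.
  - by have := TR 0%N k.
  - by rewrite subn1; exact: TR j.+1 k.
  - by rewrite !mulr0.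
have Tzle n k : cmod (Tz n k) <= t ^+ k.
  case: n => [j|j]; last by rewrite [Tz _ _]/(0 : C) cmod0.
  apply: le_trans (coef_bound_le j k bT) _.
  by rewrite exprD ler_piMl.
pose f (n : int) k := Tz (k%:Z + n) k.
have fle n k : cmod (f n k) <= 1 * t ^+ k by rewrite mul1r; exact: Tzle.
have cf n : cvgn (series (f n)) := cvgn_series_geo (ltW t0) t1 (fle n).
pose c n := csum (f n).
pose B := 1 / (1 - t).
have cB n : cmod (c n) <= B := limn_series_geo_le (ltW t0) t1 (fle n).
have T0 (n : int) : Tz n 0%N = (n == 0)%:R.
  by case: n => [j|j] //=; rewrite T_0.
have cS n : csum (fun k => f n k.+1) = c n - (n == 0)%:R.
  by rewrite /c (csum_recl (cf n)) {2}/f add0r T0 [X in X - _]addrC addrK.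
have cR n : M 1 0 * (c (n - 1 - 1) - (n - 1 - 1 == 0)%:R) +
    M 1 1 * (c (n - 1) - (n - 1 == 0)%:R) = M 0 0 * c (n - 1) + M 0 1 * c n.
  rewrite -!cS -!csumZ; try exact: is_cvg_csumS; try exact: cf.
  rewrite -!csumD; try (apply: is_cvg_csumZ; try exact: is_cvg_csumS;
    exact: cf).
  congr csum; apply/funext => k; rewrite /f.
  have h1 : (k.+1%:Z + (n - 1 - 1) = k%:Z + n - 1)%R by clear; lia.
  have h2 : (k.+1%:Z + (n - 1) = k%:Z + n)%R by clear; lia.
  have h3 : (k%:Z + (n - 1) = k%:Z + n - 1)%R by clear; lia.
  by rewrite h1 h2 h3 TzR.
(* The coefficients after multiplication by 1 - r z; the factor e (z - p) then leaves the recurrence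
   [dR], whose right-hand side stems from the column k = 0. *)
pose d n := c n - r * c (n - 1).
have dR n : e * (d (n - 1) - p * d n) =
    M 1 0 * (n - 1 - 1 == 0)%:R + M 1 1 * (n - 1 == 0)%:R.
  have := cR n; rewrite !mulrBr => h.
  transitivity ((M 1 1 - M 0 0) * c (n - 1) + M 1 0 * c (n - 1 - 1) - M 0 1 * c n).
    by rewrite dae ge be /d; ring.
  transitivity (M 1 0 * c (n - 1 - 1) - M 1 0 * (n - 1 - 1 == 0)%:R +
     (M 1 1 * c (n - 1) - M 1 1 * (n - 1 == 0)%:R) -
     (M 0 0 * c (n - 1) + M 0 1 * c n) +
     M 1 0 * (n - 1 - 1 == 0)%:R + M 1 1 * (n - 1 == 0)%:R); first ring.
  by rewrite h; ring.
have B0 : 0 <= B by rewrite /B mul1r invr_ge0 subr_ge0 ltW.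
have dB n : cmod (d n) <= 2 * B.
  apply: le_trans (cmodD _ _) _; rewrite cmodN cmodM mulr_natl mulr2n.
  apply: lerD (cB _) _; apply: le_trans (cB (n - 1)).
  by rewrite ler_piMl ?cmod_ge0 // ltW.
have dstep n : (n - 1 - 1 == 0) = false -> (n - 1 == 0) = false ->
    d (n - 1) = p * d n.
  move=> h1 h2; have := dR n; rewrite h1 h2 !mulr0 addr0 => /eqP.
  by rewrite mulf_eq0 (negbTE e0) /= subr_eq0 => /eqP.
(* Above the inhomogeneous indices d (n - 1) = p d (n), so boundedness of d and |p| < 1 force d (2)
   = 0. *)
have d2 : d 2 = 0.
  have dm m : d 2 = p ^+ m * d (2 + m%:Z).
    elim: m => [|m ->]; first by rewrite mul1r addr0.
    rewrite exprSr -mulrA; congr (_ * _).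
    have -> : (2 + m%:Z = 2 + m.+1%:Z - 1)%R by clear; lia.
    by apply: dstep; clear; apply/eqP; lia.
  apply/eqP; rewrite -cmod_eq0 eq_le cmod_ge0 andbT.
  have cv : (fun m => (2 * B) * cmod p ^+ m) @ \oo --> (0 : R).
    by apply: (@cvg_geometric R); rewrite ger0_norm // cmod_ge0.
  rewrite -(cvg_lim _ cv) //; apply: limr_ge; first exact: cvgP cv.
  near=> m; rewrite (dm m) cmodM cmodX mulrC ler_wpM2r ?exprn_ge0 ?cmod_ge0 //.
have d1 : e * d 1 = M 1 0.
  have := dR 2; rewrite d2 mulr0 subr0.
  have -> : (2 - 1 = 1 :> int)%R by [].
  by rewrite subrr eqxx mulr1 (_ : (1 == 0 :> int) = false) // mulr0 addr0.
have d0 : e * d 0 = l1.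
  have := dR 1; rewrite subrr eqxx mulr1 sub0r (_ : (-1 == 0 :> int) = false) //.
  rewrite mulr0 add0r mulrBr mulrCA d1 => h.
  by rewrite -e2 -h; ring.
have dneg m : d (- m%:Z) = p ^+ m * d 0.
  elim: m => [|m IH]; first by rewrite oppr0 mul1r.
  have h1 : (- m%:Z - 1 - 1 == 0) = false by clear; apply/eqP; lia.
  have h2 : (- m%:Z - 1 == 0) = false by clear; apply/eqP; lia.
  rewrite exprS -mulrA -IH -(dstep _ h1 h2).
  by congr d; clear; lia.
(* The factor 1 - r z is undone towards negative indices; the remainder r^m c (-m) tends to 0
   because c is bounded and |r| < 1. *)
have cm m : c 0 = \sum_(i < m) (r * p) ^+ i * d 0 + r ^+ m * c (- m%:Z).
  elim: m => [|m ->]; first by rewrite big_ord0 add0r mul1r oppr0.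
  rewrite big_ord_recr /= -addrA; congr (_ + _).
  have -> : c (- m%:Z) = d (- m%:Z) + r * c (- m.+1%:Z).
    rewrite /d (_ : - m%:Z - 1 = - m.+1%:Z)%R; [ring | by clear; lia].
  by rewrite dneg exprMn exprSr; ring.
have lim0 : (fun m => (1 - r * p) * c 0 - d 0 :> C) @ \oo --> (0 : C).
  apply/cvg_cmod; under eq_fun do rewrite subr0.
  apply: (@squeeze_cvgr _ _ _ _ (cst 0)
    (fun m => (2 * B) * cmod (r * p) ^+ m + (2 * B) * cmod r ^+ m)).
  - near=> m; rewrite cmod_ge0 /= (cm m) mulrDr -mulr_suml mulrA.
    have -> : (1 - r * p) * (\sum_(i < m) (r * p) ^+ i) = 1 - (r * p) ^+ m.
      by rewrite -[1 - r * p]opprB mulNr -subrX1 opprB.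
    have -> : (1 - (r * p) ^+ m) * d 0 + (1 - r * p) * (r ^+ m * c (- m%:Z)) - d 0
      = - (d 0 * (r * p) ^+ m) + (1 - r * p) * c (- m%:Z) * r ^+ m by ring.
    apply: le_trans (cmodD _ _) _; rewrite cmodN !cmodM !cmodX cmodM.
    apply: lerD; first by rewrite ler_wpM2r ?exprn_ge0 ?mulr_ge0 ?cmod_ge0.
    rewrite ler_wpM2r ?exprn_ge0 ?cmod_ge0 //.
    apply: ler_pM; rewrite ?cmod_ge0 //.
    apply: le_trans (cmodD _ _) _; rewrite cmod1 cmodN.
    by rewrite -[2]/(1 + 1 : R) lerD2l ltW.
  - exact: cvg_cst.
  - rewrite -[0]addr0; apply: cvgD; apply: (@cvg_geometric R);
      by rewrite ger0_norm // cmod_ge0.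
have c0E : (1 - r * p) * c 0 = d 0.
  apply/eqP; rewrite -subr_eq0; apply/eqP.
  exact: cvg_unique (cvg_cst _) lim0.
have -> : csum (fun k => T k k) = c 0.
  by congr csum; apply/funext => k; rewrite /f addr0.
have : e * ((1 - r * p) * c 0) = l1 by rewrite c0E d0.
rewrite /e mulrA divfK // => h.
by apply: (mulIf l12'); rewrite divfK // mulrC h.
Unshelve. all: by end_near. Qed.

(* The map z |-> s2 / (s1 z + W). *)
Definition gen_mx (s1 s2 W : C) : 'M[C]_2 :=
  \matrix_(i < 2, j < 2) if i == 0 then (if j == 0 then 0 else s2)
                         else (if j == 0 then s1 else W).

(** The negative binomial series of (s2 / (s1 z + W))^k. For k = j = 0 the truncated predecessor
    gives the binomial coefficient 1, as it should. *)
Definition gen_coef (s1 s2 W : C) (j k : nat) : C :=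
  'C((k + j).-1, j)%:R * ((- s1) ^+ j * s2 ^+ k) / W ^+ (k + j).

Lemma gen_mobius_coef s1 s2 W : W != 0 ->
  mobius_coef (gen_mx s1 s2 W) (gen_coef s1 s2 W).
Proof.
move=> W0; split=> [j|j k].
  rewrite /gen_coef add0n expr0 mulr1; case: j => [|j] /=.
    by rewrite bin0 !expr0 mulr1 divr1.
  by rewrite bin_small // !mul0r.
rewrite /gen_mx !mxE /= mul0r add0r /gen_coef.
have Wn n : W ^+ n != 0 by rewrite expf_neq0.
case: j => [|j] /=.
  rewrite mulr0 add0r !addn0 !bin0 !expr0 !mul1r !exprS.
  by field; rewrite Wn W0.
rewrite addSn addnS /= binS natrD [(k.+1 + j.+1)%N]addSn addnS !exprS.
by field; rewrite Wn W0.
Qed.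

(** Induction on the power. With weights t^-j a shift of the row costs 1 / t, so the recurrence
    bounds the weighted sums by (t |W| - |s1|) S <= t |s2| S0, and t |W| - |s1| >= |s2| yields S <=
    t S0. *)
Lemma gen_coef_bound s1 s2 W : cmod s1 + cmod s2 <= t * cmod W -> W != 0 ->
  s2 != 0 -> coef_bound t (gen_coef s1 s2 W).
Proof.
move=> sep W0 s20 J l.
have [T_0 TR] := gen_mobius_coef s1 s2 W0.
set T := gen_coef s1 s2 W in T_0 TR *.
have W1 : 0 < cmod W by rewrite cmod_gt0.
have tV n : 0 <= t ^- n by rewrite invr_ge0.
elim: l => [|l IH].
  rewrite expr0; case: J => [|J]; first by rewrite big_ord0.
  rewrite big_ord_recl T_0 eqxx cmod1 mul1r expr0 invr1 big1 ?addr0 // => i _.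
  by rewrite T_0 (_ : (_ == 0)%N = false) // cmod0 mul0r.
set S := \sum_(j < J) _; rewrite -/S in IH *.
set S0 := \sum_(j < J) cmod (T j l) * _ in IH.
have tS : t * cmod W * S <= t * cmod s2 * S0 + cmod s1 * S.
  have -> : cmod s1 * S = \sum_(j < J) cmod s1 * (cmod (T j l.+1) * t ^- j).
    by rewrite mulr_sumr.
  apply: le_trans (_ : t * cmod s2 * S0 + \sum_(j < J)
     t * cmod s1 * cmod (prev_row T j l.+1) * t ^- j <= _).
    rewrite /S /S0 !mulr_sumr -big_split /=; apply: ler_sum => j _.
    rewrite !mulrA -mulrDl ler_wpM2r // -!mulrA -mulrDr ler_wpM2l ?(ltW t0) //.
    have := TR j l; rewrite /gen_mx !mxE /= mul0r add0r => h.
    rewrite -!cmodM (_ : W * _ = s2 * T j l + - (s1 * prev_row T j l.+1)).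
      by apply: le_trans (cmodD _ _) _; rewrite cmodN.
    by rewrite -h addrC addKr.
  rewrite lerD2l; case: J {S S0 IH} => [|J]; first by rewrite !big_ord0.
  rewrite big_ord_recl (_ : prev_row T (ord0 : 'I_J.+1) l.+1 = 0) //.
  rewrite cmod0 mulr0 mul0r add0r [leRHS]big_ord_recr /=.
  rewrite -[leLHS]addr0; apply: lerD; last by rewrite !mulr_ge0 ?cmod_ge0.
  apply: ler_sum => j _; rewrite /bump /= add1n le_eqVlt; apply/orP; left.
  apply/eqP; rewrite exprS invfM; field.
  by rewrite expf_neq0 ?gt_eqF.
have h0 : 0 <= S by apply: sumr_ge0 => j _; rewrite mulr_ge0 ?cmod_ge0.
rewrite exprS.
have h1 : (t * cmod W - cmod s1) * S <= t * cmod s2 * S0.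
  by rewrite mulrBl lerBlDr.
have s10 := cmod_ge0 s1.
have s2p : 0 < cmod s2 by rewrite cmod_gt0.
rewrite -(ler_pM2l s2p).
apply: le_trans (_ : (t * cmod W - cmod s1) * S <= _).
  by rewrite ler_wpM2r // lerBrDl.
apply: le_trans h1 _.
by rewrite mulrAC [_ * (t * _)]mulrA [cmod s2 * t]mulrC mulrAC ler_wpM2l // mulr_ge0 // ltW.
Qed.

End CoefMatrix.

(** * Moebius maps and multipliers *)

Section Mobius.
Variable R : realType.
Local Notation C := (Cplx R).
Local Notation sphere := (sphere R).
Implicit Types M N S X : 'M[C]_2.

Lemma ord2_cases (i : 'I_2) : i = 0 \/ i = 1.
Proof. by case: i => [[|[|i]] Hi] //; [left | right]; apply: val_inj. Qed.

Lemma mx2_ext M N : M 0 0 = N 0 0 -> M 0 1 = N 0 1 -> M 1 0 = N 1 0 ->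
  M 1 1 = N 1 1 -> M = N.
Proof.
by move=> h1 h2 h3 h4; apply/matrixP => i j;
  case: (ord2_cases i) => ->; case: (ord2_cases j) => ->.
Qed.

Lemma mul2E M N i j : (M *m N) i j = M i 0 * N 0 j + M i 1 * N 1 j.
Proof.
rewrite mxE !big_ord_recl big_ord0 addr0.
by have -> : lift ord0 ord0 = (1 : 'I_2) by exact: val_inj.
Qed.

Lemma det2E M : \det M = M 0 0 * M 1 1 - M 0 1 * M 1 0.
Proof.
rewrite (expand_det_row _ 0) !big_ord_recl big_ord0 addr0.
have l1 : lift ord0 ord0 = (1 : 'I_2) by exact: val_inj.
rewrite /cofactor !det_mx11 !mxE /= !l1.
have -> : lift 1 0 = (0 : 'I_2) by exact: val_inj.
by rewrite !expr0 !expr1 mul1r mulN1r mulrN.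
Qed.

Lemma tr2E M : \tr M = M 0 0 + M 1 1.
Proof.
rewrite /mxtrace !big_ord_recl big_ord0 addr0.
by have -> : lift ord0 ord0 = (1 : 'I_2) by exact: val_inj.
Qed.

(* The point of the sphere with homogeneous coordinates (u : v). *)
Definition pt (u v : C) : sphere := if v == 0 then None else Some (u / v).

Lemma mobiusE M z : mobius M z = if z is Some x then
  pt (M 0 0 * x + M 0 1) (M 1 0 * x + M 1 1) else pt (M 0 0) (M 1 0).
Proof. by case: z. Qed.

Lemma ptZ (c u v : C) : c != 0 -> pt (c * u) (c * v) = pt u v.
Proof.
move=> c0; rewrite /pt mulf_eq0 (negbTE c0) /=; case: eqP => // _.
by rewrite -mulf_div divff // mul1r.
Qed.

Lemma mobius_pt M (u v : C) : (u != 0) || (v != 0) ->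
  mobius M (pt u v) = pt (M 0 0 * u + M 0 1 * v) (M 1 0 * u + M 1 1 * v).
Proof.
move=> uv0; rewrite mobiusE /pt; have [v0|v0] := eqVneq v 0.
  have u0 : u != 0 by move: uv0; rewrite v0 eqxx orbF.
  by rewrite v0 !mulr0 !addr0 -/(pt _ _) -/(pt _ _) mulrC [M 1 0 * u]mulrC ptZ.
rewrite -/(pt _ _) -/(pt (M 0 0 * u + _) _) -(@ptZ v) //.
by congr pt; rewrite mulrDr mulrCA [v * (u / v)]mulrC divfK // [v * M _ _]mulrC.
Qed.

Lemma det_neq0_col M (u v : C) : \det M != 0 -> (u != 0) || (v != 0) ->
  (M 0 0 * u + M 0 1 * v != 0) || (M 1 0 * u + M 1 1 * v != 0).
Proof.
rewrite det2E => d0; apply: contraTT; rewrite negb_or !negbK.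
move=> /andP[/eqP h1 /eqP h2].
have hu : (M 0 0 * M 1 1 - M 0 1 * M 1 0) * u = 0.
  transitivity (M 1 1 * (M 0 0 * u + M 0 1 * v) - M 0 1 * (M 1 0 * u + M 1 1 * v)).
    by ring.
  by rewrite h1 h2; ring.
have hv : (M 0 0 * M 1 1 - M 0 1 * M 1 0) * v = 0.
  transitivity (M 0 0 * (M 1 0 * u + M 1 1 * v) - M 1 0 * (M 0 0 * u + M 0 1 * v)).
    by ring.
  by rewrite h1 h2; ring.
move/eqP: hu; rewrite mulf_eq0 (negbTE d0) /= => ->.
by move/eqP: hv; rewrite mulf_eq0 (negbTE d0) /= => ->.
Qed.

Definition hom_u (z : sphere) : C := if z is Some x then x else 1.
Definition hom_v (z : sphere) : C := if z is Some x then 1 else 0.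

Lemma hom_neq0 z : (hom_u z != 0) || (hom_v z != 0).
Proof. by case: z => [x|] /=; rewrite oner_eq0 ?orbT. Qed.

Lemma pt_hom z : pt (hom_u z) (hom_v z) = z.
Proof. by case: z => [x|]; rewrite /pt /= ?oner_eq0 ?divr1 ?eqxx. Qed.

Lemma mobius_mul M N : \det N != 0 -> mobius (M *m N) = mobius M \o mobius N.
Proof.
move=> dN; apply/funext => z; rewrite /comp -[z]pt_hom.
rewrite !mobius_pt ?hom_neq0 //; last by rewrite det_neq0_col ?hom_neq0.
by congr pt; rewrite !mul2E; ring.
Qed.

Lemma mobiusZ (c : C) M : c != 0 -> mobius (c *: M) = mobius M.
Proof.
move=> c0; apply/funext => z; rewrite !mobiusE; case: z => [x|].
  by rewrite !mxE -!mulrA -!mulrDr ptZ.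
by rewrite !mxE ptZ.
Qed.

Lemma mobius1 : mobius (1%:M : 'M[C]_2) = id.
Proof.
apply/funext => z; rewrite -[z]pt_hom mobius_pt ?hom_neq0 // !mxE /=.
by congr pt; rewrite mul1r mul0r ?addr0 ?add0r.
Qed.

Lemma mobius_iter M m : \det M != 0 -> iter m (mobius M) = mobius (M ^+ m).
Proof.
move=> d0; elim: m => [|m IH]; first by rewrite expr0 mobius1.
rewrite exprSr mobius_mul // -IH; apply/funext => z /=.
by rewrite -iterS iterSr.
Qed.

Lemma mobius_invmx M : \det M != 0 ->
  mobius M \o mobius (invmx M) = id /\ mobius (invmx M) \o mobius M = id.
Proof.
move=> d0; have uM : M \in unitmx by rewrite unitmxE unitfE.
split; rewrite -mobius_mul ?mulmxV ?mulVmx ?mobius1 //.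
by rewrite det_inv invr_eq0.
Qed.

Lemma pt_eq (u v u' v' : C) : (u != 0) || (v != 0) -> (u' != 0) || (v' != 0) ->
  pt u v = pt u' v' -> exists a : C, u' = a * u /\ v' = a * v.
Proof.
rewrite /pt; have [->|v0] := eqVneq v 0; have [->|v'0] := eqVneq v' 0 => //.
  rewrite !orbF => u0 u'0 _; exists (u' / u); split; first by rewrite divfK.
  by rewrite mulr0.
move=> _ _ [e]; exists (v' / v); rewrite divfK //; split => //.
by rewrite mulrAC -mulrA e mulrC divfK.
Qed.

(** Equal images of infinity and 0 make the columns proportional, the image of 1 makes the two
    factors equal, and the determinants force their square to be 1. The trace is thus determined
    only up to sign. *)
Lemma mobius_eq_tr_sqr M N : \det M = 1 -> \det N = 1 -> mobius M = mobius N ->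
  \tr M ^+ 2 = \tr N ^+ 2.
Proof.
move=> dM dN MN.
have M0 : \det M != 0 by rewrite dM oner_eq0.
have N0 : \det N != 0 by rewrite dN oner_eq0.
have H (u v : C) : (u != 0) || (v != 0) -> exists a : C,
    N 0 0 * u + N 0 1 * v = a * (M 0 0 * u + M 0 1 * v) /\
    N 1 0 * u + N 1 1 * v = a * (M 1 0 * u + M 1 1 * v).
  move=> uv; apply: pt_eq; [exact: det_neq0_col | exact: det_neq0_col |].
  by rewrite -!mobius_pt // MN.
have [|a [a1 a2]] := H 1 0; first by rewrite oner_eq0.
have [|b [b1 b2]] := H 0 1; first by rewrite oner_eq0 orbT.
have [|c [c1 c2]] := H 1 1; first by rewrite oner_eq0.
rewrite !mulr1 !mulr0 ?addr0 ?add0r in a1 a2 b1 b2 c1 c2.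
move: dM dN; rewrite !det2E !tr2E a1 a2 b1 b2 => dM dN.
have ab : a = b.
  rewrite a1 b1 in c1; rewrite a2 b2 in c2.
  have : (b - a) * (M 0 0 * M 1 1 - M 0 1 * M 1 0) = 0.
    transitivity ((M 0 0 + M 0 1) * (a * M 1 0 + b * M 1 1) -
      (M 1 0 + M 1 1) * (a * M 0 0 + b * M 0 1)); first ring.
    by rewrite c1 c2; ring.
  by rewrite dM mulr1 => /eqP; rewrite subr_eq0 => /eqP.
rewrite -ab -mulrDr exprMn.
have -> : a ^+ 2 = 1.
  rewrite -dN -ab -[LHS]mulr1 -{1}dM; ring.
by rewrite mul1r.
Qed.

Definition dilation (h : C) : 'M[C]_2 :=
  diag_mx (\row_(i < 2) if i == 0 then h else h^-1).

Lemma dilationE h : [/\ dilation h 0 0 = h, dilation h 0 1 = 0,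
  dilation h 1 0 = 0 & dilation h 1 1 = h^-1].
Proof. by split; rewrite !mxE /= ?mulr1n ?mulr0n. Qed.

Lemma det_dilation h : h != 0 -> \det (dilation h) = 1.
Proof. by move=> h0; rewrite det2E; case: (dilationE h) => -> -> -> ->; rewrite divff // mulr0 subr0. Qed.

Lemma dilationX h m : dilation h ^+ m = dilation (h ^+ m).
Proof.
elim: m => [|m IH].
  rewrite !expr0; case: (dilationE 1) => a b c d.
  by apply: mx2_ext; rewrite ?a ?b ?c ?d ?invr1 !mxE.
rewrite exprS IH; case: (dilationE h) => a b c d.
case: (dilationE (h ^+ m)) => a' b' c' d'.
case: (dilationE (h ^+ m.+1)) => a2 b2 c2 d2.
apply: mx2_ext; rewrite mul2E ?a ?b ?c ?d ?a' ?b' ?c' ?d' ?a2 ?b2 ?c2 ?d2.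
- by rewrite mulr0 addr0 exprS.
- by rewrite mulr0 mul0r addr0.
- by rewrite mulr0 mul0r addr0.
- by rewrite mulr0 add0r exprS invfM.
Qed.

Lemma det_conj_dilation S h : \det S = 1 -> h != 0 ->
  \det (S *m dilation h *m invmx S) = 1.
Proof. by move=> dS h0; rewrite !det_mulmx det_inv dS det_dilation // invr1 !mulr1. Qed.

Lemma tr_conj S X : \det S = 1 -> \tr (S *m X *m invmx S) = \tr X.
Proof.
move=> dS; have uS : S \in unitmx by rewrite unitmxE unitfE dS oner_eq0.
by rewrite mxtrace_mulC mulmxA mulVmx // mul1mx.
Qed.

(** The squared trace q + 2 + q^-1 leaves q and 1 / q, and only one of them lies in the unit
    disc. *)
Lemma is_multiplier_unique (f : sphere -> sphere) q q' :
  is_multiplier f q -> is_multiplier f q' -> q = q'.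
Proof.
move=> [q1 [S [h [dS h0 hq fE]]]] [q'1 [S' [h' [dS' h'0 h'q fE']]]].
have := mobius_eq_tr_sqr (det_conj_dilation dS h0) (det_conj_dilation dS' h'0).
rewrite -/(dilation h) in fE; rewrite -/(dilation h') in fE'.
rewrite -fE -fE' => /(_ erefl); rewrite !tr_conj // !tr2E.
case: (dilationE h) => -> _ _ ->; case: (dilationE h') => -> _ _ -> e.
have q0 : q != 0 by rewrite -hq expf_neq0.
have q'0 : q' != 0 by rewrite -h'q expf_neq0.
have : (q - q') * (1 - q * q') = 0.
  have e1 : (h + h^-1) ^+ 2 = q + 2 + q^-1 by rewrite -hq; field.
  have e2 : (h' + h'^-1) ^+ 2 = q' + 2 + q'^-1 by rewrite -h'q; field.
  rewrite e1 e2 in e.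
  transitivity (q * q' * ((q' + 2 + q'^-1) - (q + 2 + q^-1))).
    by field; rewrite q0 q'0.
  by rewrite e subrr mulr0.
move/eqP; rewrite mulf_eq0 !subr_eq0 => /orP[/eqP //|/eqP h1].
move: q1 q'1; rewrite !ltr_cmod1 => q1 q'1.
have := congr1 (@cmod R) h1; rewrite cmod1 cmodM => h2.
have : cmod q * cmod q' < 1 by rewrite mulr_ilt1 ?cmod_ge0.
by rewrite -h2 ltxx.
Qed.

Lemma multiplierE (f : sphere -> sphere) q : is_multiplier f q -> multiplier f = q.
Proof.
move=> fq; rewrite /multiplier; case: xgetP => [q' _ fq'|/(_ q)] //.
exact: is_multiplier_unique fq' fq.
Qed.

Lemma csqrt_exists (z : C) : exists s : C, s ^+ 2 = z.
Proof. by exists (sqrtC z); rewrite sqrtCK. Qed.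

Lemma is_multiplier_conj (H : 'M[C]_2) (f f' : sphere -> sphere) q :
  \det H != 0 -> mobius H \o f = f' \o mobius H ->
  is_multiplier f q -> is_multiplier f' q.
Proof.
move=> dH Hf [q1 [S [h [dS h0 hq fE]]]]; split => //.
(* [is_multiplier] asks for a conjugating matrix of determinant 1, whence the scaling by a square
   root of 1 / det H. *)
have [c c2] := csqrt_exists (\det H)^-1.
have c0 : c != 0.
  by apply/eqP => c0; move: c2; rewrite c0 expr0n => /esym/eqP; rewrite invr_eq0 (negbTE dH).
have uH : H \in unitmx by rewrite unitmxE unitfE.
have uS : S \in unitmx by rewrite unitmxE unitfE dS oner_eq0.
have dSH : \det (c *: (H *m S)) = 1 by rewrite detZ c2 det_mulmx dS mulr1 mulVf.
exists (c *: (H *m S)), h; split; [exact: dSH | exact: h0 | exact: hq |].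
have [HV _] := mobius_invmx dH.
have -> : f' = mobius H \o f \o mobius (invmx H).
  by rewrite Hf -compA HV.
rewrite fE -/(dilation h).
have dX : \det (S *m dilation h *m invmx S) != 0.
  by rewrite (det_conj_dilation dS h0) oner_eq0.
have dHi : \det (invmx H) != 0 by rewrite det_inv invr_eq0.
rewrite -(mobius_mul _ dX) -(mobius_mul _ dHi); congr mobius.
have uA : c *: (H *m S) \in unitmx by rewrite unitmxE unitfE dSH oner_eq0.
have AB : c *: (H *m S) *m (c^-1 *: (invmx S *m invmx H)) = 1%:M.
  rewrite -scalemxAl -scalemxAr scalerA divff // scale1r -mulmxA.
  by rewrite (mulmxA S) mulmxV // mul1mx mulmxV.
have -> : invmx (c *: (H *m S)) = c^-1 *: (invmx S *m invmx H).
  by rewrite -[RHS]mul1mx -(mulVmx uA) -mulmxA AB mulmx1.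
rewrite -!scalemxAl -scalemxAr scalerA divff // scale1r.
by rewrite !mulmxA.
Qed.

Lemma is_multiplier_iter (f : sphere -> sphere) q m : (0 < m)%N ->
  is_multiplier f q -> is_multiplier (iter m f) (q ^+ m).
Proof.
move=> m0 [q1 [S [h [dS h0 hq fE]]]]; split.
  move: q1; rewrite !ltr_cmod1 cmodX => q1.
  by rewrite exprn_ilt1 ?cmod_ge0 // -lt0n.
have hm0 : h ^+ m != 0 by rewrite expf_neq0.
have hmq : (h ^+ m) ^+ 2 = q ^+ m by rewrite -hq -!exprM mulnC.
exists S, (h ^+ m); split; [exact: dS | exact: hm0 | exact: hmq |].
have uS : S \in unitmx by rewrite unitmxE unitfE dS oner_eq0.
rewrite fE -/(dilation h) -/(dilation (h ^+ m)) mobius_iter; last first.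
  by rewrite det_conj_dilation ?oner_eq0.
congr mobius; rewrite -dilationX; elim: m {m0 hm0 hmq} => [|m IH].
  by rewrite !expr0 mulmx1 mulmxV.
rewrite exprS IH exprS -!mulmxE !mulmxA.
by rewrite -(mulmxA _ (invmx S) S) mulVmx // mulmx1.
Qed.

(* The Hermitian form |v|^2 - |u|^2, positive on the unit disc, is strictly
   increased (up to the normalisation by the determinant). Unlike being a
   contraction of the disc, this is visibly stable under products and locates
   the eigenvectors. *)
Definition expanding M : Prop := \det M != 0 /\
  forall u v : C, (u != 0) || (v != 0) ->
  cmod (\det M) * (cmod v ^+ 2 - cmod u ^+ 2) <
  cmod (M 1 0 * u + M 1 1 * v) ^+ 2 - cmod (M 0 0 * u + M 0 1 * v) ^+ 2.

Lemma expanding_mul M N : expanding M -> expanding N -> expanding (M *m N).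
Proof.
move=> [dM eM] [dN eN]; split; first by rewrite det_mulmx mulf_neq0.
move=> u v uv; rewrite det_mulmx cmodM -mulrA.
have h := eM _ _ (det_neq0_col dN uv).
rewrite !mul2E.
have -> : (M 1 0 * N 0 0 + M 1 1 * N 1 0) * u + (M 1 0 * N 0 1 + M 1 1 * N 1 1) * v
  = M 1 0 * (N 0 0 * u + N 0 1 * v) + M 1 1 * (N 1 0 * u + N 1 1 * v) by ring.
have -> : (M 0 0 * N 0 0 + M 0 1 * N 1 0) * u + (M 0 0 * N 0 1 + M 0 1 * N 1 1) * v
  = M 0 0 * (N 0 0 * u + N 0 1 * v) + M 0 1 * (N 1 0 * u + N 1 1 * v) by ring.
apply: lt_trans h; rewrite ltr_pM2l ?cmod_gt0 //; exact: eN.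
Qed.

Lemma gen_mxE (s1 s2 W : C) : [/\ gen_mx s1 s2 W 0 0 = 0, gen_mx s1 s2 W 0 1 = s2,
  gen_mx s1 s2 W 1 0 = s1 & gen_mx s1 s2 W 1 1 = W].
Proof. by split; rewrite !mxE. Qed.

(** The reverse triangle inequality reduces the claim to a quadratic form in the moduli of u and
    v. *)
Lemma expanding_gen (s1 s2 W : C) : s1 != 0 -> s2 != 0 ->
  cmod s1 + cmod s2 < cmod W -> expanding (gen_mx s1 s2 W).
Proof.
move=> s10 s20 sep; case: (gen_mxE s1 s2 W) => a b c d.
rewrite /expanding det2E a b c d mul0r sub0r; split.
  by rewrite oppr_eq0 mulf_neq0.
move=> u v uv; rewrite cmodN !cmodM mul0r add0r.
have h := cmod_le1D (W * v) (s1 * u); have h' := cmod_le1D (s1 * u) (W * v).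
rewrite [W * v + _]addrC in h; move: h h'; rewrite !cmodM.
have r1 : 0 < cmod s1 by rewrite cmod_gt0.
have r2 : 0 < cmod s2 by rewrite cmod_gt0.
have Z0 := cmod_ge0 (s1 * u + W * v).
have x0 := cmod_ge0 u; have y0 := cmod_ge0 v.
have xy : 0 < cmod u + cmod v.
  by rewrite lt_def addr_ge0 // andbT paddr_eq0 // !cmod_eq0 negb_and.
move: r1 r2 Z0 x0 y0 xy sep; set Z := cmod (_ + _).
set x := cmod u; set y := cmod v; set p := cmod s1; set q := cmod s2.
set w := cmod W => r1 r2 Z0 x0 y0 xy sep h h'.
have Z2 : (w * y - p * x) ^+ 2 <= Z ^+ 2.
  rewrite -ler_sqrt ?sqr_ge0 // !sqrtr_sqr (ger0_norm Z0) ler_norml.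
  by apply/andP; split; lra.
rewrite exprMn; apply: lt_le_trans (_ : (w * y - p * x) ^+ 2 - q ^+ 2 * y ^+ 2 <= _);
  last by rewrite lerD2r.
(* The discriminant of the remaining quadratic form in (x, y) is
   - p q (w^2 - (p + q)^2). *)
rewrite -subr_gt0.
have -> : (w * y - p * x) ^+ 2 - q ^+ 2 * y ^+ 2 - q * p * (y ^+ 2 - x ^+ 2) =
  (p * ((p + q) * x - w * y) ^+ 2 + q * (w ^+ 2 - (p + q) ^+ 2) * y ^+ 2) / (p + q).
  by field; rewrite gt_eqF // addr_gt0.
apply: divr_gt0; last exact: addr_gt0.
have wpq : 0 < w ^+ 2 - (p + q) ^+ 2.
  by rewrite subr_gt0 ltrXn2r ?nnegrE //; apply/ltW; rewrite ?addr_gt0 //;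
     apply: lt_trans sep; rewrite addr_gt0.
have [y00|y00] := eqVneq y 0.
  rewrite y00 mulr0 subr0 expr0n mulr0 addr0 mulr_gt0 // exprn_gt0 //.
  by rewrite mulr_gt0 ?addr_gt0 //; move: xy; rewrite y00 addr0.
rewrite ltr_wpDl //; first by rewrite mulr_ge0 ?sqr_ge0 // ltW.
apply: mulr_gt0; first exact: mulr_gt0.
by rewrite exprn_gt0 // lt_def y00 y0.
Qed.

(** The columns of the adjugate of l - M are eigenvectors; if both vanish, M is the scalar l and any
    vector serves. *)
Lemma eigenvector2 M (l : C) : l ^+ 2 - \tr M * l + \det M = 0 ->
  exists u v : C, [/\ (u != 0) || (v != 0), M 0 0 * u + M 0 1 * v = l * u &
    M 1 0 * u + M 1 1 * v = l * v].
Proof.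
rewrite tr2E det2E => e.
have [h1|h1] := boolP ((M 0 1 != 0) || (l - M 0 0 != 0)).
  exists (M 0 1), (l - M 0 0); split => //; first by ring.
  apply/eqP; rewrite -subr_eq0; apply/eqP.
  by rewrite -[RHS]oppr0 -e; ring.
have [h2|h2] := boolP ((l - M 1 1 != 0) || (M 1 0 != 0)).
  exists (l - M 1 1), (M 1 0); split => //; last by ring.
  apply/eqP; rewrite -subr_eq0; apply/eqP.
  by rewrite -[RHS]oppr0 -e; ring.
move: h1 h2; rewrite !negb_or !negbK !subr_eq0.
move=> /andP[/eqP h1 /eqP h2] /andP[/eqP h3 /eqP h4].
exists 1, 0; rewrite oner_eq0; split => //.
  by rewrite h2; ring.
by rewrite h4; ring.
Qed.

(** At an eigenvector (u, v) of eigenvalue l, with l' the other eigenvalue, the expansion says 0 <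
    (|l| - |l'|) (|v|^2 - |u|^2). So |l| and |l'| differ, the larger eigenvalue has its fixed point
    p = u / v inside the disc, and the smaller one has its fixed point 1 / r outside. *)
Lemma expanding_eigen M : expanding M -> exists l1 l2 p r : C,
  [/\ M 0 0 * p + M 0 1 = l1 * p, M 1 0 * p + M 1 1 = l1,
      M 0 0 + M 0 1 * r = l2 & M 1 0 + M 1 1 * r = l2 * r] /\
  [/\ cmod p < 1, cmod r < 1, cmod l2 < cmod l1 & l2 != 0].
Proof.
move=> [dM eM].
have [la [lb [lab labD]]] : exists la lb : C, la * lb = \det M /\ la + lb = \tr M.
  have [s s2] := csqrt_exists (\tr M ^+ 2 - 4 * \det M).
  exists ((\tr M + s) / 2), ((\tr M - s) / 2); split; last by field.
  transitivity ((\tr M ^+ 2 - s ^+ 2) / 4); first by field.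
  by rewrite s2; field.
have root l l' : l * l' = \det M -> l + l' = \tr M ->
    l ^+ 2 - \tr M * l + \det M = 0 by move=> <- <-; ring.
have key l l' : l * l' = \det M -> l + l' = \tr M -> exists u v : C,
   [/\ (u != 0) || (v != 0), M 0 0 * u + M 0 1 * v = l * u,
       M 1 0 * u + M 1 1 * v = l * v &
       0 < (cmod l - cmod l') * (cmod v ^+ 2 - cmod u ^+ 2)].
  move=> h1 h2; have [u [v [uv e1 e2]]] := eigenvector2 (root _ _ h1 h2).
  exists u, v; split => //; have := eM u v uv.
  rewrite e1 e2 -h1 !cmodM !exprMn => h.
  have l0 : 0 < cmod l.
    by rewrite cmod_gt0; apply: contraNneq dM => l0; rewrite -h1 l0 mul0r.
  rewrite -(pmulr_rgt0 _ l0); nra.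
wlog lt_ab : la lb lab labD / cmod lb < cmod la => [H|].
  have [h|h|h] := ltgtP (cmod lb) (cmod la); first exact: H lab labD h.
    by apply: (H lb la) => //; rewrite ?[lb * _]mulrC ?[lb + _]addrC.
  have [u [v [_ _ _]]] := key _ _ lab labD.
  by rewrite h subrr mul0r ltxx.
have [u [v [uv e1 e2 s1]]] := key _ _ lab labD.
rewrite mulrC in lab; rewrite addrC in labD.
have [u' [v' [uv' e1' e2' s1']]] := key _ _ lab labD.
have uvlt : cmod u < cmod v.
  move: s1; rewrite pmulr_rgt0 ?subr_gt0 // ltr_pXn2r ?nnegrE ?cmod_ge0 //.
have uvlt' : cmod v' < cmod u'.
  move: s1'; rewrite nmulr_rgt0 ?subr_lt0 // ltr_pXn2r ?nnegrE ?cmod_ge0 //.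
have v0 : v != 0 by rewrite -cmod_gt0 (le_lt_trans _ uvlt) // cmod_ge0.
have u0 : u' != 0 by rewrite -cmod_gt0 (le_lt_trans _ uvlt') // cmod_ge0.
exists la, lb, (u / v), (v' / u'); split; split.
- by apply: (mulIf v0); rewrite mulrDl -!(mulrA _ (u / v)) divfK.
- by apply: (mulIf v0); rewrite mulrDl -!(mulrA _ (u / v)) divfK.
- by apply: (mulIf u0); rewrite mulrDl -!(mulrA _ (v' / u')) divfK.
- by apply: (mulIf u0); rewrite mulrDl -!(mulrA _ (v' / u')) divfK.
- by rewrite cmod_div ltr_pdivrMr ?cmod_gt0 // mul1r.
- by rewrite cmod_div ltr_pdivrMr ?cmod_gt0 // mul1r.
- exact: lt_ab.
- by apply: contraNneq dM => l0; rewrite -lab l0 mul0r.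
Qed.

(* The trace formula for a single Moebius contraction M of the disc: M is
   conjugate to its multiplier q, and composition with M has trace q / (1 - q)
   on functions modulo constants. *)
Lemma expanding_multiplier (t : R) M L (T : nat -> nat -> C) :
  0 < t -> t < 1 -> expanding M -> \det L != 0 ->
  coef_bound t T -> mobius_coef M T ->
  exists2 q, is_multiplier (mobius (L *m M *m invmx L)) q &
    csum (fun k => T k.+1 k.+1) = q / (1 - q).
Proof.
move=> t0 t1 eM dL bT rT.
have [l1 [l2 [p [r [[e1 e2 e3 e4] [p1 r1 l12 l20]]]]]] := expanding_eigen eM.
have l10 : l1 != 0 by rewrite -cmod_gt0 (le_lt_trans _ l12) // cmod_ge0.
have l1l2 : l1 != l2 by apply: contraTneq l12 => ->; rewrite ltxx.
have q1 : cmod (l2 / l1) < 1.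
  by rewrite cmod_div ltr_pdivrMr ?cmod_gt0 // mul1r.
exists (l2 / l1); last first.
  have cT : cvgn (series (fun k => T k k)).
    apply: (cvgn_series_geo (ltW t0) t1 (K := 1)) => k; rewrite mul1r.
    apply: le_trans (coef_bound_le t0 k k bT) _.
    by rewrite exprD ler_piMl ?exprn_ge0 ?exprn_ile1 // ltW.
  have := coef_trace t0 t1 bT rT e1 e2 e3 e4 p1 r1 l1l2.
  rewrite csum_recl // (proj1 rT) eqxx mulr1n => h.
  have -> : csum (fun k => T k.+1 k.+1) = l1 / (l1 - l2) - 1 by rewrite -h; ring.
  by field; rewrite l10 subr_eq0 l1l2.
have [h h2] := csqrt_exists (l2 / l1).
have h0 : h != 0.
  apply/eqP => h0; move: h2; rewrite h0 expr0n => /esym/eqP.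
  by rewrite mulf_eq0 invr_eq0 (negbTE l10) (negbTE l20).
(* The eigenvectors as columns, that of l2 first, to match diag (h, 1 / h) with h^2 = l2 / l1. *)
pose V : 'M[C]_2 := \matrix_(i < 2, j < 2)
  if i == 0 then (if j == 0 then 1 else p) else (if j == 0 then r else 1).
have [V00 V01 V10 V11] : [/\ V 0 0 = 1, V 0 1 = p, V 1 0 = r & V 1 1 = 1].
  by split; rewrite !mxE.
have rp1 : cmod (p * r) < 1 by rewrite cmodM mulr_ilt1 ?cmod_ge0.
have dV : \det V != 0.
  rewrite det2E V00 V01 V10 V11 mul1r subr_eq0.
  by apply: contraTneq rp1 => <-; rewrite cmod1 ltxx.
have MV : M *m V = (l2 / h) *: (V *m dilation h).
  case: (dilationE h) => a b c d.
  have hh : l2 / h * h^-1 = l1.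
    by rewrite -mulrA -invfM -expr2 h2 invf_div mulrCA divff // mulr1.
  have sE i j : (l2 / h *: (V *m dilation h)) i j = l2 / h * (V *m dilation h) i j.
    by rewrite mxE.
  apply: mx2_ext; rewrite sE !mul2E ?V00 ?V01 ?V10 ?V11 ?a ?b ?c ?d.
  - by rewrite mulr1 e3 mul1r mulr0 addr0 divfK.
  - by rewrite mulr1 e1 mulr0 add0r mulrCA hh mulrC.
  - by rewrite mulr1 e4 mulr0 addr0 [r * h]mulrC mulrA divfK.
  - by rewrite mulr1 e2 mulr0 add0r mul1r hh.
have uV : V \in unitmx by rewrite unitmxE unitfE.
have uL : L \in unitmx by rewrite unitmxE unitfE.
have f1 : is_multiplier (mobius (M : 'M[C]_2)) (l2 / l1).
  have mult_d : is_multiplier (mobius (dilation h)) (l2 / l1).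
    split; first by rewrite ltr_cmod1.
    exists 1%:M, h; split; [exact: det1 | exact: h0 | exact: h2 |].
    by rewrite invmx1 mulmx1 mul1mx.
  apply: is_multiplier_conj mult_d; first exact: dV.
  rewrite -mobius_mul; last by rewrite det_dilation ?oner_eq0.
  rewrite -mobius_mul // MV mobiusZ // mulf_neq0 // invr_eq0 //.
apply: is_multiplier_conj f1; first exact: dL.
have dM : \det M != 0 by case: eM.
rewrite -mobius_mul // -mobius_mul // -!mulmxA mulVmx // mulmx1.
by [].
Qed.

End Mobius.

Lemma sum_cons_tuple (V : nmodType) (T : finType) n (F : n.+1.-tuple T -> V) :
  \sum_(s : n.+1.-tuple T) F s =
  \sum_(c : T) \sum_(s : n.-tuple T) F [tuple of c :: s].
Proof.
rewrite pair_bigA /= (reindex (fun p : T * n.-tuple T => [tuple of p.1 :: p.2])) //.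
exists (fun s => (thead s, [tuple of behead s])) => [[c s] _|s _] /=.
  by rewrite theadE; congr (_, _); apply: val_inj.
by rewrite -tuple_eta.
Qed.

Lemma sum_pair (V : nmodType) (A B : finType) (F : A * B -> V) :
  \sum_p F p = \sum_a \sum_b F (a, b).
Proof. by rewrite pair_bigA; apply: eq_bigr => -[]. Qed.

(** * Traces of the powers of A *)

Section SchottkyOperator.
Variables (R : realType) (g : nat).
Local Notation C := (Cplx R).
Local Notation I := (idx g).
Variables (w sg : I -> C) (t : R).
Hypotheses (t0 : 0 < t) (t1 : t < 1).
Hypothesis sg0 : forall a, sg a != 0.
Hypothesis sgN : forall a, sg (opp_idx a) = sg a.
Hypothesis sep : forall a b, a != b ->
  cmod (sg a) + cmod (sg b) <= t * cmod (w a - w b).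

Lemma opp_idxK : involutive (@opp_idx g).
Proof. by case=> a b; rewrite /opp_idx /= negbK. Qed.

Lemma opp_idx_neq (a b : I) : a != opp_idx b -> opp_idx a != b.
Proof. by apply: contra => /eqP <-; rewrite opp_idxK. Qed.

Lemma sep_neq0 a b : a != b -> w a - w b != 0.
Proof.
move=> ab; rewrite -cmod_gt0 -(pmulr_rgt0 _ t0).
by apply: lt_le_trans (sep ab); rewrite addr_gt0 // cmod_gt0.
Qed.

(** The map gamma_b from the disc around w (-a) to the disc around w (-b), in the coordinates which
    make both of them the unit disc. *)
Definition letter_coef (a b : I) : nat -> nat -> C :=
  if a == opp_idx b then fun _ _ => 0
  else gen_coef (sg a) (sg b) (w (opp_idx a) - w b).

Fixpoint path_coef_rec (a b : I) (s : seq I) : nat -> nat -> C :=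
  if s is c :: s' then coef_comp (letter_coef a b) (path_coef_rec b c s')
  else letter_coef a b.

(* The coefficients of the composite of the maps of the letters of s, in the
   local coordinates of the discs, starting from the disc around w (-a); the
   junk value 0 is for the empty word. *)
Definition path_coef (a : I) (s : seq I) : nat -> nat -> C :=
  if s is b :: s' then path_coef_rec a b s' else fun _ _ => 0.

Lemma path_coef_cons a b c s : path_coef a [:: b, c & s] =
  coef_comp (letter_coef a b) (path_coef b (c :: s)).
Proof. by []. Qed.

Lemma coef_bound0 : coef_bound t (fun _ _ => 0 : C).
Proof.
move=> J l; rewrite big1 ?exprn_ge0 ?(ltW t0) // => j _.
by rewrite cmod0 mul0r.
Qed.

Lemma letter_bound a b : coef_bound t (letter_coef a b).
Proof.
rewrite /letter_coef; case: ifPn => [_|ab]; first exact: coef_bound0.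
have oab := opp_idx_neq ab.
apply: gen_coef_bound => //; last exact: sep_neq0.
by have := sep oab; rewrite sgN.
Qed.

Lemma path_bound a s : coef_bound t (path_coef a s).
Proof.
case: s => [|b s]; first exact: coef_bound0.
elim: s a b => [|c s IH] a b; first exact: letter_bound.
apply: coef_comp_bound => //; [exact: letter_bound | exact: IH].
Qed.

Lemma letter_col0 a b k : letter_coef a b k.+1 0 = 0.
Proof.
rewrite /letter_coef; case: ifP => // _.
by rewrite /gen_coef add0n /= bin_small // !mul0r.
Qed.

Lemma letter_path_cvg a b c s j l :
  cvgn (series (fun m => letter_coef a b j m * path_coef c s m l)).
Proof.
by apply: (is_cvg_coef_comp t0 t1); [exact: letter_bound | exact: path_bound].
Qed.

(** Constants are mapped to constants, so the column of index 0 has no positive rows and the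
    matrices restricted to positive indices still multiply: this is the passage to functions modulo
    constants. *)
Lemma path_coef_cons_pos a b s k l : s != [::] ->
  path_coef a (b :: s) k.+1 l =
  csum (fun m => letter_coef a b k.+1 m.+1 * path_coef b s m.+1 l).
Proof.
case: s => // c s _; rewrite path_coef_cons /coef_comp csum_recl.
  by rewrite letter_col0 mul0r add0r.
exact: letter_path_cvg.
Qed.

(** The blocks of the (n + 1)-st power of the matrix of the [letter_coef], expanded over the paths
    from a to b. *)
Definition power_coef n (a b : I) (k l : nat) : C :=
  \sum_(s : n.+1.-tuple I | last a s == b) path_coef a s k l.

Lemma power_coef0 a b k l : power_coef 0 a b k l = letter_coef a b k l.
Proof.
rewrite /power_coef big_mkcond sum_cons_tuple /= (bigD1 b) //=.
rewrite [X in _ + X]big1 ?addr0 => [|c cb].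
  rewrite (bigD1 [tuple]) //= eqxx big1 ?addr0 // => s /eqP[].
  exact: tuple0.
by rewrite big1 // => s _; rewrite tuple0 /= (negbTE cb).
Qed.

Lemma power_path_cvg n a c b j l :
  cvgn (series (fun m => letter_coef a c j m.+1 * power_coef n c b m.+1 l)).
Proof.
under eq_fun do rewrite mulr_sumr.
apply: is_cvg_csum_sum => s; exact: (is_cvg_csumS (@letter_path_cvg a c c s j l)).
Qed.

Lemma power_coefS n a b k l : power_coef n.+1 a b k.+1 l =
  \sum_c csum (fun m => letter_coef a c k.+1 m.+1 * power_coef n c b m.+1 l).
Proof.
rewrite /power_coef big_mkcond sum_cons_tuple; apply: eq_bigr => c _.
under [in RHS]eq_fun do rewrite mulr_sumr.
rewrite csum_sum => [|s]; last first.
  exact: (is_cvg_csumS (@letter_path_cvg a c c s k.+1 l)).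
rewrite -big_mkcondr /=; apply: eq_big => s.
  by case: s => [[|x s]].
by move=> _; apply: path_coef_cons_pos; rewrite -size_eq0 size_tuple.
Qed.

(** The inverse of the midpoint of t and 1, chosen so that 1 < u < 1 / t. *)
Let u : R := 2 / (1 + t).
Let t10 : 0 < 1 + t. Proof. by rewrite addr_gt0. Qed.
Let u1 : 1 < u.
Proof. by rewrite /u ltr_pdivlMr // mul1r; move: t1; lra. Qed.
Let u0 : 0 < u. Proof. exact: lt_trans u1. Qed.
Let ut : u * t < 1.
Proof. by rewrite /u mulrAC ltr_pdivrMr // mul1r; move: t1; lra. Qed.

(* The radii of the discs are first dilated by u, which keeps them disjoint:
   Grunsky's inequality then maps the weak norm to the strong one, and each
   letter gains the factor u^-4 by which they differ. *)
Definition strong_norm (K : nat) (z : nat -> C) : R :=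
  \sum_(k < K) k.+1%:R * u ^+ (2 * k.+1) * cmod (z k) ^+ 2.
Definition weak_norm (K : nat) (z : nat -> C) : R :=
  \sum_(k < K) k.+1%:R * u ^- (2 * k.+1) * cmod (z k) ^+ 2.

Lemma weak_le_strong K z : weak_norm K z <= u ^- 4 * strong_norm K z.
Proof.
rewrite /weak_norm /strong_norm mulr_sumr; apply: ler_sum => k _.
rewrite [leRHS]mulrA ler_wpM2r ?sqr_ge0 // [leRHS]mulrCA ler_wpM2l ?ler0n //.
have uk n : 0 < u ^+ n by rewrite exprn_gt0.
rewrite mulrC ler_pdivlMr // mulrC ler_pdivrMr // -exprD.
by rewrite ler_weXn2l ?(ltW u1) //; clear; lia.
Qed.

Lemma strong_norm_le K K' z : (K <= K')%N -> strong_norm K z <= strong_norm K' z.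
Proof.
move=> KK; rewrite /strong_norm.
rewrite (big_ord_widen K' (fun k => k.+1%:R * u ^+ (2 * k.+1) * cmod (z k) ^+ 2) KK).
rewrite big_mkcond; apply: ler_sum => k _; case: ifP => // _.
by rewrite !mulr_ge0 ?ler0n ?exprn_ge0 ?cmod_ge0 // ltW.
Qed.

(** The logarithm splits as - log (1 + s1 x / W) - log (1 - s2 y / (s1 x + W)), so for l > 0 the
    coefficient of y^l is the l-th power of s2 / (s1 x + W) divided by l. *)
Lemma gen_coef_log (s1 s2 W : C) k l :
  gen_coef s1 s2 W k l.+1 = l.+1%:R * log_coef s1 s2 W k l.+1.
Proof.
rewrite /gen_coef /log_coef !exprMn -!exprVn.
have -> : (l.+1 + k).-1 = (k + l)%N by rewrite addSn /= addnC.
have e : ((k + l.+1) * 'C(k + l, k) = l.+1 * 'C(k + l.+1, l.+1))%N.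
  rewrite -mul_bin_diag addnS /=; congr (_ * _)%N.
  by rewrite -bin_sub ?leq_addr // addKn.
have kl0 : (k + l.+1)%:R != 0 :> C by rewrite pnatr_eq0 addnS.
have -> : 'C(k + l, k)%:R = l.+1%:R * ('C(k + l.+1, l.+1)%:R / (k + l.+1)%:R) :> C.
  by apply: (mulIf kl0); rewrite mulrA divfK // -!natrM -e mulnC.
by rewrite addnC exprD exprVn; ring.
Qed.

(** Replacing the row index a by -a turns the blocks into the symmetric Grunsky matrix times diag
    (l). Dilating all radii by u multiplies its entries by u^(k + l): the part u^k makes the norm of
    the image strong, and u^l is absorbed into the vector, whose norm becomes weak. *)
Lemma operator_bound_fin K (z : I -> nat -> C) :
  \sum_a strong_norm K (fun k =>
     \sum_b \sum_(l < K) letter_coef a b k.+1 l.+1 * z b l) <=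
  \sum_b weak_norm K (z b).
Proof.
pose J : finType := (I * 'I_K)%type.
pose S (p p' : J) : C := if p.1 == p'.1 then 0 else
  log_coef (rtoc u * sg p.1) (rtoc u * sg p'.1) (w p.1 - w p'.1) p.2.+1 p'.2.+1.
pose d (p : J) : R := p.2.+1%:R.
have d0 p : 0 < d p by rewrite ltr0n.
have Ssym p p' : S p p' = S p' p.
  by rewrite /S eq_sym; case: eqP => // _; rewrite log_coef_sym opprB.
have cu : cmod (rtoc u) = u by rewrite cmod_real // ltW.
have Q (y : J -> C) : 0 <= \sum_p (cmod (y p) ^+ 2 / d p +
    cre (\sum_p' S p p' * y p * y p')).
  pose y' a k : C := if insub k is Some k' then y (a, k') else 0.
  have y'E a (k : 'I_K) : y' a k = y (a, k).
    by rewrite /y' valK.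
  have usg0 a : rtoc u * sg a != 0.
    by rewrite mulf_neq0 // -cmod_gt0 cu.
  have usep a b : a != b ->
      cmod (rtoc u * sg a) + cmod (rtoc u * sg b) < cmod (w a - w b).
    move=> ab; rewrite !cmodM cu -mulrDr.
    apply: le_lt_trans (_ : u * (t * cmod (w a - w b)) < _).
      by rewrite ler_pM2l // sep.
    by rewrite mulrA gtr_pMl // cmod_gt0 sep_neq0.
  apply: le_trans (grunsky_form K y' usg0 usep) _.
  rewrite le_eqVlt; apply/orP; left; apply/eqP.
  rewrite [RHS]sum_pair.
  apply: eq_bigr => a _; rewrite big_split /=; congr (_ + _).
    by apply: eq_bigr => k _; rewrite y'E.
  rewrite -!cre_sum; congr cre.
  under [RHS]eq_bigr do rewrite sum_pair.
  rewrite [RHS]exchange_big /= big_mkcond; apply: eq_bigr => b _.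
  rewrite /S /= eq_sym; case: (eqVneq a b) => ab /=.
    by rewrite big1 // => k _; rewrite big1 // => l _; rewrite !mul0r.
  by apply: eq_bigr => k _; apply: eq_bigr => l _; rewrite !y'E.
have uC n : rtoc u ^+ n != 0 by rewrite expf_neq0 // -cmod_gt0 cu.
have := sym_form_contraction d0 Ssym Q
  (fun p : J => rtoc u ^- p.2.+1 * z p.1 p.2).
rewrite [leLHS]sum_pair [leRHS]sum_pair.
rewrite (reindex_inj (inv_inj opp_idxK)) /= => h.
apply: le_trans (le_trans h _).
  rewrite le_eqVlt; apply/orP; left; apply/eqP.
  apply: eq_bigr => a _; apply: eq_bigr => k _.
  rewrite -mulrA; congr (_ * _).
  rewrite mulnC exprM -exprMn; congr (_ ^+ 2).
  rewrite -[u in LHS]cu -cmodX -cmodM mulr_sumr; congr cmod.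
  rewrite [RHS]sum_pair.
  apply: eq_bigr => b _; rewrite mulr_sumr; apply: eq_bigr => l _.
  rewrite /S /letter_coef /=; have [ab|ab] := eqVneq a (opp_idx b).
    by rewrite ab opp_idxK eqxx !mul0r mulr0.
  rewrite (negbTE (opp_idx_neq ab)) gen_coef_log /d /= sgN.
  have -> : log_coef (rtoc u * sg a) (rtoc u * sg b) (w (opp_idx a) - w b) k.+1 l.+1
    = rtoc u ^+ k.+1 * rtoc u ^+ l.+1 *
      log_coef (sg a) (sg b) (w (opp_idx a) - w b) k.+1 l.+1.
    rewrite /log_coef -mulrN -!(mulrA (rtoc u)).
    by rewrite ![(rtoc u * (_ / _)) ^+ _]exprMn; ring.
  by rewrite rtoc_nat; field; exact: uC.
apply: ler_sum => b _; apply: ler_sum => l _; rewrite /d /=.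
rewrite cmodM cmodV cmodX cu exprMn -mulrA ler_wpM2l //.
by rewrite exprVn -exprM mulnC.
Qed.

Lemma operator_bound (J : finType) (z v : J -> I -> nat -> C) (B : R) :
  (forall K, \sum_j \sum_b weak_norm K (z j b) <= B) ->
  (forall j a k, (fun K => \sum_b \sum_(l < K)
     letter_coef a b k.+1 l.+1 * z j b l) @ \oo --> v j a k) ->
  forall K, \sum_j \sum_a strong_norm K (v j a) <= B.
Proof.
move=> zB zv K.
have cv : (fun K' => \sum_j \sum_a strong_norm K (fun k =>
    \sum_b \sum_(l < K') letter_coef a b k.+1 l.+1 * z j b l)) @ \oo -->
    \sum_j \sum_a strong_norm K (v j a).
  apply: cvg_sum_seq => j _; apply: cvg_sum_seq => a _.
  apply: cvg_sum_seq => k _; apply: cvgMr.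
  by rewrite expr2; apply: cvgM; apply: cvg_cmod_fun; exact: zv.
rewrite -(cvg_lim _ cv) //; apply: limr_le; first exact: cvgP cv.
near=> K'; apply: le_trans (zB K'); apply: ler_sum => j _.
apply: le_trans (operator_bound_fin K' (z j)).
apply: ler_sum => a _; apply: strong_norm_le.
by near: K'; exact: nbhs_infty_ge.
Unshelve. all: by end_near. Qed.

Lemma cvg_one_block a b k (z : nat -> C) (z' : I -> nat -> C) :
  (forall b' l, z' b' l = if b' == b then z l else 0) ->
  cvgn (series (fun m => letter_coef a b k.+1 m.+1 * z m)) ->
  (fun K => \sum_b' \sum_(l < K) letter_coef a b' k.+1 l.+1 * z' b' l)
    @ \oo --> csum (fun m => letter_coef a b k.+1 m.+1 * z m).
Proof.
move=> zE cz; rewrite (_ : (fun K => _) =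
    series (fun m => letter_coef a b k.+1 m.+1 * z m)); first exact: cvg_csum.
apply/funext => K; rewrite (bigD1 b) //= [X in _ + X]big1 => [|b' /negbTE bb].
  by rewrite addr0 /series /= big_mkord; apply: eq_bigr => l _; rewrite zE eqxx.
by rewrite big1 // => l _; rewrite zE bb mulr0.
Qed.

Lemma weak_norm0 K : weak_norm K (fun _ => 0) = 0.
Proof. by rewrite /weak_norm big1 // => k _; rewrite cmod0 expr0n mulr0. Qed.

Lemma weak_norm_block K (b : I) (z : nat -> C) :
  \sum_b' weak_norm K (fun l => if b' == b then z l else 0) = weak_norm K z.
Proof.
rewrite (bigD1 b) //= eqxx big1 ?addr0 // => b' /negbTE ->.
exact: weak_norm0.
Qed.

Definition unit_norm (l : nat) : R := l.+1%:R * u ^- (2 * l.+1).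

Lemma unit_norm_ge0 l : 0 <= unit_norm l.
Proof. by rewrite mulr_ge0 ?ler0n // invr_ge0 exprn_ge0 // ltW. Qed.

Lemma weak_norm_unit K l : weak_norm K (fun m => (m == l)%:R) <= unit_norm l.
Proof.
rewrite /weak_norm; have [lK|Kl] := ltnP l K.
  rewrite (bigD1 (Ordinal lK)) //= eqxx cmod1 expr1n mulr1 big1 ?addr0 // => m.
  by rewrite -val_eqE /= => /negbTE ->; rewrite cmod0 expr0n mulr0.
rewrite big1 ?unit_norm_ge0 // => m _.
rewrite (_ : (m == l :> nat) = false) ?cmod0 ?expr0n ?mulr0 //.
by apply/eqP => ml; move: (ltn_ord m); rewrite ml ltnNge Kl.
Qed.

Lemma csum_unit (f : nat -> C) l :
  series (fun m => f m * (m == l)%:R) @ \oo --> f l.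
Proof.
apply: cvg_near_cst; near=> K.
have lK : (l < K)%N by near: K; exact: nbhs_infty_gt.
rewrite /series /= big_mkord (bigD1 (Ordinal lK)) //= eqxx mulr1 big1 ?addr0 // => m.
by rewrite -val_eqE /= => /negbTE ->; rewrite mulr0.
Unshelve. all: by end_near. Qed.

(** A path is prolonged at its front. Its coefficients form a vector supported on one block, whose
    images in all blocks are bounded together by one application of the contraction; passing from
    the strong norm back to the weak one gains u^-4. No counting of words enters beyond the choice
    of the last letter. *)
Lemma path_norm n l K :
  \sum_a \sum_(s : n.+1.-tuple I) strong_norm K (fun k => path_coef a s k.+1 l.+1)
  <= #|{: I}|%:R * unit_norm l * (u ^- 4) ^+ n.
Proof.
elim: n K => [|n IH] K.
  rewrite expr0 mulr1.
  have -> : \sum_a \sum_(s : 1.-tuple I)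
      strong_norm K (fun k => path_coef a s k.+1 l.+1) =
     \sum_b \sum_a strong_norm K (fun k => letter_coef a b k.+1 l.+1).
    rewrite [RHS]exchange_big /=; apply: eq_bigr => a _.
    rewrite sum_cons_tuple; apply: eq_bigr => b _.
    rewrite (bigD1 [tuple]) //= big1 ?addr0 // => s /eqP[].
    exact: tuple0.
  apply: (operator_bound (z := fun b b' l' => if b' == b then (l' == l)%:R else 0)).
    move=> K'; rewrite mulr_natl -sumr_const; apply: ler_sum => b _.
    by rewrite weak_norm_block; exact: weak_norm_unit.
  move=> b a k.
  have cl := @csum_unit (fun m => letter_coef a b k.+1 m.+1) l.
  rewrite -(csum_unique cl).
  exact (cvg_one_block (z := fun m => (m == l)%:R) (fun _ _ => erefl) (cvgP _ cl)).
have -> : \sum_a \sum_(s : n.+2.-tuple I)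
    strong_norm K (fun k => path_coef a s k.+1 l.+1) =
  \sum_(p : I * n.+1.-tuple I) \sum_a strong_norm K (fun k =>
     csum (fun m => letter_coef a p.1 k.+1 m.+1 * path_coef p.1 p.2 m.+1 l.+1)).
  rewrite (@sum_pair _ _ (n.+1.-tuple I)).
  under [LHS]eq_bigr do rewrite sum_cons_tuple.
  rewrite exchange_big /=; apply: eq_bigr => b _.
  rewrite exchange_big /=; apply: eq_bigr => s _; apply: eq_bigr => a _.
  congr strong_norm; apply/funext => k; apply: path_coef_cons_pos.
  by rewrite -size_eq0 size_tuple.
apply: (operator_bound (z := fun (p : I * n.+1.-tuple I) b' l' =>
   if b' == p.1 then path_coef p.1 p.2 l'.+1 l.+1 else 0)).
  move=> K'; apply: le_trans (_ : \sum_(p : I * n.+1.-tuple I)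
    u ^- 4 * strong_norm K' (fun k => path_coef p.1 p.2 k.+1 l.+1) <= _).
    apply: ler_sum => p _; rewrite weak_norm_block; exact: weak_le_strong.
  rewrite -mulr_sumr (@sum_pair _ _ (n.+1.-tuple I)) [_ ^+ n.+1]exprSr [leRHS]mulrA [leRHS]mulrC.
  by rewrite ler_wpM2l ?invr_ge0 ?exprn_ge0 // ltW.
move=> p a k.
exact (cvg_one_block (z := fun m => path_coef p.1 p.2 m.+1 l.+1)
  (fun _ _ => erefl) (is_cvg_csumS (@letter_path_cvg a p.1 p.1 p.2 k.+1 l.+1))).
Qed.

(** The same induction with the sum over the paths inside the norm: the whole column of the power is
    one vector. *)
Lemma power_norm n b l K :
  \sum_a strong_norm K (fun k => power_coef n a b k.+1 l.+1) <=
  unit_norm l * (u ^- 4) ^+ n.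
Proof.
elim: n K => [|n IH] K.
  rewrite expr0 mulr1.
  have h := @operator_bound unit (fun _ b' l' => if b' == b then (l' == l)%:R else 0)
    (fun _ a k => power_coef 0 a b k.+1 l.+1) (unit_norm l) _ _ K.
  have sum_unit (F : unit -> R) : \sum_j F j = F tt.
    by rewrite (bigD1 tt) //= big1 ?addr0 // => -[].
  move: h; rewrite sum_unit; apply.
    by move=> K'; rewrite sum_unit weak_norm_block; exact: weak_norm_unit.
  move=> _ a k; rewrite power_coef0.
  have cl := @csum_unit (fun m => letter_coef a b k.+1 m.+1) l.
  rewrite -(csum_unique cl).
  exact (cvg_one_block (z := fun m => (m == l)%:R) (fun _ _ => erefl) (cvgP _ cl)).
have sum_unit (F : unit -> R) : \sum_j F j = F tt.
  by rewrite (bigD1 tt) //= big1 ?addr0 // => -[].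
have h := @operator_bound unit (fun _ b' l' => power_coef n b' b l'.+1 l.+1)
  (fun _ a k => power_coef n.+1 a b k.+1 l.+1) (unit_norm l * (u ^- 4) ^+ n.+1) _ _ K.
move: h; rewrite sum_unit; apply.
  move=> K'; rewrite sum_unit; apply: le_trans (_ : \sum_a
    u ^- 4 * strong_norm K' (fun k => power_coef n a b k.+1 l.+1) <= _).
    by apply: ler_sum => a _; exact: weak_le_strong.
  rewrite -mulr_sumr [_ ^+ n.+1]exprSr [leRHS]mulrA [leRHS]mulrC.
  by rewrite ler_wpM2l ?invr_ge0 ?exprn_ge0 // ltW.
move=> _ a k; rewrite power_coefS; apply: cvg_sum_seq => c _.
rewrite (_ : (fun K => _) = series (fun m =>
   letter_coef a c k.+1 m.+1 * power_coef n c b m.+1 l.+1)).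
  apply: cvg_csum; exact: power_path_cvg.
by apply/funext => K'; rewrite /series /= big_mkord.
Qed.

Let u4E m : (u ^- 4) ^+ m = u ^- (2 * m) * u ^- (2 * m).
Proof. by rewrite exprVn -exprM -invfM -exprD; congr (u ^- _); clear; lia. Qed.

Lemma strong_norm_entry (z : nat -> C) l B :
  strong_norm l.+1 z <= unit_norm l * B -> cmod (z l) ^+ 2 <= (u ^- 4) ^+ l.+1 * B.
Proof.
rewrite /strong_norm /unit_norm big_ord_recr /= => h.
have : l.+1%:R * u ^+ (2 * l.+1) * cmod (z l) ^+ 2 <=
    l.+1%:R * u ^- (2 * l.+1) * B.
  apply: le_trans h; rewrite lerDr sumr_ge0 // => k _.
  by rewrite !mulr_ge0 ?ler0n ?exprn_ge0 ?cmod_ge0 // ltW.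
rewrite -!mulrA ler_pM2l ?ltr0n // mulrC -ler_pdivlMr ?exprn_gt0 //.
move=> {}h; apply: le_trans h _; rewrite le_eqVlt; apply/orP; left; apply/eqP.
by rewrite u4E mulrAC.
Qed.

(** The square root of the gain u^-4 per letter, since the norms are quadratic. *)
Definition rate : R := u ^- 2.

Lemma rate_gt0 : 0 < rate. Proof. by rewrite invr_gt0 exprn_gt0. Qed.

Lemma rate_lt1 : rate < 1.
Proof. by rewrite invf_lt1 ?exprn_gt0 // exprn_egt1. Qed.

Lemma rate2 n : (u ^- 4) ^+ n = (rate ^+ n) ^+ 2.
Proof. by rewrite u4E [RHS]expr2 /rate exprVn -exprM. Qed.

Lemma power_entry_le n a l :
  cmod (power_coef n a a l.+1 l.+1) <= rate ^+ n * rate ^+ l.+1.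
Proof.
rewrite -(@ler_pXn2r _ 2) ?nnegrE ?cmod_ge0 ?mulr_ge0 ?exprn_ge0 ?(ltW rate_gt0) //.
rewrite exprMn mulrC -!rate2.
apply: (strong_norm_entry (z := fun k => power_coef n a a k.+1 l.+1)).
apply: le_trans (power_norm n a l l.+1); rewrite (bigD1 a) //= lerDl sumr_ge0 //.
move=> b _; apply: sumr_ge0 => k _.
by rewrite !mulr_ge0 ?ler0n ?exprn_ge0 ?cmod_ge0 // ltW.
Qed.

Lemma path_entry_sum_le n l : \sum_a \sum_(s : n.+1.-tuple I)
    cmod (path_coef a s l.+1 l.+1) ^+ 2 <=
  #|{: I}|%:R * (rate ^+ n * rate ^+ l.+1) ^+ 2.
Proof.
have h := path_norm n l l.+1.
have ul : 0 < l.+1%:R * u ^+ (2 * l.+1) by rewrite mulr_gt0 ?ltr0n ?exprn_gt0.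
have : l.+1%:R * u ^+ (2 * l.+1) * \sum_a \sum_(s : n.+1.-tuple I)
    cmod (path_coef a s l.+1 l.+1) ^+ 2 <=
    #|{: I}|%:R * unit_norm l * (u ^- 4) ^+ n.
  apply: le_trans h; rewrite mulr_sumr; apply: ler_sum => a _.
  rewrite mulr_sumr; apply: ler_sum => s _; rewrite /strong_norm big_ord_recr /=.
  rewrite lerDr sumr_ge0 // => k _.
  by rewrite !mulr_ge0 ?ler0n ?exprn_ge0 ?cmod_ge0 // ltW.
rewrite mulrC -ler_pdivlMr // => {}h; apply: le_trans h _.
rewrite le_eqVlt; apply/orP; left; apply/eqP.
have hl : l.+1%:R != 0 :> R by rewrite pnatr_eq0.
have hu : u ^+ (2 * l.+1) != 0 by rewrite expf_neq0 // gt_eqF.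
rewrite /unit_norm [(rate ^+ n * _) ^+ 2]exprMn -!rate2 (u4E l.+1); set x := (_ ^- 4) ^+ n.
by field; rewrite hu /= nat1r hl.
Qed.

Definition path_trace a s : C := csum (fun k => path_coef a s k.+1 k.+1).

Lemma path_trace_cvg a s : cvgn (series (fun k => path_coef a s k.+1 k.+1)).
Proof.
apply: (cvgn_series_geo (ltW t0) t1 (K := 1)) => k; rewrite mul1r.
apply: le_trans (coef_bound_le t0 k.+1 k.+1 (path_bound a s)) _.
rewrite (_ : (k.+1 + k.+1 = k + k.+2)%N); last by clear; lia.
by rewrite exprD ler_piMr ?exprn_ge0 ?exprn_ile1 ?(ltW t0) ?(ltW t1).
Qed.

End SchottkyOperator.

(** The weighted Cauchy-Schwarz inequality, from the weighted variance of x_l / wt_l being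
    nonnegative. *)
Lemma sum_sqr_weighted (R : realType) (L : nat) (wt x : nat -> R) :
  (forall l, 0 < wt l) ->
  (\sum_(l < L) x l) ^+ 2 <= (\sum_(l < L) wt l) * \sum_(l < L) x l ^+ 2 / wt l.
Proof.
move=> wt0; case: L => [|L]; first by rewrite !big_ord0 expr0n mul0r.
set B := \sum_(l < _) x l; set A := \sum_(l < _) wt l; set D := \sum_(l < _) _.
have A0 : 0 < A.
  rewrite /A big_ord_recl ltr_wpDr //; apply: sumr_ge0 => l _; exact: ltW.
have : 0 <= \sum_(l < L.+1) wt l * (x l / wt l - B / A) ^+ 2.
  by apply: sumr_ge0 => l _; rewrite mulr_ge0 ?sqr_ge0 // ltW.
have -> : \sum_(l < L.+1) wt l * (x l / wt l - B / A) ^+ 2 =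
    D - 2 * (B / A) * B + (B / A) ^+ 2 * A.
  set c := B / A; rewrite /D /B /A !mulr_sumr -sumrB -big_split /=.
  by apply: eq_bigr => l _; field; rewrite gt_eqF.
have -> : D - 2 * (B / A) * B + (B / A) ^+ 2 * A = D - B ^+ 2 / A.
  by field; rewrite gt_eqF.
by rewrite subr_ge0 ler_pdivrMr // mulrC.
Qed.

(** * Convergence and expansion of the traces over closed paths *)

Section SchottkyTrace.
Variables (R : realType) (g : nat).
Local Notation C := (Cplx R).
Local Notation I := (idx g).
Variables (w sg : I -> C) (t : R).
Hypotheses (t0 : 0 < t) (t1 : t < 1).
Hypothesis sg0 : forall a, sg a != 0.
Hypothesis sgN : forall a, sg (opp_idx a) = sg a.
Hypothesis sep : forall a b, a != b ->
  cmod (sg a) + cmod (sg b) <= t * cmod (w a - w b).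

Local Notation letter_coef := (letter_coef w sg).
Local Notation path_coef := (path_coef w sg).
Local Notation power_coef := (power_coef w sg).
Local Notation path_trace := (path_trace w sg).
Local Notation rate := (rate t).

Let r0 : 0 < rate. Proof. exact: rate_gt0. Qed.
Let r1 : rate < 1. Proof. exact: rate_lt1. Qed.

(** Cauchy-Schwarz with the weights rate^(l + 1): the diagonal entries decay in the mean square like
    rate^(l + 1), and after the division by the weight one power is left to sum over l. *)
Lemma path_trace_sqr_le n : \sum_a \sum_(s : n.+1.-tuple I)
    cmod (path_trace a s) ^+ 2 <=
  #|{: I}|%:R * (1 - rate)^-1 ^+ 2 * (rate ^+ n) ^+ 2.
Proof.
have cv : (fun L => \sum_a \sum_(s : n.+1.-tuple I)
    cmod (series (fun k => path_coef a s k.+1 k.+1) L) ^+ 2) @ \oo -->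
    \sum_a \sum_(s : n.+1.-tuple I) cmod (path_trace a s) ^+ 2.
  apply: cvg_sum_seq => a _; apply: cvg_sum_seq => s _.
  have h : series (fun k => path_coef a s k.+1 k.+1) @ \oo --> path_trace a s.
    exact (cvg_csum (@path_trace_cvg R g w sg t t0 t1 sg0 sgN sep a s)).
  by rewrite expr2; apply: cvgM; apply: cvg_cmod_fun.
rewrite -(cvg_lim _ cv) //; apply: limr_le; first exact: cvgP cv.
near=> L.
have geoL : \sum_(l < L) rate ^+ l.+1 <= (1 - rate)^-1.
  apply: le_trans (sum_geo_le L (ltW r0) r1); rewrite big_mkord.
  by apply: ler_sum => l _; rewrite exprS ler_piMl ?exprn_ge0 // ltW.
have geo0 : 0 <= \sum_(l < L) rate ^+ l.+1.
  by apply: sumr_ge0 => l _; rewrite exprn_ge0 // ltW.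
have i0 : 0 <= (1 - rate)^-1 by rewrite invr_ge0 subr_ge0 ltW.
apply: le_trans (_ : \sum_a \sum_(s : n.+1.-tuple I) (1 - rate)^-1 *
   \sum_(l < L) cmod (path_coef a s l.+1 l.+1) ^+ 2 / rate ^+ l.+1 <= _).
  apply: ler_sum => a _; apply: ler_sum => s _.
  apply: le_trans (_ : (\sum_(l < L) cmod (path_coef a s l.+1 l.+1)) ^+ 2 <= _).
    rewrite lerXn2r ?nnegrE ?cmod_ge0 //.
      by apply: sumr_ge0 => l _; exact: cmod_ge0.
    by apply: le_trans (cmod_sum _ _ _) _; rewrite big_mkord.
  have wt0 l : 0 < rate ^+ l.+1 by rewrite exprn_gt0.
  apply: le_trans (@sum_sqr_weighted R L (fun l => rate ^+ l.+1)
    (fun l => cmod (path_coef a s l.+1 l.+1)) wt0) _.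
  rewrite ler_wpM2r // sumr_ge0 // => l _.
  by rewrite divr_ge0 ?sqr_ge0 // ltW.
under eq_bigr do rewrite -mulr_sumr exchange_big /=.
rewrite -mulr_sumr exchange_big /=.
apply: le_trans (_ : (1 - rate)^-1 * \sum_(l < L)
   (#|{: I}|%:R * (rate ^+ n * rate ^+ l.+1) ^+ 2) / rate ^+ l.+1 <= _).
  rewrite ler_wpM2l //; apply: ler_sum => l _.
  under eq_bigr do rewrite -mulr_suml.
  rewrite -mulr_suml ler_wpM2r ?invr_ge0 ?exprn_ge0 ?(ltW r0) //.
  exact: (@path_entry_sum_le R g w sg t t0 t1 sg0 sgN sep).
have -> : \sum_(l < L) (#|{: I}|%:R * (rate ^+ n * rate ^+ l.+1) ^+ 2) /
    rate ^+ l.+1 = #|{: I}|%:R * (rate ^+ n) ^+ 2 * \sum_(l < L) rate ^+ l.+1.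
  rewrite mulr_sumr; apply: eq_bigr => l _; field.
  by rewrite expf_neq0 // gt_eqF.
apply: le_trans (_ : (1 - rate)^-1 *
   (#|{: I}|%:R * (rate ^+ n) ^+ 2 * (1 - rate)^-1) <= _).
  by rewrite ler_wpM2l // ler_wpM2l // mulr_ge0 ?ler0n ?sqr_ge0.
by rewrite le_eqVlt; apply/orP; left; apply/eqP; ring.
Unshelve. all: by end_near. Qed.

Local Notation A := (Amx w sg).
Let sq n : C := sqrtC n%:R.

Let sq0 n : sq n.+1 != 0.
Proof. by rewrite sqrtC_eq0 pnatr_eq0. Qed.

Let sqM n m : sqrtC (n * m)%:R = sq n * sq m.
Proof. by rewrite natrM sqrtCM ?nnegrE ?ler0n. Qed.

Let sqK n : sq n * sq n = n%:R.
Proof. by rewrite -expr2 sqrtCK. Qed.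

Lemma Amx_entry a b k l :
  A a b k.+1 l.+1 = sq k.+1 / sq l.+1 * letter_coef a b k.+1 l.+1.
Proof.
rewrite /Amx /letter_coef; case: eqP => _; first by rewrite mulr0.
rewrite sqM /gen_coef !(addSn, addnS) /= [(l + k)%N]addnC.
set W := w _ - w _.
have kf : k`!%:R != 0 :> C by rewrite pnatr_eq0 -lt0n fact_gt0.
have lf : l`!%:R != 0 :> C by rewrite pnatr_eq0 -lt0n fact_gt0.
have k1 : k.+1%:R != 0 :> C by rewrite pnatr_eq0.
have bE : 'C((k + l).+1, k.+1)%:R = (k + l).+1`!%:R / (k.+1%:R * k`!%:R * l`!%:R) :> C.
  apply: (mulIf (mulf_neq0 (mulf_neq0 k1 kf) lf)); rewrite divfK; last first.
    by rewrite !mulf_neq0.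
  rewrite -!natrM -factS; congr _%:R.
  have := @bin_fact (k + l).+1 k.+1; rewrite subSS addKn => <-; last first.
    by rewrite ltnS leq_addr.
  by [].
rewrite bE [(- sg a) ^+ _]exprNn -(sqK k.+1).
have [-> | W0] := eqVneq W 0.
  by rewrite !expr0n /= invr0 !mulr0.
by field; rewrite kf lf !sq0 expf_neq0.
Qed.

Lemma exp_entry n a b k l : infmx_exp A n.+1 a b k.+1 l.+1 =
  sq k.+1 / sq l.+1 * power_coef n a b k.+1 l.+1.
Proof.
elim: n a b k l => [|n IH] a b k l.
  rewrite /infmx_exp /= /infmx_mul power_coef0.
  rewrite (bigD1 b) //= [X in _ + X]big1 ?addr0 => [|c /negbTE cb]; last first.
    rewrite -/(csum _) -[RHS](@csum0 R); congr csum; apply/funext => m.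
    by rewrite /infmx_id cb mulr0.
  rewrite -Amx_entry -/(csum _); apply: csum_unique.
  have := @csum_unit R (fun m => A a b k.+1 m.+1) l.
  rewrite (_ : (fun m => _) = fun m =>
    A a b k.+1 m.+1 * infmx_id R b b m.+1 l.+1) //.
  by apply/funext => m; rewrite /infmx_id eqxx eqSS.
rewrite [infmx_exp _ _]/(infmx_mul A (infmx_exp A n.+1)) /infmx_mul.
rewrite (@power_coefS R g w sg t t0 t1 sg0 sgN sep) mulr_sumr; apply: eq_bigr => c _.
rewrite -/(csum _) -csumZ; last exact (@power_path_cvg R g w sg t t0 t1 sg0 sgN sep n a c b k.+1 l.+1).
congr csum; apply/funext => m; rewrite IH Amx_entry.
by field; rewrite !sq0.
Qed.

Lemma exp_product_cvg n a b c k l : (0 < k)%N -> (0 < l)%N ->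
  cvgn (series (fun m => `|A a c k m.+1 * infmx_exp A n c b m.+1 l|)).
Proof.
case: k => // k _; case: l => // l _.
have [K HK] : exists K : R, forall m,
    cmod (A a c k.+1 m.+1 * infmx_exp A n c b m.+1 l.+1) <= K * t ^+ m.
  case: n => [|n].
    exists (cmod (sq k.+1 / sq l.+1)) => m.
    rewrite /infmx_exp /= /infmx_id eqSS.
    have [->|ml] := eqVneq m l; last first.
      by rewrite andbF mulr0 cmod0 mulr_ge0 ?cmod_ge0 // exprn_ge0 // ltW.
    rewrite cmodM Amx_entry cmodM -mulrA ler_wpM2l ?cmod_ge0 //.
    apply: le_trans (_ : cmod (letter_coef a c k.+1 l.+1) * 1 <= _).
      rewrite ler_wpM2l ?cmod_ge0 // cmod_nat; by case: (_ && _).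
    rewrite mulr1; apply: le_trans (coef_bound_le t0 _ _ (@letter_bound R g w sg t t0 sg0 sgN sep a c)) _ => //.
    rewrite (_ : (k.+1 + l.+1 = l + k.+2)%N); last by clear; lia.
    by rewrite exprD ler_piMr ?exprn_ge0 ?exprn_ile1 ?(ltW t0) ?(ltW t1).
  exists (cmod (sq k.+1 / sq l.+1) * \sum_(s : n.+1.-tuple I) 1) => m.
  rewrite exp_entry Amx_entry.
  have -> : sq k.+1 / sq m.+1 * letter_coef a c k.+1 m.+1 *
     (sq m.+1 / sq l.+1 * power_coef n c b m.+1 l.+1) =
     sq k.+1 / sq l.+1 * (letter_coef a c k.+1 m.+1 * power_coef n c b m.+1 l.+1).
    by field; rewrite !sq0.
  rewrite cmodM -!mulrA ler_wpM2l ?cmod_ge0 // mulr_suml.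
  rewrite /power_coef mulr_sumr; apply: le_trans (cmod_sum _ _ _) _.
  rewrite big_mkcond; apply: ler_sum => s _; case: ifP => _; last first.
    by rewrite mul1r exprn_ge0 // ltW.
  apply: le_trans (coef_prod_geo t0 t1 _ _ _ (@letter_bound R g w sg t t0 sg0 sgN sep a c)
    (@path_bound R g w sg t t0 t1 sg0 sgN sep c s)) _.
  by rewrite !mul1r exprS ler_piMl ?exprn_ge0 ?(ltW t0) ?(ltW t1).
apply: (cvgn_series_geo (ltW t0) t1 (K := K)) => m.
by rewrite cmod_norm.
Qed.

Lemma exp_diag_le n a k :
  cmod (infmx_exp A n.+1 a a k.+1 k.+1) <= rate ^+ n * rate ^+ k.
Proof.
rewrite exp_entry divff ?sq0 // mul1r.
apply: le_trans (@power_entry_le R g w sg t t0 t1 sg0 sgN sep n a k) _.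
by rewrite ler_wpM2l ?exprn_ge0 ?(ltW r0) // exprS ler_piMl ?exprn_ge0 // ltW.
Qed.

Lemma exp_diag_cvg n a :
  cvgn (series (fun k => `|infmx_exp A n.+1 a a k.+1 k.+1|)).
Proof.
apply: (cvgn_series_geo (ltW r0) r1 (K := rate ^+ n)) => k.
by rewrite cmod_norm exp_diag_le.
Qed.

Lemma tr_exp_le n : cmod (infmx_tr (infmx_exp A n.+1)) <=
  #|{: I}|%:R / (1 - rate) * rate ^+ n.
Proof.
apply: le_trans (cmod_sum _ _ _) _.
apply: le_trans (_ : \sum_(a : I) rate ^+ n / (1 - rate) <= _).
  apply: ler_sum => a _.
  by apply: limn_series_geo_le (ltW r0) r1 _ => k; exact: exp_diag_le.
by rewrite sumr_const -mulr_natl; rewrite le_eqVlt; apply/orP; left; apply/eqP; ring.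
Qed.

Lemma det1B_series_cvg : cvgn (det1B_series A).
Proof.
apply: (cvgn_series_geo (ltW r0) r1 (K := #|{: I}|%:R / (1 - rate))) => n.
rewrite cmod_div cmod_nat; apply: le_trans (tr_exp_le n).
by rewrite ler_pdivrMr ?ltr0n // ler_peMr ?cmod_ge0 // ler1n.
Qed.

Lemma tr_expE n : infmx_tr (infmx_exp A n.+1) =
  \sum_(s : n.+1.-tuple I) path_trace (last (thead s) s) s.
Proof.
rewrite /infmx_tr.
transitivity (\sum_a \sum_(s : n.+1.-tuple I | last a s == a) path_trace a s).
  apply: eq_bigr => a _; rewrite -/(csum _).
  rewrite (_ : (fun k => _) = fun k => power_coef n a a k.+1 k.+1); last first.
    by apply/funext => k; rewrite exp_entry divff ?sq0 // mul1r.
  apply: csum_sum => s; exact (@path_trace_cvg R g w sg t t0 t1 sg0 sgN sep a s).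
under eq_bigr do rewrite big_mkcond.
rewrite exchange_big /=; apply: eq_bigr => s _.
have lE a : last a s = last (thead s) s.
  by case: s => [[|x s] Hs].
rewrite (bigD1 (last (thead s) s)) //= lE eqxx big1 ?addr0 // => a.
by rewrite lE eq_sym => /negbTE ->.
Qed.

End SchottkyTrace.

(** * Paths as words in the generators *)

Section PathMultiplier.
Variables (R : realType) (g : nat).
Local Notation C := (Cplx R).
Local Notation I := (idx g).
Variables (w sg rho : I -> C) (t : R).
Hypotheses (t0 : 0 < t) (t1 : t < 1).
Hypothesis sg0 : forall a, sg a != 0.
Hypothesis sgN : forall a, sg (opp_idx a) = sg a.
Hypothesis sep : forall a b, a != b ->
  cmod (sg a) + cmod (sg b) <= t * cmod (w a - w b).
Hypothesis sg2 : forall a, sg a ^+ 2 = rho a.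

Local Notation letter_coef := (letter_coef w sg).
Local Notation path_coef := (path_coef w sg).
Local Notation path_trace := (path_trace w sg).

Definition mx2 (a b c d : C) : 'M[C]_2 := \matrix_(i < 2, j < 2)
  if i == 0 then (if j == 0 then a else b) else (if j == 0 then c else d).

Lemma mx2E a b c d : [/\ mx2 a b c d 0 0 = a, mx2 a b c d 0 1 = b,
  mx2 a b c d 1 0 = c & mx2 a b c d 1 1 = d].
Proof. by split; rewrite !mxE. Qed.

Definition gamma_mx (a : I) : 'M[C]_2 :=
  mx2 (w (opp_idx a)) (rho a - w a * w (opp_idx a)) 1 (- w a).

Lemma det_gamma_mx a : \det (gamma_mx a) != 0.
Proof.
rewrite det2E /gamma_mx; case: (mx2E (w (opp_idx a))
  (rho a - w a * w (opp_idx a)) 1 (- w a)) => -> -> -> ->.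
have -> : w (opp_idx a) * - w a - (rho a - w a * w (opp_idx a)) * 1 = - (sg a ^+ 2).
  by rewrite sg2; ring.
by rewrite oppr_eq0 expf_neq0.
Qed.

Lemma gammaE a : gamma w rho a = mobius (gamma_mx a).
Proof.
apply/funext => z; rewrite mobiusE /gamma_mx; case: (mx2E (w (opp_idx a))
  (rho a - w a * w (opp_idx a)) 1 (- w a)) => -> -> -> ->.
case: z => [x|] /=; rewrite /pt ?oner_eq0 ?divr1 // mul1r subr_eq0.
case: eqP => // /eqP xw; congr Some.
by field; rewrite subr_eq0.
Qed.

(** The coordinate z -> w a + sg a z, which carries the unit disc onto the disc of a. *)
Definition chart_mx (a : I) : 'M[C]_2 := mx2 (sg a) (w a) 0 1.

Lemma det_chart_mx a : \det (chart_mx a) != 0.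
Proof.
by rewrite det2E; case: (mx2E (sg a) (w a) 0 1) => -> -> -> ->; rewrite mulr1 mulr0 subr0.
Qed.

Definition letter_mx (a b : I) : 'M[C]_2 := gen_mx (sg a) (sg b) (w (opp_idx a) - w b).

Fixpoint path_mx (a : I) (s : seq I) : 'M[C]_2 :=
  if s is b :: s' then path_mx b s' *m letter_mx a b else 1%:M.

(** The first letter acts first, as in [path_mx], whereas [word] lets its last letter act first;
    hence the reversals [rev s] below. *)
Fixpoint word_mx (s : seq I) : 'M[C]_2 :=
  if s is b :: s' then word_mx s' *m gamma_mx b else 1%:M.

Lemma gamma_chart a b : gamma_mx b *m chart_mx (opp_idx a) =
  chart_mx (opp_idx b) *m letter_mx a b.
Proof.
rewrite /letter_mx; have [g1 g2 g3 g4] := gen_mxE (sg a) (sg b) (w (opp_idx a) - w b).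
have [c1 c2 c3 c4] := mx2E (sg (opp_idx a)) (w (opp_idx a)) 0 1.
have [d1 d2 d3 d4] := mx2E (sg (opp_idx b)) (w (opp_idx b)) 0 1.
have [e1 e2 e3 e4] := mx2E (w (opp_idx b)) (rho b - w b * w (opp_idx b)) 1 (- w b).
apply: mx2_ext; rewrite !mul2E ?g1 ?g2 ?g3 ?g4 ?c1 ?c2 ?c3 ?c4 ?d1 ?d2 ?d3 ?d4
  ?e1 ?e2 ?e3 ?e4 ?sgN -?sg2; ring.
Qed.

Lemma word_chart a s : word_mx s *m chart_mx (opp_idx a) =
  chart_mx (opp_idx (last a s)) *m path_mx a s.
Proof.
elim: s a => [|b s IH] a /=; first by rewrite mul1mx mulmx1.
by rewrite -mulmxA gamma_chart !mulmxA IH.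
Qed.

Lemma det_word_mx s : \det (word_mx s) != 0.
Proof.
elim: s => [|b s IH] /=; first by rewrite det1 oner_eq0.
by rewrite det_mulmx mulf_neq0 // det_gamma_mx.
Qed.

Lemma word_cat s s' : word w rho (s ++ s') = word w rho s \o word w rho s'.
Proof. by elim: s => //= a s ->. Qed.

Lemma word_rev s : word w rho (rev s) = mobius (word_mx s).
Proof.
elim: s => [|b s IH] /=; first by rewrite mobius1.
rewrite mobius_mul ?det_gamma_mx // -IH -gammaE rev_cons -cats1 word_cat.
by [].
Qed.

Lemma word_mobius s : exists2 H : 'M[C]_2, \det H != 0 & word w rho s = mobius H.
Proof.
exists (word_mx (rev s)); first exact: det_word_mx.
by rewrite -word_rev revK.
Qed.

Definition nocancel (a b : I) : bool := b != opp_idx a.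

Lemma nocancelP a b : nocancel a b -> (a == opp_idx b) = false.
Proof. by move=> h; apply: contraNF h => /eqP ->; rewrite opp_idxK. Qed.

Lemma letter_expanding a b : nocancel a b -> expanding (letter_mx a b) /\
  mobius_coef (letter_mx a b) (letter_coef a b).
Proof.
move=> /nocancelP ab; have oab := opp_idx_neq (negbT ab).
have W0 := sep_neq0 t0 sg0 sep oab.
split; last by rewrite /letter_coef ab; exact: gen_mobius_coef.
apply: expanding_gen => //; rewrite -sgN; apply: le_lt_trans (sep oab) _.
by rewrite gtr_pMl // cmod_gt0.
Qed.

Lemma path_expanding a s : s != [::] -> path nocancel a s ->
  expanding (path_mx a s) /\ mobius_coef (path_mx a s) (path_coef a s).
Proof.
case: s => // b s _; elim: s a b => [|c s IH] a b.
  by rewrite /= andbT mul1mx; exact: letter_expanding.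
move=> /=/andP[ab bcs]; have [e1 e2] := letter_expanding ab.
have [e3 e4] := IH b c bcs.
split; first exact: expanding_mul e3 e1.
apply: (mobius_coef_comp t0 t1) e2 e4.
- exact: (@letter_bound R g w sg t t0 sg0 sgN sep).
- exact: (@path_bound R g w sg t t0 t1 sg0 sgN sep b (c :: s)).
Qed.

(** For a closed path the charts at both ends coincide, so the matrix of the word is the path matrix
    conjugated by a chart, and the trace formula for a single contraction applies. *)
Lemma path_multiplier a s : s != [::] -> path nocancel a s -> last a s = a ->
  exists2 q, is_multiplier (word w rho (rev s)) q & path_trace a s = q / (1 - q).
Proof.
move=> s0 ps la; have [e1 e2] := path_expanding s0 ps.
have uL : chart_mx (opp_idx a) \in unitmx by rewrite unitmxE unitfE det_chart_mx.
have := expanding_multiplier t0 t1 e1 (det_chart_mx (opp_idx a))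
  (@path_bound R g w sg t t0 t1 sg0 sgN sep a s) e2.
have -> : chart_mx (opp_idx a) *m path_mx a s *m invmx (chart_mx (opp_idx a)) =
    word_mx s.
  by rewrite -{1}la -word_chart -mulmxA mulmxV // mulmx1.
by rewrite -word_rev.
Qed.

Lemma path_trace0 a s : ~~ path nocancel a s -> path_trace a s = 0.
Proof.
move=> ps; rewrite /path_trace.
suff -> : path_coef a s = fun _ _ => 0 by exact: csum0.
case: s ps => // b s; elim: s a b => [|c s IH] a b.
  rewrite /= andbT negbK => /eqP ->.
  by rewrite /letter_coef opp_idxK eqxx.
rewrite path_coef_cons [path _ _ _]/= negb_and => /orP[h|h].
  rewrite /letter_coef; move: h; rewrite negbK => /eqP ->.
  rewrite opp_idxK eqxx; apply/funext => j; apply/funext => l.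
  rewrite /coef_comp -[RHS](@csum0 R); congr csum.
  by apply/funext => m; rewrite mul0r.
rewrite (IH b c h); apply/funext => j; apply/funext => l.
rewrite /coef_comp -[RHS](@csum0 R); congr csum.
by apply/funext => m; rewrite mulr0.
Qed.

End PathMultiplier.

(** * Words and conjugacy classes *)

Section WordPowers.
Local Open Scope nat_scope.
Variable T : eqType.
Implicit Types s u v x y z : seq T.

Definition wpow (m : nat) (u : seq T) : seq T := flatten (nseq m u).

Lemma wpowS m u : wpow m.+1 u = u ++ wpow m u. Proof. by []. Qed.

Lemma wpow1 u : wpow 1 u = u. Proof. by rewrite /wpow /= cats0. Qed.

Lemma wpowD m n u : wpow (m + n) u = wpow m u ++ wpow n u.
Proof. by elim: m => //= m IH; rewrite addSn !wpowS IH catA. Qed.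

Lemma wpowM m n u : wpow (m * n) u = wpow m (wpow n u).
Proof. by elim: m => //= m IH; rewrite mulSn wpowD wpowS IH. Qed.

Lemma size_wpow m u : size (wpow m u) = m * size u.
Proof. by elim: m => //= m IH; rewrite wpowS size_cat IH mulSn. Qed.

(** Unlike [rot k], which is the identity once k exceeds the length, the iterate is additive in k
    without restriction. *)
Definition rotn (k : nat) (x : seq T) : seq T := iter k (rot 1) x.

Lemma size_rotn k x : size (rotn k x) = size x.
Proof. by elim: k => //= k IH; rewrite size_rot. Qed.

Lemma rotnE k x : k <= size x -> rotn k x = rot k x.
Proof.
elim: k => [|k IH] kx; first by rewrite rot0.
by rewrite rotS // -IH ?(ltnW kx).
Qed.

Lemma rotn_size x : rotn (size x) x = x.
Proof. by rewrite rotnE // rot_size. Qed.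

Lemma rotnD k l x : rotn (k + l) x = rotn k (rotn l x).
Proof. by rewrite /rotn iterD. Qed.

Lemma rotn_mulr k c x : rotn k x = x -> rotn (c * k) x = x.
Proof. by move=> h; elim: c => //= c IH; rewrite mulSn rotnD IH. Qed.

Lemma rotn_inv k x : k <= size x -> rotn (size x - k) (rotn k x) = x.
Proof. by move=> kx; rewrite -rotnD subnK // rotn_size. Qed.

Lemma rotn_exists k x : exists2 k', k' <= size x & rotn k x = rotn k' x.
Proof.
case: (posnP (size x)) => [/eqP|x0].
  rewrite size_eq0 => /eqP ->; exists 0 => //.
  by elim: k => // k IH; rewrite /rotn iterS -/(rotn k _) IH.
exists (k %% size x); first by rewrite ltnW // ltn_mod.
rewrite {1}(divn_eq k (size x)) addnC rotnD rotn_mulr //; exact: rotn_size.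
Qed.

Lemma rotn_gcd a b x : 0 < a -> rotn a x = x -> rotn b x = x ->
  rotn (gcdn a b) x = x.
Proof.
move=> a0 ha hb; have [u v e _] := egcdnP b a0.
have := rotn_mulr u ha; rewrite e addnC rotnD.
by rewrite (rotn_mulr v hb).
Qed.

Lemma cat_comm_wpow m y z : size z = m * size y -> z ++ y = y ++ z ->
  z = wpow m y.
Proof.
elim: m z => [|m IH] z; first by move/eqP; rewrite size_eq0 => /eqP.
move=> sz e; have yz : size y <= size z by rewrite sz mulSn leq_addr.
have tz : take (size y) z = y.
  by have := congr1 (take (size y)) e; rewrite takel_cat // take_size_cat.
have ez : z = y ++ drop (size y) z by rewrite -{1}(cat_take_drop (size y) z) tz.
rewrite ez wpowS; congr (_ ++ _); apply: IH.
  by rewrite size_drop sz mulSn addKn.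
move: e; rewrite {1 2}ez -catA => /eqP; rewrite eqseq_cat // eqxx /=.
by move/eqP.
Qed.

(** Invariance means that the prefix of length k commutes with the rest, from which copies of it can
    be split off one by one. *)
Lemma rotn_period_wpow k x : rotn k x = x -> 0 < k -> k %| size x ->
  x = wpow (size x %/ k) (take k x).
Proof.
move=> h k0 kx; have [x0|x0] := posnP (size x).
  by rewrite x0 div0n; apply/eqP; rewrite -size_eq0 x0.
have kx' : k <= size x by exact: dvdn_leq.
rewrite rotnE // /rot in h.
have st : size (take k x) = k by rewrite size_takel.
have -> : size x %/ k = (size x %/ k).-1.+1.
  by rewrite prednK // divn_gt0.
rewrite wpowS -{1}(cat_take_drop k x); congr (_ ++ _).
apply: cat_comm_wpow; last by rewrite h cat_take_drop.
by rewrite size_drop st -subn1 mulnBl mul1n divnK.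
Qed.

Lemma rotn1_wpow m c p : rot 1 (wpow m (c :: p)) = wpow m (rcons p c).
Proof.
have aux k : p ++ wpow k (c :: p) ++ [:: c] = wpow k.+1 (rcons p c).
  elim: k => [|k IH]; first by rewrite [RHS]wpow1 -cats1.
  by rewrite wpowS [RHS]wpowS -IH -cats1 -!catA.
case: m => //= m; rewrite rot1_cons -cats1 -/(wpow m _) -catA.
exact: aux.
Qed.

Lemma rotn_wpow k m u : rotn k (wpow m u) = wpow m (rotn k u).
Proof.
elim: k => //= k ->; case: (rotn k u) => [|c p]; last by rewrite rotn1_wpow rot1_cons.
by rewrite /wpow; elim: m.
Qed.

Definition wprim (u : seq T) : Prop :=
  u != [::] /\ forall v m, 1 < m -> u <> wpow m v.

Lemma wprim_rotn k u : wprim u -> wprim (rotn k u).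
Proof.
move=> [u0 up]; have [k' k'u ->] := rotn_exists k u; split.
  by rewrite -size_eq0 size_rotn size_eq0.
move=> v m m1 e; apply: (up (rotn (size u - k') v) m m1).
by rewrite -rotn_wpow -e rotn_inv.
Qed.

Lemma wroot_exists s : s != [::] -> exists u m, [/\ 0 < m, wprim u & s = wpow m u].
Proof.
have [n] := ubnP (size s); elim: n s => // n IH s sn s0.
case: (boolp.pselect (exists v m, 1 < m /\ s = wpow m v)) => [[v [m [m1 e]]]|h].
  have v0 : v != [::].
    by apply: contraNneq s0 => v0; rewrite e v0 -size_eq0 size_wpow muln0.
  have vs : size v < size s.
    by rewrite e size_wpow ltn_Pmull // lt0n size_eq0.
  have [u [m' [m'0 up ev]]] := IH v (leq_trans vs sn) v0.
  exists u, (m * m'); split => //; first by rewrite muln_gt0 (ltnW m1).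
  by rewrite e ev -wpowM.
exists s, 1; split => //; last by rewrite wpow1.
by split => // v m m1 e; apply: h; exists v, m.
Qed.

Lemma wprim_size u : wprim u -> 0 < size u.
Proof. by case=> u0 _; rewrite lt0n size_eq0. Qed.

Lemma take_wpow a b u : a <= b -> take (a * size u) (wpow b u) = wpow a u.
Proof.
by move=> ab; rewrite -(subnKC ab) wpowD take_size_cat // size_wpow.
Qed.

(** By Bezout the gcd of j and the length of u is a period as well. It divides the length of u, so u
    is a power of its prefix of that length, and primitivity makes the gcd the full length. *)
Lemma wprim_period u m j : wprim u -> 0 < m ->
  rotn j (wpow m u) = wpow m u -> size u %| j.
Proof.
move=> up m0 hj; have d0 := wprim_size up.
have hd : rotn (size u) (wpow m u) = wpow m u by rewrite rotn_wpow rotn_size.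
have hg := rotn_gcd d0 hd hj; set g := gcdn (size u) j in hg.
have g0 : 0 < g by rewrite gcdn_gt0 d0.
have gd : g %| size u by exact: dvdn_gcdl.
have gx : g %| size (wpow m u) by rewrite size_wpow dvdn_mull.
have ex := rotn_period_wpow hg g0 gx.
set y := take g _ in ex.
have sy : size y = g by rewrite size_takel // dvdn_leq // size_wpow muln_gt0 m0.
have eu : u = wpow (size u %/ g) y.
  rewrite -(@take_wpow _ (size (wpow m u) %/ g)); last first.
    by rewrite leq_div2r // size_wpow leq_pmull.
  by rewrite -ex sy divnK // -[X in take X](mul1n (size u)) take_wpow // wpow1.
have : size u %/ g <= 1.
  by rewrite leqNgt; apply/negP => h1; case: up => _ /(_ y _ h1).
rewrite -(leq_pmul2r g0) divnK // mul1n => dg.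
have -> : size u = g by apply/eqP; rewrite eqn_leq dg dvdn_leq.
exact: dvdn_gcdr.
Qed.

(** The length of each word is a period of the common power, hence a multiple of the length of the
    other. *)
Lemma wprim_wpow_inj u v m n : wprim u -> wprim v -> 0 < m -> 0 < n ->
  wpow m u = wpow n v -> u = v.
Proof.
move=> up vp m0 n0 e.
have hu : size u %| size v.
  by apply: (wprim_period up m0); rewrite e rotn_wpow rotn_size.
have hv : size v %| size u.
  by apply: (wprim_period vp n0); rewrite -e rotn_wpow rotn_size.
have sE : size u = size v by apply/eqP; rewrite eqn_dvd hu hv.
rewrite -[u]wpow1 -(take_wpow u m0) e mul1n sE -[X in take X]mul1n.
by rewrite take_wpow // wpow1.
Qed.

(** A power of a primitive word thus has exactly as many rotations as the word has letters, which is
    the multiplicity d in the sum over words. *)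
Lemma wprim_rotn_inj u m i j : wprim u -> 0 < m -> i < size u -> j < size u ->
  rotn i (wpow m u) = rotn j (wpow m u) -> i = j.
Proof.
move=> up m0; wlog ij : i j / i <= j => [H|].
  move=> iu ju e; case/orP: (leq_total i j) => h; first exact: H.
  by apply/esym/H.
move=> iu ju e; have ux : size u <= size (wpow m u) by rewrite size_wpow leq_pmull.
have ix : i <= size (wpow m u) by exact: leq_trans (ltnW iu) ux.
have h : rotn (j - i) (wpow m u) = wpow m u.
  rewrite -{2}(rotn_inv ix) e -rotnD -[in RHS](subnK ij).
  by rewrite addnCA rotnD [in RHS]addnC subnKC // rotn_size.
have := wprim_period up m0 h => /dvdn_leq; case: (posnP (j - i)) => [ji _|ji /(_ isT)].
  by apply/eqP; rewrite eqn_leq ij -subn_eq0 ji.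
by rewrite leqNgt (leq_ltn_trans (leq_subr _ _) ju).
Qed.

End WordPowers.

(** * Freeness of the group and conjugacy of cyclically reduced words *)

Section SchottkyGroup.
Variables (R : realType) (g : nat).
Local Notation C := (Cplx R).
Local Notation I := (idx g).
Local Notation sphere := (sphere R).
Variables (w sg rho : I -> C) (t : R).
Hypotheses (t0 : 0 < t) (t1 : t < 1).
Hypothesis sg0 : forall a, sg a != 0.
Hypothesis sgN : forall a, sg (opp_idx a) = sg a.
Hypothesis sep : forall a b, a != b ->
  cmod (sg a) + cmod (sg b) <= t * cmod (w a - w b).
Hypothesis sg2 : forall a, sg a ^+ 2 = rho a.

Local Notation gam := (gamma w rho).
Local Notation wd := (word w rho).
Local Notation G := (schottky_group w rho).
Local Notation nc := (@nocancel g).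
Local Notation conj := (conjugate G).

Lemma nocancel_sym a b : nc a b = nc b a.
Proof.
rewrite /nocancel; congr negb; apply/eqP/eqP => ->; by rewrite opp_idxK.
Qed.

Lemma gamma_opp a : gam (opp_idx a) \o gam a = id.
Proof.
rewrite !gammaE -mobius_mul; last exact: (det_gamma_mx w sg0 sg2).
have rN : rho (opp_idx a) = rho a by rewrite -!sg2 sgN.
have -> : gamma_mx w rho (opp_idx a) *m gamma_mx w rho a = rho a *: 1%:M.
  rewrite /gamma_mx opp_idxK rN.
  have [e1 e2 e3 e4] := mx2E (w (opp_idx a)) (rho a - w a * w (opp_idx a)) 1 (- w a).
  have [d1 d2 d3 d4] := mx2E (w a) (rho a - w (opp_idx a) * w a) 1 (- w (opp_idx a)).
  have sE (i j : 'I_2) : (rho a *: (1%:M : 'M[C]_2)) i j = rho a * (i == j)%:R.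
    by rewrite !mxE.
  apply: mx2_ext; rewrite sE mul2E ?e1 ?e2 ?e3 ?e4 ?d1 ?d2 ?d3 ?d4 /=; ring.
by rewrite mobiusZ ?mobius1 // -sg2 expf_neq0.
Qed.

Lemma gamma_oppK a z : gam (opp_idx a) (gam a z) = z.
Proof. exact: (congr1 (fun f => f z) (gamma_opp a)). Qed.

Lemma gammaK_opp a z : gam a (gam (opp_idx a) z) = z.
Proof. by rewrite -{1}(opp_idxK a) gamma_oppK. Qed.

Definition winv (s : seq I) : seq I := rev (map (@opp_idx g) s).

Lemma winv_cons a s : winv (a :: s) = rcons (winv s) (opp_idx a).
Proof. by rewrite /winv /= rev_cons. Qed.

Lemma winv_rcons a s : winv (rcons s a) = opp_idx a :: winv s.
Proof. by rewrite /winv map_rcons rev_rcons. Qed.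

Lemma word_winvK s z : wd (winv s) (wd s z) = z.
Proof.
elim: s z => //= a s IH z.
by rewrite winv_cons -cats1 word_cat /= gamma_oppK IH.
Qed.

Lemma winvK : involutive winv.
Proof.
move=> s; rewrite /winv map_rev revK -map_comp -[RHS]map_id.
by apply: eq_map => a /=; exact: opp_idxK.
Qed.

Lemma word_Kwinv s z : wd s (wd (winv s) z) = z.
Proof. by rewrite -{1}(winvK s) word_winvK. Qed.

Lemma G_word s : G (wd s). Proof. by exists s. Qed.

Lemma conj_refl f : conj f f.
Proof. by exists id => //; exists [::]. Qed.

Lemma conj_word f f' r : wd r \o f = f' \o wd r -> conj f f'.
Proof. by move=> h; exists (wd r) => //; exact: G_word. Qed.

Lemma conj_sym f f' : conj f f' -> conj f' f.
Proof.
move=> [_ [r _ <-] e]; apply: (@conj_word _ _ (winv r)).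
apply/funext => z /=; have := congr1 (fun h => h (wd (winv r) z)) e.
by rewrite /= word_Kwinv => <-; rewrite word_winvK.
Qed.

Lemma conj_trans f f' f'' : conj f f' -> conj f' f'' -> conj f f''.
Proof.
move=> [_ [r _ <-] e] [_ [r' _ <-] e'].
apply: (@conj_word _ _ (r' ++ r)); rewrite word_cat.
by rewrite -compA e compA e' compA.
Qed.

Lemma conj_iter f f' m : conj f f' -> conj (iter m f) (iter m f').
Proof.
move=> [h Gh e]; exists h => //; elim: m => [|m IH]; apply/funext => z //=.
have := congr1 (fun k => k (iter m f z)) e; rewrite /= => ->.
by have := congr1 (fun k => k z) IH; rewrite /= => ->.
Qed.

Lemma conj_id f f' : conj f f' -> f = id -> f' = id.
Proof.
move=> [_ [r _ <-] e] fid; apply/funext => z.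
have := congr1 (fun h => h (wd (winv r) z)) e.
by rewrite /= fid !word_Kwinv.
Qed.

Lemma word_wpow m u : wd (wpow m u) = iter m (wd u).
Proof.
elim: m => // m IH; rewrite wpowS word_cat IH; apply/funext => z /=.
by [].
Qed.

Lemma conj_rotn k s : conj (wd s) (wd (rotn k s)).
Proof.
elim: k => [|k IH]; first exact: conj_refl.
apply: conj_trans IH _.
have -> : rotn k.+1 s = rot 1 (rotn k s) by [].
case: (rotn k s) => [|a u]; first exact: conj_refl.
rewrite rot1_cons -cats1; apply: (@conj_word _ _ (winv [:: a])).
rewrite word_cat; apply/funext => z /=.
by rewrite gamma_oppK gammaK_opp.
Qed.

(* Ping-pong with infinity as base point: gamma_a maps the exterior of the
   disc of a into the disc of -a. *)
Definition in_disc (a : I) (z : sphere) : Prop :=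
  if z is Some x then cmod (x - w a) <= cmod (sg a) else False.

Lemma disc_disjoint a b z : in_disc a z -> in_disc b z -> a = b.
Proof.
case: z => // x /= ha hb; apply/eqP/negPn/negP => ab.
have W := sep_neq0 t0 sg0 sep ab; rewrite -cmod_gt0 in W.
have h : cmod (w a - w b) <= cmod (sg a) + cmod (sg b).
  have -> : w a - w b = (w a - x) + (x - w b) by ring.
  by apply: le_trans (cmodD _ _) _; rewrite cmodB lerD.
have := le_trans h (sep ab); rewrite leNgt => /negP; apply.
by rewrite gtr_pMl.
Qed.

Lemma gamma_in_disc a z : ~ in_disc a z -> in_disc (opp_idx a) (gam a z).
Proof.
case: z => [x|] /=; last by rewrite subrr cmod0 cmod_ge0.
move=> h; have xa : cmod (sg a) < cmod (x - w a) by rewrite ltNge; apply/negP.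
have x0 : 0 < cmod (x - w a) by exact: le_lt_trans (cmod_ge0 _) xa.
case: eqP => [e|_] /=; first by move: x0; rewrite e subrr cmod0 ltxx.
rewrite addrAC subrr add0r cmod_div -sg2 cmodX sgN ler_pdivrMr //.
by rewrite expr2 ler_wpM2l ?cmod_ge0 // ltW.
Qed.

Lemma word_infty a s : path nc a s -> in_disc (opp_idx a) (wd (a :: s) None).
Proof.
elim: s a => [|b s IH] a; first by move=> _; apply: gamma_in_disc.
move=> /= /andP[ab bs]; apply: gamma_in_disc => h.
have := disc_disjoint h (IH b bs) => e.
by move: ab; rewrite /nocancel e opp_idxK eqxx.
Qed.

(** The image of infinity lies in the disc opposite to the first letter, the discs are disjoint and
    infinity is in none of them: the first letter can be read off, or its absence, and then
    cancelled. *)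
Lemma word_inj s s' : sorted nc s -> sorted nc s' -> wd s = wd s' -> s = s'.
Proof.
elim: s s' => [|a s IH] [|b s'] // ps ps' e.
- by have := word_infty ps'; rewrite -e.
- by have := word_infty ps; rewrite e.
have := word_infty ps; rewrite e => ha; have hb := word_infty ps'.
have ab : a = b by apply: (inv_inj (@opp_idxK g)); exact: disc_disjoint ha hb.
subst b; congr (_ :: _); apply: IH.
- exact: path_sorted ps.
- exact: path_sorted ps'.
apply/funext => z; have := congr1 (fun f => gam (opp_idx a) (f z)) e.
by rewrite /= !gamma_oppK.
Qed.

Lemma cycle_sorted s : cycle nc s -> sorted nc s.
Proof. by case: s => //= a s; rewrite rcons_path => /andP[]. Qed.

Lemma not_sorted_cat s : ~~ sorted nc s ->
  exists u a v, s = u ++ [:: a, opp_idx a & v].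
Proof.
elim: s => // a [|b s] IH //; rewrite [sorted _ _]/= negb_and => /orP[|h].
  by rewrite negbK => /eqP ->; exists [::], a, s.
have [u [c [v e]]] := IH h; exists (a :: u), c, v; by rewrite e.
Qed.

Lemma word_cancel u a v : wd (u ++ [:: a, opp_idx a & v]) = wd (u ++ v).
Proof. by rewrite !word_cat; apply/funext => z /=; rewrite gammaK_opp. Qed.

Lemma word_reduce s : exists2 s', sorted nc s' & wd s = wd s'.
Proof.
have [n] := ubnP (size s); elim: n s => // n IH s sn.
have [ss|/not_sorted_cat[u [a [v e]]]] := boolP (sorted nc s); first by exists s.
have [|s' ss' es'] := IH (u ++ v).
  by rewrite -ltnS; apply: leq_trans sn; rewrite e !size_cat /= !addnS ltnW.
by exists s' => //; rewrite -es' e word_cancel.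
Qed.

(** An inner cancelling pair is deleted; a cancelling pair formed by the two ends is removed by
    conjugation. Both shorten the word, and a single letter is never its own inverse. *)
Lemma word_cycred s : exists s', [/\ cycle nc s', (size s' <= size s)%N &
  conj (wd s) (wd s')].
Proof.
have [n] := ubnP (size s); elim: n s => // n IH s sn.
have [ss|/not_sorted_cat[u [a [v e]]]] := boolP (sorted nc s); last first.
  have uvs : (size (u ++ v) < size s)%N by rewrite e !size_cat /= !addnS ltnS leqW.
  have [|s' [cs' zs' es']] := IH (u ++ v); first by rewrite -ltnS; apply: leq_trans sn.
  exists s'; split => //; first exact: leq_trans zs' (ltnW uvs).
  by rewrite e word_cancel.
have [cs|] := boolP (cycle nc s); first by exists s; split => //; exact: conj_refl.
case: s sn ss => // a s sn ss; rewrite /= rcons_path; rewrite /= in ss.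
rewrite ss /= negbK => /eqP ea.
case/lastP: s sn ss ea => [_ _ /= ea|s b sn ss].
  by case: a ea => i [].
rewrite last_rcons => ea.
have [|s' [cs' zs' es']] := IH s.
  by rewrite -ltnS; apply: leq_trans sn; rewrite /= size_rcons ltnW.
exists s'; split => //.
  by apply: leq_trans zs' _; rewrite /= size_rcons !leqW.
apply: conj_trans es'; apply: (@conj_word _ _ [:: opp_idx a]).
rewrite ea opp_idxK -cats1; apply/funext => z.
by rewrite /= word_cat /= gammaK_opp.
Qed.

Lemma sorted_winv s : sorted nc s -> sorted nc (winv s).
Proof.
rewrite /winv rev_sorted sorted_map; apply: sub_sorted => a b /=.
by rewrite /nocancel opp_idxK eq_sym.
Qed.

(** Induction on the reduced conjugator r. If its last letter cancels the first letter of s, or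
    equals the last letter of s, it is absorbed by rotating s. Otherwise r s r^-1 is reduced as it
    stands, so it is s' by freeness; but it begins with a letter and ends with its inverse, so it is
    not cyclically reduced. *)
Lemma conj_cycred_rotn s s' : cycle nc s -> cycle nc s' ->
  conj (wd s) (wd s') -> exists k, s' = rotn k s.
Proof.
move=> cs cs' [_ [r0 _ <-]]; have [r sr ->] := word_reduce r0.
have [n] := ubnP (size r); elim: n r sr s cs => // n IH r sr s cs rn e.
case: s cs e => [|x u] cs e.
  have ws' : wd s' = id.
    apply/funext => z; have := congr1 (fun h => h (wd (winv r) z)) e.
    by rewrite /= !word_Kwinv.
  have := word_inj (cycle_sorted cs') (isT : sorted nc [::]) ws' => ->.
  by exists 0%N.
case/lastP: r sr rn e => [|r c] sr rn e.
  exists 0%N; apply/esym/word_inj; [exact: cycle_sorted|exact: cycle_sorted|].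
  exact: e.
have rn' : (size r < n)%N by rewrite -ltnS -(size_rcons r c).
have sr' : sorted nc r.
  by move: sr; case: (r) => //= a l; rewrite rcons_path => /andP[].
have [cx|cx] := eqVneq c (opp_idx x).
  have hc : cycle nc (rot 1 (x :: u)) by rewrite rot_cycle.
  have he : wd r \o wd (rot 1 (x :: u)) = wd s' \o wd r.
    rewrite rot1_cons -cats1; apply/funext => z.
    have := congr1 (fun h => h (gam x z)) e.
    by rewrite /= -cats1 !word_cat /= cx !gamma_oppK => <-.
  have [k ek] := IH r sr' _ hc rn' he.
  by exists (k + 1)%N; rewrite rotnD.
pose y := last x u; pose u' := belast x u.
have sE : x :: u = rcons u' y by exact: lastI.
have [cy|cy] := eqVneq c y.
  have sE' : x :: u = rotn 1 (y :: u') by rewrite sE /rotn /= rot1_cons.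
  have hc : cycle nc (y :: u').
    have : cycle nc (rot 1 (y :: u')) by move: cs; rewrite sE'.
    by rewrite rot_cycle.
  have he : wd r \o wd (y :: u') = wd s' \o wd r.
    apply/funext => z.
    have := congr1 (fun h => h (gam (opp_idx c) z)) e.
    rewrite sE -!cats1 /= !word_cat /= !cy !gammaK_opp => <-.
    by [].
  have [k ek] := IH r sr' _ hc rn' he.
  exists (k + size u')%N; rewrite ek rotnD; congr rotn.
  by rewrite sE' -{1}(@rotn_inv _ 1 (y :: u')) //= subn1.
exfalso; pose W := rcons r c ++ (x :: u) ++ winv (rcons r c).
have sc : path nc x u := cycle_sorted cs.
have sW : sorted nc W.
  have swc := sorted_winv sr; rewrite winv_rcons in swc.
  have h1 : path nc c ((x :: u) ++ winv (rcons r c)).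
    have cx' : nc c x.
      by rewrite /nocancel; apply: contraNneq cx => ->; rewrite opp_idxK.
    have yc : nc y (opp_idx c).
      rewrite /nocancel; apply: contraNneq cy => h.
      by apply/eqP; apply: (inv_inj (@opp_idxK g)).
    rewrite cat_path; apply/andP; split; first by rewrite /= cx' sc.
    by rewrite winv_rcons; apply/andP; split.
  rewrite /W; move: h1; case: (r) sr => [|a l] sr h1; first exact: h1.
  have -> : sorted nc (rcons (a :: l) c ++ (x :: u) ++ winv (rcons (a :: l) c)) =
    path nc a (rcons l c ++ (x :: u) ++ winv (rcons (a :: l) c)) by [].
  by rewrite cat_path last_rcons; apply/andP; split.
have eW : wd s' = wd W.
  apply/funext => z; rewrite /W !word_cat /=.
  have := congr1 (fun h => h (wd (winv (rcons r c)) z)) e.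
  by rewrite /= word_Kwinv => <-.
have ss' := word_inj (cycle_sorted cs') sW eW.
have [a [m em]] : exists a m, rcons r c = a :: m.
  by case: (r) => [|a l]; [exists c, [::] | exists a, (rcons l c)].
move: cs'; rewrite ss' /W em winv_cons -!rcons_cat cat_cons.
rewrite [cycle _ _]/= rcons_path last_rcons /nocancel opp_idxK eqxx.
by rewrite andbF.
Qed.

End SchottkyGroup.

(** * Primitive classes and the words belonging to them *)

Section Representatives.
Variables (R : realType) (g : nat).
Local Notation C := (Cplx R).
Local Notation I := (idx g).
Local Notation sphere := (sphere R).
Variables (w sg rho : I -> C) (t : R).
Hypotheses (t0 : 0 < t) (t1 : t < 1).
Hypothesis sg0 : forall a, sg a != 0.
Hypothesis sgN : forall a, sg (opp_idx a) = sg a.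
Hypothesis sep : forall a b, a != b ->
  cmod (sg a) + cmod (sg b) <= t * cmod (w a - w b).
Hypothesis sg2 : forall a, sg a ^+ 2 = rho a.

Local Notation wd := (word w rho).
Local Notation G := (schottky_group w rho).
Local Notation nc := (@nocancel g).
Local Notation cnj := (conjugate G).

Let csym f f' := @conj_sym R g w sg rho sg0 sgN sg2 f f'.
Let crot k s := @conj_rotn R g w sg rho sg0 sgN sg2 k s.
Let cycrot s s' := @conj_cycred_rotn R g w sg rho t t0 t1 sg0 sgN sep sg2 s s'.

Lemma cycle_wpow m u : cycle nc u -> cycle nc (wpow m u).
Proof.
case: u => [|x p] cu; first by rewrite /wpow; elim: m.
have pl k : path nc (last x p) (wpow k (x :: p)) /\
    (k != 0%N -> last (last x p) (wpow k (x :: p)) = last x p).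
  elim: k => // k [IH1 IH2]; rewrite wpowS cat_path last_cat; split.
    move: cu; rewrite [cycle _ _]/= rcons_path => /andP[h1 h2].
    by apply/andP; split; [rewrite /= h2 h1 | exact: IH1].
  by case: k IH2 {IH1} => [|k] IH2 _; [| exact: IH2].
case: m => // m; rewrite (cycle_path x); have [h1 h2] := pl m.+1.
by rewrite -[last x (wpow m.+1 (x :: p))]/(last (last x p) (wpow m.+1 (x :: p))) h2.
Qed.

Lemma primitive_conj f f' : primitive G f -> cnj f f' -> primitive G f'.
Proof.
move=> [[v _ <-] prim] cf; split.
  case: cf => _ [r _ <-] e; exists (r ++ v ++ winv r) => //.
  apply/funext => z; rewrite !word_cat /=.
  have := congr1 (fun h => h (wd (winv r) z)) e.
  by rewrite /= (word_Kwinv w sg0 sgN sg2).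
move=> _ m [v' _ <-] m1 e.
case: (csym cf) => _ [r _ <-] e'.
have Gh : G (wd (r ++ v' ++ winv r)) by exists (r ++ v' ++ winv r).
apply: (prim _ m Gh m1); apply/funext => z.
have it k : iter k (wd (r ++ v' ++ winv r)) z = wd r (iter k (wd v') (wd (winv r) z)).
  elim: k => [|k IH] /=; first by rewrite (word_Kwinv w sg0 sgN sg2).
  by rewrite IH !word_cat /= (word_winvK w sg0 sgN sg2).
rewrite it -e; have := congr1 (fun h => h (wd (winv r) z)) e'.
by rewrite /= (word_Kwinv w sg0 sgN sg2).
Qed.

(** A root of the element is conjugate to a cyclically reduced word u, and then s is a rotation of a
    power of u, hence itself a power. *)
Lemma wprim_primitive s : cycle nc s -> wprim s ->
  primitive G (wd s) /\ wd s <> id.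
Proof.
move=> cs [s0 sp]; split; last first.
  move=> e; have := word_inj t0 t1 sg0 sgN sep sg2 (cycle_sorted cs)
    (isT : sorted nc [::]) e.
  by move/eqP; rewrite (negbTE s0).
split; first by exists s.
move=> _ m [v _ <-] m1 e.
have [u [cu _ cvu]] := word_cycred w sg0 sgN sg2 v.
have : cnj (wd (wpow m u)) (wd s).
  by rewrite e word_wpow; apply: conj_iter; exact: csym.
move=> /(cycrot (cycle_wpow m cu) cs)[k ek].
by apply: (sp (rotn k u) m m1); rewrite -rotn_wpow.
Qed.

Lemma primitive_wprim s : primitive G (wd s) -> wd s <> id -> wprim s.
Proof.
move=> [_ prim] s1; split; first by apply/eqP => e; apply: s1; rewrite e.
move=> v m m1 e; apply: (prim (wd v) m (G_word _ _ _) m1).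
by rewrite e word_wpow.
Qed.

Variable P : set (sphere -> sphere).
Hypothesis hP : primitive_representatives G P.

Lemma rep_unique p p' : P p -> P p' -> cnj p p' -> p = p'.
Proof.
move=> Pp Pp' pp'; case: hP => h1 h2; have [pr pid] := h1 p Pp.
have [q [_ qu]] := h2 p pr pid.
by rewrite -(qu p (conj Pp (conj_refl _ _ _))) -(qu p' (conj Pp' pp')).
Qed.

Lemma rep_word p : P p -> exists u, [/\ cycle nc u, wprim u & cnj (wd u) p].
Proof.
move=> Pp; case: hP => h1 _; have [pr pid] := h1 p Pp.
have [[v _ ve] _] := pr; have [u [cu _ cvu]] := word_cycred w sg0 sgN sg2 v.
rewrite ve in cvu.
exists u; split => //; last exact: csym.
apply: primitive_wprim; first exact: primitive_conj pr cvu.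
move=> uid; apply: pid; apply: conj_id uid; [exact: sg0 | exact: sgN | exact: sg2 |].
exact: csym.
Qed.

(** Unique up to rotation, so [rep_len] depends on p alone; the default [::] does not occur for p in
    P. *)
Definition rep_wd (p : sphere -> sphere) : seq I :=
  xget [::] [set u | [/\ cycle nc u, wprim u & cnj (wd u) p]].

Definition rep_len p := size (rep_wd p).

Lemma rep_wdP p : P p ->
  [/\ cycle nc (rep_wd p), wprim (rep_wd p) & cnj (wd (rep_wd p)) p].
Proof.
by move=> /rep_word[u hu]; rewrite /rep_wd; case: xgetP => [v _ //|/(_ u)].
Qed.

Lemma rep_len_gt0 p : P p -> (0 < rep_len p)%N.
Proof. by case/rep_wdP => _ /wprim_size. Qed.

Lemma conj_rep s p : cycle nc s -> P p -> cnj (wd s) p ->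
  exists k, s = rotn k (rep_wd p).
Proof.
move=> cs Pp sp; have [cu up cup] := rep_wdP Pp.
by apply: cycrot => //; apply: conj_trans cup (csym sp).
Qed.

(** Cyclic reduction never lengthens a word and rotation keeps its length, so the representing word
    is a shortest one in its class. *)
Lemma length_leE N : length_le w rho P N = [set p | P p /\ (rep_len p <= N)%N].
Proof.
apply/seteqP; split => p [Pp].
  move=> [s sN sp]; split => //.
  have [s' [cs' ss' css']] := word_cycred w sg0 sgN sg2 s.
  have [k ek] := conj_rep cs' Pp (conj_trans (csym css') sp).
  by rewrite /rep_len -(size_rotn k) -ek (leq_trans ss').
move=> dN; split => //; exists (rep_wd p) => //.
by have [] := rep_wdP Pp.
Qed.

(** There are finitely many words of length at most N, and a word determines the representative of
    its class. *)
Lemma finite_length_le N : finite_set (length_le w rho P N).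
Proof.
rewrite length_leE.
pose F (s : {n : 'I_N.+1 & n.-tuple I}) : sphere -> sphere :=
  if pselect (exists p, P p /\ cnj (wd (tagged s)) p) is left h
  then projT1 (cid h) else id.
apply: (@sub_finite_set _ _ (F @` setT)); last first.
  by apply: finite_image; exact: finite_finset.
move=> p [Pp pN].
exists (existT _ (Ordinal (pN : (rep_len p < N.+1)%N)) (in_tuple (rep_wd p))) => //.
have [cu up cup] := rep_wdP Pp.
rewrite /F /=; case: pselect => [h|[]]; last by exists p.
case: (cid h) => q /= [Pq cq].
by apply: rep_unique => //; apply: conj_trans (csym cq) cup.
Qed.

Definition power_of (s : seq I) (p : sphere -> sphere) : Prop :=
  exists2 m, (0 < m)%N & cnj (wd s) (iter m p).

Lemma power_of_rotn s p : cycle nc s -> P p -> power_of s p ->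
  exists i m, [/\ (i < rep_len p)%N, (0 < m)%N & s = rotn i (wpow m (rep_wd p))].
Proof.
move=> cs Pp [m m0 cm]; have [cu up cup] := rep_wdP Pp.
have : cnj (wd (wpow m (rep_wd p))) (wd s).
  by rewrite word_wpow; apply: conj_trans (conj_iter m cup) (csym cm).
move=> /(cycrot (cycle_wpow m cu) cs)[k ->].
exists (k %% rep_len p)%N, m; split => //; first by rewrite ltn_mod rep_len_gt0.
rewrite {1}(divn_eq k (rep_len p)) addnC rotnD rotn_mulr //.
by rewrite rotn_wpow rotn_size.
Qed.

Lemma rotn_power_of p i m : P p -> (0 < m)%N ->
  cnj (wd (rotn i (wpow m (rep_wd p)))) (iter m p) /\
  cycle nc (rotn i (wpow m (rep_wd p))).
Proof.
move=> Pp m0; have [cu up cup] := rep_wdP Pp; split.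
  apply: conj_trans (csym (crot _ _)) _.
  by rewrite word_wpow; exact: conj_iter.
elim: i => [|i IH]; first exact: cycle_wpow.
by rewrite /rotn iterS rot_cycle.
Qed.

Lemma power_of_exists s : cycle nc s -> s != [::] -> exists2 p, P p & power_of s p.
Proof.
move=> cs s0; have [u [m [m0 up e]]] := wroot_exists s0.
have cu : cycle nc u.
  case: u up e => [|x p] up e; first by case: up.
  have [k km] : exists k, m = k.+1 by exists m.-1; rewrite prednK.
  move: cs; rewrite e km; case: k {km} => [|k]; first by rewrite wpow1.
  rewrite wpowS wpowS /= -cat_rcons rcons_cat cat_path => /andP[] //.
have [pr pid] := wprim_primitive cu up.
case: hP => _ h2; have [q [[Pq cq] _]] := h2 _ pr pid.
exists q => //; exists m => //; rewrite e word_wpow; exact: conj_iter.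
Qed.

Lemma power_of_unique s p p' : cycle nc s -> s != [::] -> P p -> P p' ->
  power_of s p -> power_of s p' -> p = p'.
Proof.
move=> cs s0 Pp Pp' sp sp'.
have [i [m [_ m0 e]]] := power_of_rotn cs Pp sp.
have [j [m' [_ m'0 e']]] := power_of_rotn cs Pp' sp'.
have [cu up cup] := rep_wdP Pp; have [cu' up' cup'] := rep_wdP Pp'.
rewrite e !rotn_wpow in e'.
have h := wprim_wpow_inj (wprim_rotn i up) (wprim_rotn j up') m0 m'0 e'.
apply: rep_unique => //.
apply: conj_trans (csym cup) _; apply: conj_trans (crot i _) _.
by rewrite h; apply: conj_trans (csym (crot j _)) cup'.
Qed.

Lemma power_of_size s p : cycle nc s -> P p -> power_of s p ->
  (rep_len p %| size s)%N.
Proof.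
move=> cs Pp /(power_of_rotn cs Pp)[i [m [_ _ ->]]].
by rewrite size_rotn size_wpow dvdn_mull.
Qed.

(** The words in question are the rotations of the power n / d of the representing word, d =
    [rep_len p], and these d rotations are distinct. *)
Lemma sum_power_of (V : nmodType) (Phi : (sphere -> sphere) -> V) n p :
  (forall f f', cnj f f' -> Phi f = Phi f') -> (0 < n)%N -> P p ->
  \sum_(s : n.-tuple I | cycle nc s && `[< power_of s p >]) Phi (wd s) =
  if (rep_len p %| n)%N then Phi (iter (n %/ rep_len p) p) *+ rep_len p else 0.
Proof.
move=> PhiC n0 Pp; have d0 := rep_len_gt0 Pp.
have [cu up cup] := rep_wdP Pp.
case: ifPn => dn; last first.
  rewrite big1 // => s /andP[cs /asboolP sp].
  by have := power_of_size cs Pp sp; rewrite size_tuple (negbTE dn).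
set m := (n %/ rep_len p)%N.
have m0 : (0 < m)%N by rewrite divn_gt0 // dvdn_leq.
have sz i : size (rotn i (wpow m (rep_wd p))) == n.
  by rewrite size_rotn size_wpow /m divnK.
pose h (i : 'I_(rep_len p)) : n.-tuple I := Tuple (sz i).
have hinj : injective h.
  move=> i j /(congr1 val) /= e; apply: val_inj.
  exact: (wprim_rotn_inj up m0 (ltn_ord i) (ltn_ord j) e).
rewrite (eq_bigl (mem (h @: [set: 'I_(rep_len p)])%SET)); last first.
  move=> s; apply/idP/idP.
    move=> /andP[cs /asboolP sp].
    have [i [m' [im' m'0 e]]] := power_of_rotn cs Pp sp.
    have mm : m' = m.
      rewrite /m -(size_tuple s) e size_rotn size_wpow mulnK //.
    apply/imsetP; exists (Ordinal im') => //; apply: val_inj => /=.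
    by rewrite e mm.
  case/imsetP => i _ ->.
  have [h1 h2] := rotn_power_of i Pp m0.
  by apply/andP; split => //; apply/asboolP; exists m.
rewrite (big_imset _ (in2W hinj)) /=.
rewrite (eq_bigr (fun _ => Phi (iter m p))); last first.
  by move=> i _; apply: PhiC; exact: (proj1 (rotn_power_of i Pp m0)).
by rewrite sumr_const cardsT card_ord.
Qed.

(** Every nonempty cyclically reduced word belongs to a power of exactly one representative, so a
    class function on words of length n can be summed class by class. *)
Lemma sum_cycle_words (V : nmodType) (Phi : (sphere -> sphere) -> V) n
    (r : seq (sphere -> sphere)) :
  (forall f f', cnj f f' -> Phi f = Phi f') -> (0 < n)%N -> uniq r ->
  (forall p, p \in r -> P p) ->
  (forall p, P p -> (rep_len p <= n)%N -> p \in r) ->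
  \sum_(s : n.-tuple I | cycle nc s) Phi (wd s) =
  \sum_(p <- r | (rep_len p %| n)%N)
     Phi (iter (n %/ rep_len p) p) *+ rep_len p.
Proof.
move=> PhiC n0 ur rP Pr.
transitivity (\sum_(s : n.-tuple I | cycle nc s)
   \sum_(p <- r | `[< power_of s p >]) Phi (wd s)).
  apply: eq_bigr => s cs.
  have s0 : tval s != [::] by rewrite -size_eq0 size_tuple -lt0n.
  have [p Pp sp] := power_of_exists cs s0.
  have pr : p \in r.
    apply: Pr => //; have := power_of_size cs Pp sp.
    by rewrite size_tuple => /dvdn_leq; apply.
  rewrite big_mkcond (bigD1_seq p) //= asboolT // big_seq_cond big1 ?addr0 //.
  move=> q /andP[qr /eqP qp]; case: asboolP => // sq; case: qp.
  exact: (power_of_unique cs s0 (rP q qr) Pp sq sp).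
rewrite (exchange_big_dep xpredT) //= [RHS]big_mkcond.
rewrite big_seq [RHS]big_seq; apply: eq_bigr => p pr.
exact: sum_power_of (rP p pr).
Qed.

End Representatives.

(** * Summation over primitive classes *)

Section Exhaustions.
Variables (R : realType) (T : choiceType).
Local Notation C := (Cplx R).
Implicit Types (P : set T) (X : nat -> seq T).

(** Lists instead of finite sets, so that sums are indexed by [X N] directly; their order is
    immaterial. *)
Definition exhausting P X :=
  [/\ forall N, uniq (X N), forall N x, x \in X N -> P x,
      forall N, {subset X N <= X N.+1} &
      forall x, P x -> exists N, x \in X N].

Lemma exhausting_mono P X m n :
  exhausting P X -> (m <= n)%N -> {subset X m <= X n}.
Proof.
move=> [_ _ XS _]; elim: n => [|n IH]; first by rewrite leqn0 => /eqP ->.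
by rewrite leq_eqVlt => /predU1P[->//|/IH h] x /h; exact: XS.
Qed.

Lemma exhausting_cover P X (r : seq T) : exhausting P X ->
  (forall x, x \in r -> P x) -> exists N, {subset r <= X N}.
Proof.
move=> eX; elim: r => [|x r IH] rP; first by exists 0%N.
have [|N hN] := IH; first by move=> y yr; apply: rP; rewrite inE yr orbT.
have [_ _ _ /(_ x (rP x (mem_head _ _)))[M hM]] := eX.
exists (maxn N M) => y; rewrite inE => /predU1P[->|yr].
  exact: exhausting_mono eX (leq_maxr _ _) _ hM.
exact: exhausting_mono eX (leq_maxl _ _) _ (hN _ yr).
Qed.

Lemma ler_sum_subset (h : T -> R) (r r' : seq T) : uniq r ->
  {subset r <= r'} -> (forall x, x \in r' -> 0 <= h x) ->
  \sum_(x <- r) h x <= \sum_(x <- r') h x.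
Proof.
elim: r r' => [|x r IH] r' /=.
  by move=> _ _ h0; rewrite big_nil big_seq sumr_ge0.
move=> /andP[xr ur] rr' h0; have xr' : x \in r' by apply: rr'; exact: mem_head.
rewrite big_cons (perm_big _ (perm_to_rem xr')) big_cons lerD2l.
apply: IH => // [y yr|y /mem_rem]; last exact: h0.
apply: rem_mem; first by apply: contraNneq xr => <-.
by apply: rr'; rewrite inE yr orbT.
Qed.

Lemma exhausting_sum_le P X (h : T -> R) (B : R) (r : seq T) :
  exhausting P X -> (forall x, P x -> 0 <= h x) ->
  (forall N, \sum_(x <- X N) h x <= B) ->
  uniq r -> (forall x, x \in r -> P x) -> \sum_(x <- r) h x <= B.
Proof.
move=> eX h0 hB ur rP; have [N hN] := exhausting_cover eX rP.
apply: le_trans (hB N); apply: ler_sum_subset => // x.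
by case: eX => _ XP _ _ /XP; exact: h0.
Qed.

Lemma exhausting_cvg_nneg P X (h : T -> R) (B : R) :
  exhausting P X -> (forall x, P x -> 0 <= h x) ->
  (forall N, \sum_(x <- X N) h x <= B) ->
  exists l : R, forall Y, exhausting P Y ->
    (fun N => \sum_(x <- Y N) h x) @ \oo --> l.
Proof.
move=> eX h0 hB.
have nd Y : exhausting P Y -> nondecreasing_seq (fun N => \sum_(x <- Y N) h x).
  move=> eY m n mn; apply: ler_sum_subset.
  - by case: eY.
  - exact: exhausting_mono eY mn.
  - by case: eY => _ YP _ _ x /YP; exact: h0.
have bd Y : exhausting P Y -> forall N, \sum_(x <- Y N) h x <= B.
  by move=> eY N; case: (eY) => uY YP _ _; apply: exhausting_sum_le eX _ _ _ _ => // x /YP.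
have cv Y : exhausting P Y -> cvgn (fun N => \sum_(x <- Y N) h x).
  move=> eY; apply: nondecreasing_is_cvgn; first exact: nd.
  by exists B => _ [N _ <-]; exact: bd.
have le Y Z : exhausting P Y -> exhausting P Z ->
    limn (fun N => \sum_(x <- Y N) h x) <= limn (fun N => \sum_(x <- Z N) h x).
  move=> eY eZ; apply: limr_le; first exact: cv.
  apply: nearW => N; case: (eY) => uY YP _ _.
  apply: (exhausting_sum_le eZ h0 _ (uY N) (YP N)) => M.
  exact: (nondecreasing_cvgn_le (nd Z eZ) (cv Z eZ)).
exists (limn (fun N => \sum_(x <- X N) h x)) => Y eY.
have -> : limn (fun N => \sum_(x <- X N) h x) = limn (fun N => \sum_(x <- Y N) h x).
  by apply/eqP; rewrite eq_le !le.
exact: cv.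
Qed.

(** A majorant bounded along one exhaustion gives the same limit along all of them. Real and
    imaginary parts p are treated as (h + p) - h, a difference of sums of nonnegative terms, where
    monotonicity makes the limit independent of the exhaustion. *)
Lemma exhausting_cvg P X (h : T -> R) (B : R) (f : T -> C) :
  exhausting P X -> (forall N, \sum_(x <- X N) h x <= B) ->
  (forall x, P x -> cmod (f x) <= h x) ->
  exists2 l : C, cmod l <= B & forall Y, exhausting P Y ->
    (fun N => \sum_(x <- Y N) f x) @ \oo --> l.
Proof.
move=> eX hB fh.
have h0 x : P x -> 0 <= h x by move=> /fh; apply: le_trans; exact: cmod_ge0.
have [l0 cv0] := exhausting_cvg_nneg eX h0 hB.
have part (p : T -> R) : (forall x, P x -> `|p x| <= h x) ->
    exists l : R, forall Y, exhausting P Y ->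
    (fun N => \sum_(x <- Y N) p x) @ \oo --> l.
  move=> ph.
  have [|N|l cvl] := @exhausting_cvg_nneg P X (fun x => h x + p x) (B + B) eX.
  - by move=> x /ph; rewrite ler_norml -subr_ge0 opprK addrC => /andP[].
  - apply: le_trans (_ : \sum_(x <- X N) (h x + h x) <= _).
      rewrite big_seq [leRHS]big_seq; apply: ler_sum => x xX; rewrite lerD2l.
      by apply: le_trans (ler_norm _) _; apply: ph; case: eX => _ XP _ _; exact: XP xX.
    by rewrite big_split lerD.
  exists (l - l0) => Y eY.
  have -> : (fun N => \sum_(x <- Y N) p x) =
      (fun N => \sum_(x <- Y N) (h x + p x) - \sum_(x <- Y N) h x).
    apply/funext => N; rewrite -sumrB; apply: eq_bigr => x _; ring.
  apply: cvgB; [exact: cvl | exact: cv0].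
have [lr cvr] := part (fun x => cre (f x)) (fun x Px => le_trans (cre_le _) (fh x Px)).
have [li cvi] := part (fun x => cim (f x)) (fun x Px => le_trans (cim_le _) (fh x Px)).
have cv Y : exhausting P Y ->
    (fun N => \sum_(x <- Y N) f x) @ \oo --> (Complex lr li : C).
  move=> eY; apply: cvg_reim.
    by under eq_fun do rewrite cre_sum; exact: cvr.
  by under eq_fun do rewrite cim_sum; exact: cvi.
exists (Complex lr li) => //; apply: cvg_cmod_le (cv X eX) _ => N.
apply: le_trans (cmod_sum _ _ _) _; apply: le_trans (hB N).
rewrite big_seq [leRHS]big_seq; apply: ler_sum => x xX.
by apply: fh; case: eX => _ XP _ _; exact: XP xX.
Qed.

End Exhaustions.

(** * The contribution of a single primitive class *)

Section CycleEnergy.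
Variable R : realType.
Local Notation C := (Cplx R).
Variable v : R.
Hypotheses (v0 : 0 <= v) (v1 : v < 1).
Let c := (1 - v)^-1.

Definition geo (z : C) : C := z / (1 - z).

Definition geo_ser (M : nat) (z : C) : C := \sum_(m < M) geo (z ^+ m.+1) / m.+1%:R.

(** The sum over m of z^m / (m (1 - z^m)): all powers of one primitive element of multiplier z
    together. *)
Definition geo_sum (z : C) : C := limn (geo_ser ^~ z).

Definition clog_sum (K : nat) (z : C) : C := \sum_(k < K) clog1 (z ^+ k.+1).

Lemma inv_1B_ge1 : 1 <= c.
Proof. by rewrite /c invf_ge1 ?subr_gt0 // gerBl. Qed.

Lemma inv_1B_ge0 : 0 <= c.
Proof. exact: le_trans ler01 inv_1B_ge1. Qed.

Lemma inv_1B_le (r : R) : r <= v -> (1 - r)^-1 <= c.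
Proof.
move=> rv; rewrite lef_pV2 ?posrE ?subr_gt0 //; first by rewrite lerD2l lerN2.
exact: le_lt_trans rv v1.
Qed.

Lemma cmod_inv_1B (z : C) : cmod z <= v -> cmod (1 - z)^-1 <= c.
Proof.
move=> zv; rewrite cmodV lef_pV2 ?posrE ?subr_gt0 //.
  apply: le_trans (_ : cmod 1 - cmod (- z) <= _); last exact: cmod_le1D.
  by rewrite cmod1 cmodN lerD2l lerN2.
rewrite cmod_gt0 subr_eq0; apply: contraTneq zv => <-.
by rewrite cmod1 -ltNge.
Qed.

Lemma cmod_geo (z : C) : cmod z <= v -> cmod (geo z) <= c * cmod z.
Proof.
by move=> zv; rewrite cmodM mulrC ler_wpM2r ?cmod_ge0 // cmod_inv_1B.
Qed.

Lemma cmodX_le (z : C) m : cmod z <= v -> cmod (z ^+ m.+1) <= v.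
Proof.
move=> zv; rewrite cmodX exprS -[leRHS]mulr1 ler_pM ?exprn_ge0 ?cmod_ge0 //.
by rewrite exprn_ile1 ?cmod_ge0 // (le_trans zv) // ltW.
Qed.

Lemma cmod_div_nat (z : C) n : cmod (z / n.+1%:R) <= cmod z.
Proof.
rewrite cmod_div cmod_nat ler_pdivrMr ?ltr0n // ler_peMr ?cmod_ge0 //.
by rewrite ler1n.
Qed.

Lemma geo_term_le (z : C) m : cmod z <= v ->
  cmod (geo (z ^+ m.+1) / m.+1%:R) <= c * cmod z * cmod z ^+ m.
Proof.
move=> zv; apply: le_trans (cmod_div_nat _ _) _.
by rewrite -mulrA -exprS -cmodX; apply: cmod_geo; exact: cmodX_le.
Qed.

Lemma geo_serE (z : C) :
  geo_ser ^~ z = series (fun m => geo (z ^+ m.+1) / m.+1%:R).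
Proof. by apply/funext => M; rewrite /geo_ser /series /= big_mkord. Qed.

Lemma cvg_geo_ser (z : C) : cmod z <= v -> geo_ser ^~ z @ \oo --> geo_sum z.
Proof.
move=> zv; rewrite /geo_sum geo_serE.
have z1 : cmod z < 1 by exact: le_lt_trans zv v1.
exact: (cvgn_series_geo (cmod_ge0 z) z1 (fun m => geo_term_le m zv)).
Qed.

Lemma geo_sum_tail (z : C) M : cmod z <= v ->
  cmod (geo_sum z - geo_ser M z) <= c ^+ 2 * cmod z ^+ M.+1.
Proof.
move=> zv; have z1 : cmod z < 1 by exact: le_lt_trans zv v1.
rewrite /geo_sum -[geo_ser M z]/((geo_ser ^~ z) M) geo_serE.
apply: le_trans (series_tail_geo_le M (cmod_ge0 z) z1 (fun m => geo_term_le m zv)) _.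
have -> : c * cmod z * cmod z ^+ M / (1 - cmod z) =
    c * (1 - cmod z)^-1 * cmod z ^+ M.+1 by rewrite exprS; ring.
rewrite expr2 ler_wpM2r ?exprn_ge0 ?cmod_ge0 //.
by rewrite ler_wpM2l ?inv_1B_ge0 // inv_1B_le.
Qed.

(** Removing the linear term leaves a quadratic remainder, which can be summed absolutely over the
    classes. *)
Lemma geo_sum_sub1 (z : C) : cmod z <= v ->
  cmod (geo_sum z - z) <= 2 * c ^+ 2 * cmod z ^+ 2.
Proof.
move=> zv; have -> : geo_sum z - z = (geo_sum z - geo_ser 1 z) + (geo z - z).
  by rewrite /geo_ser big_ord1 expr1 divr1; ring.
apply: le_trans (cmodD _ _) _; rewrite -mulrA mulrDl mul1r lerD //.
  exact: geo_sum_tail.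
have -> : geo z - z = (1 - z)^-1 * z ^+ 2.
  rewrite /geo; field; rewrite subr_eq0; apply: contraTneq zv => <-.
  by rewrite cmod1 -ltNge.
rewrite cmodM cmodX ler_wpM2r ?exprn_ge0 ?cmod_ge0 //.
apply: le_trans (cmod_inv_1B zv) _.
by rewrite expr2 ler_peMr ?inv_1B_ge0 // inv_1B_ge1.
Qed.

Lemma sum_pow_geo (y : C) K : y != 1 ->
  \sum_(k < K) y ^+ k.+1 = geo y - geo y * y ^+ K.
Proof.
move=> y1; have y1' : 1 - y != 0 by rewrite subr_eq0 eq_sym.
elim: K => [|K IH]; first by rewrite big_ord0 expr0 mulr1 subrr.
by rewrite big_ord_recr /= IH /geo !exprS; field.
Qed.

(** Both sides are expanded in m, where the difference is the tail z^(m (K + 1)) / (1 - z^m) of a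
    geometric series in k. The uniform power K + 1 permits the summation over all classes. *)
Lemma geo_sum_clog (z : C) K : cmod z <= v ->
  cmod (geo_sum z - clog_sum K z) <= c ^+ 2 * cmod z ^+ K.+1.
Proof.
move=> zv; have z1 : cmod z < 1 by exact: le_lt_trans zv v1.
have cz : (fun M => geo_ser M z - \sum_(k < K) plog M (z ^+ k.+1)) @ \oo -->
    geo_sum z - clog_sum K z.
  apply: cvgB; first exact: cvg_geo_ser.
  apply: cvg_sum_seq => k _; apply: cvg_plog.
  by apply: le_lt_trans v1; exact: cmodX_le.
apply: (cvg_cmod_le cz) => M.
have -> : geo_ser M z - \sum_(k < K) plog M (z ^+ k.+1) =
    series (fun m => geo (z ^+ m.+1) * (z ^+ m.+1) ^+ K / m.+1%:R) M.
  rewrite /geo_ser /plog exchange_big /= -sumrB /series /= big_mkord.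
  apply: eq_bigr => m _.
  rewrite -mulr_suml.
  have -> : \sum_(i < K) (z ^+ i.+1) ^+ m.+1 = \sum_(i < K) (z ^+ m.+1) ^+ i.+1.
    by apply: eq_bigr => i _; rewrite -!exprM mulnC.
  rewrite sum_pow_geo; first by rewrite mulrBl; ring.
  apply: contraTneq (cmodX_le m zv) => ->.
  by rewrite cmod1 -ltNge.
have bd m : cmod (geo (z ^+ m.+1) * (z ^+ m.+1) ^+ K / m.+1%:R) <=
    c * cmod z ^+ K.+1 * cmod z ^+ m.
  apply: le_trans (cmod_div_nat _ _) _.
  rewrite cmodM (cmodX _ K); apply: le_trans (_ : c * cmod (z ^+ m.+1) * cmod (z ^+ m.+1) ^+ K <= _).
    by rewrite ler_wpM2r ?exprn_ge0 ?cmod_ge0 // cmod_geo // cmodX_le.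
  rewrite -!mulrA ler_wpM2l ?inv_1B_ge0 // -exprS cmodX -exprM -exprD.
  apply: ler_wiXn2l; [exact: cmod_ge0 | exact: ltW |].
  by clear; nia.
apply: le_trans (series_geo_le (cmod_ge0 z) z1 bd M) _.
have -> : c * cmod z ^+ K.+1 / (1 - cmod z) =
    c * (1 - cmod z)^-1 * cmod z ^+ K.+1 by ring.
rewrite expr2 ler_wpM2r ?exprn_ge0 ?cmod_ge0 // ler_wpM2l ?inv_1B_ge0 //.
exact: inv_1B_le.
Qed.

Lemma clog1_le (z : C) : cmod z <= v -> cmod (clog1 z) <= c * cmod z.
Proof.
move=> zv; have z1 : cmod z < 1 by exact: le_lt_trans zv v1.
have := clog1_tail 0 z1; rewrite /plog big_ord0 subr0 expr1 => h.
apply: le_trans h _; rewrite mulrC ler_wpM2r ?cmod_ge0 //; exact: inv_1B_le.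
Qed.

Lemma clog1_sub_le (z : C) : cmod z <= v -> cmod (clog1 z - z) <= c * cmod z ^+ 2.
Proof.
move=> zv; have z1 : cmod z < 1 by exact: le_lt_trans zv v1.
have := clog1_tail 1 z1; rewrite /plog big_ord1 expr1 divr1 => h.
by apply: le_trans h _; rewrite mulrC ler_wpM2r ?exprn_ge0 ?cmod_ge0 // inv_1B_le.
Qed.

End CycleEnergy.

Lemma sum_multiples (V : nmodType) (phi : nat -> V) d N : (0 < d)%N ->
  \sum_(n < N | (d %| n.+1)%N) phi n.+1 = \sum_(m < N %/ d) phi (m.+1 * d)%N.
Proof.
move=> d0; elim: N => [|N IH]; first by rewrite big_ord0 div0n big_ord0.
rewrite big_mkcond big_ord_recr /= -big_mkcond /= IH divnS //.
case: ifPn => dN; last by rewrite add0n addr0.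
rewrite add1n big_ord_recr /=; congr (_ + phi _).
by rewrite -[in LHS](divnK dN) divnS // dN.
Qed.

(** * The product formula for an abstract family of multipliers and lengths *)

Section EulerProduct.
Variables (R : realType) (T : choiceType).
Local Notation C := (Cplx R).
Variables (P : set T) (X : nat -> seq T) (q : T -> C) (d : T -> nat).
Variables (u B : R) (tr : nat -> C) (Z : C).
Hypotheses (u0 : 0 < u) (u1 : u < 1) (eX : exhausting P X).
Hypothesis d0 : forall x, P x -> (0 < d x)%N.
Hypothesis dX : forall N x, x \in X N -> (d x <= N)%N.
Hypothesis q_le : forall x, P x -> cmod (q x) <= (u ^+ 2) ^+ d x.
Hypothesis q_sum : forall N,
  \sum_(x <- X N) cmod (q x) ^+ 2 / (u ^+ 2) ^+ d x <= B.
Hypothesis trE : forall N n, (n < N)%N ->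
  tr n.+1 = \sum_(x <- X N | (d x %| n.+1)%N) geo (q x ^+ (n.+1 %/ d x)) *+ d x.
Hypothesis cvgZ : series (fun n => tr n.+1 / n.+1%:R) @ \oo --> Z.

Let v := u ^+ 2.
Let c := (1 - v)^-1.

Let v0 : 0 < v. Proof. exact: exprn_gt0. Qed.
Let v1 : v < 1. Proof. by rewrite /v exprn_ilt1 // ltW. Qed.
Let XP N x : x \in X N -> P x. Proof. by case: eX => _ h _ _; exact: h. Qed.

Let qv x : P x -> cmod (q x) <= v.
Proof.
move=> Px; apply: le_trans (q_le Px) _; rewrite -(prednK (d0 Px)) exprS.
by rewrite ger_pMr // exprn_ile1 // ltW.
Qed.

Let q_sqr N : \sum_(x <- X N) cmod (q x) ^+ 2 <= B.
Proof.
apply: le_trans (q_sum N); rewrite big_seq [leRHS]big_seq.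
apply: ler_sum => x /XP Px.
rewrite ler_pdivlMr ?exprn_gt0 // ler_piMr ?exprn_ge0 ?cmod_ge0 //.
by rewrite exprn_ile1 ?exprn_ge0 ?exprn_ile1 // ltW.
Qed.

(** Length n + 1 = m d means the m-th power of an element of length d; the d rotations over the
    denominator m d leave 1 / m. Cutting at length N cuts the powers of x at N / d. *)
Lemma series_trE N : series (fun n => tr n.+1 / n.+1%:R) N =
  \sum_(x <- X N) geo_ser (N %/ d x) (q x).
Proof.
rewrite /series /= big_mkord.
rewrite (eq_bigr (fun n : 'I_N => \sum_(x <- X N | (d x %| n.+1)%N)
   (geo (q x ^+ (n.+1 %/ d x)) *+ d x) / n.+1%:R)); last first.
  by move=> n _; rewrite (trE (ltn_ord n)) mulr_suml.
rewrite (exchange_big_dep xpredT) //= big_seq [RHS]big_seq; apply: eq_bigr => x /XP Px.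
rewrite (sum_multiples (fun n => (geo (q x ^+ (n %/ d x)) *+ d x) / n%:R) N (d0 Px)).
apply: eq_bigr => m _; rewrite mulnK ?d0 // natrM -(mulr_natr (geo _)).
have h : (d x)%:R != 0 :> C by rewrite pnatr_eq0 -lt0n d0.
by rewrite invfM mulrACA divff // mulr1.
Qed.

(** With M = N / d >= 1 the tail of one class is at most c^2 |q|^(M + 1), where |q|^(M + 1) <= |q|^2
    v^(d (M - 1)) = (|q|^2 / v^d) v^(d M). As 2 d M >= N and v = u^2, the last power is at most u^N;
    this is why v is written as a square and why the sum is weighted by 1 / v^d. *)
Lemma series_tr_tail N :
  cmod (\sum_(x <- X N) geo_sum (q x) - series (fun n => tr n.+1 / n.+1%:R) N) <=
  c ^+ 2 * B * u ^+ N.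
Proof.
rewrite series_trE -sumrB; apply: le_trans (cmod_sum _ _ _) _.
apply: le_trans (_ : \sum_(x <- X N)
   c ^+ 2 * (cmod (q x) ^+ 2 / v ^+ d x) * u ^+ N <= _); last first.
  rewrite -mulr_suml -mulr_sumr ler_wpM2r ?exprn_ge0 ?(ltW u0) //.
  by rewrite ler_wpM2l ?exprn_ge0 ?inv_1B_ge0 ?(ltW v0) //; exact: q_sum.
rewrite big_seq [leRHS]big_seq; apply: ler_sum => x xX; have Px := XP xX.
apply: le_trans (geo_sum_tail (ltW v0) v1 _ (qv Px)) _.
rewrite -mulrA ler_wpM2l ?exprn_ge0 ?inv_1B_ge0 ?(ltW v0) //.
set M := (N %/ d x)%N; have M0 : (0 < M)%N by rewrite divn_gt0 ?d0 // dX.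
have -> : cmod (q x) ^+ M.+1 = cmod (q x) ^+ 2 * cmod (q x) ^+ M.-1.
  by rewrite -exprD -{1}(prednK M0).
rewrite -[leRHS]mulrA ler_wpM2l ?exprn_ge0 ?cmod_ge0 //.
rewrite mulrC ler_pdivlMr ?exprn_gt0 //.
apply: le_trans (_ : (v ^+ d x) ^+ M.-1 * v ^+ d x <= _).
  apply: ler_wpM2r; first by rewrite ltW // exprn_gt0.
  apply: lerXn2r.
  - exact: cmod_ge0.
  - by rewrite nnegrE ltW // exprn_gt0.
  - exact: q_le.
rewrite -exprSr prednK // -exprM /v -exprM; apply: ler_wiXn2l; rewrite ?(ltW u0) ?(ltW u1) //.
have := ltn_ceil N (d0 Px); rewrite -/M; move: M0 (d0 Px); clear; nia.
Qed.

Lemma cvg_geo_tail (k : R) :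
  (fun N => k * u ^+ N) @ \oo --> (0 : R).
Proof.
rewrite -[X in _ --> X](mulr0 k); apply: cvgM; first exact: cvg_cst.
by apply: cvg_expr; rewrite ger0_norm // ltW.
Qed.

Lemma geo_sum_sub_cvg : exists SG : C, forall Y, exhausting P Y ->
  (fun N => \sum_(x <- Y N) (geo_sum (q x) - q x)) @ \oo --> SG.
Proof.
have [|x Px|l _ cl] := @exhausting_cvg _ _ P X
    (fun x => 2 * c ^+ 2 * cmod (q x) ^+ 2) (2 * c ^+ 2 * B)
    (fun x => geo_sum (q x) - q x) eX.
- move=> N; rewrite -mulr_sumr ler_wpM2l ?mulr_ge0 ?exprn_ge0 ?inv_1B_ge0 ?(ltW v0) //.
- by apply: geo_sum_sub1 => //; [exact: ltW v0 | exact: qv].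
by exists l.
Qed.

(** Convergence of the sum of the q in the order of length is inherited from the trace series, by
    subtracting the tails and the absolutely convergent quadratic remainder. *)
Lemma multiplier_sum_cvg SG :
  (forall Y, exhausting P Y ->
    (fun N => \sum_(x <- Y N) (geo_sum (q x) - q x)) @ \oo --> SG) ->
  (fun N => \sum_(x <- X N) q x) @ \oo --> Z - SG.
Proof.
move=> cSG.
have -> : (fun N => \sum_(x <- X N) q x) = (fun N =>
   series (fun n => tr n.+1 / n.+1%:R) N +
   (\sum_(x <- X N) geo_sum (q x) - series (fun n => tr n.+1 / n.+1%:R) N) -
    \sum_(x <- X N) (geo_sum (q x) - q x)).
  by apply/funext => N; rewrite sumrB; ring.
apply: cvgB; last exact: cSG.
rewrite -[X in _ --> X]addr0; apply: cvgD; first exact: cvgZ.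
apply/cvg_cmod; under eq_fun do rewrite subr0.
apply: (@squeeze_cvgr _ _ _ _ (fun=> 0) (fun N => c ^+ 2 * B * u ^+ N)).
- by apply: nearW => N; rewrite cmod_ge0 series_tr_tail.
- exact: cvg_cst.
- exact: cvg_geo_tail.
Qed.

(** Only the factor k = 1 depends on the exhaustion: for k >= 2 the logarithms are of order q^2 and
    converge absolutely, and for k = 1 so does the logarithm minus its linear term q. It thus
    suffices that the sum of the q along Y has the same limit as along X. *)
Lemma euler_product SG Y :
  (forall Y, exhausting P Y ->
    (fun N => \sum_(x <- Y N) (geo_sum (q x) - q x)) @ \oo --> SG) ->
  exhausting P Y ->
  (fun N => \sum_(x <- Y N) q x) @ \oo --> Z - SG ->
  exists2 Pi : nat -> C,
    forall k, (0 < k)%N ->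
      (fun N => \prod_(x <- Y N) (1 - q x ^+ k)) @ \oo --> Pi k
    & (fun K => \prod_(1 <= k < K.+1) Pi k) @ \oo --> cexp (- Z).
Proof.
move=> cSG eY cq.
have cG : (fun N => \sum_(x <- Y N) geo_sum (q x)) @ \oo --> Z.
  have -> : (fun N => \sum_(x <- Y N) geo_sum (q x)) = (fun N =>
     \sum_(x <- Y N) (geo_sum (q x) - q x) + \sum_(x <- Y N) q x).
    by apply/funext => N; rewrite sumrB subrK.
  have -> : Z = SG + (Z - SG) by ring.
  by apply: cvgD; [exact: cSG | exact: cq].
have bd (f : T -> C) (K : R) : 0 <= K -> (forall x, P x -> cmod (f x) <= K * cmod (q x) ^+ 2) ->
    exists2 l : C, cmod l <= K * B & (fun N => \sum_(x <- Y N) f x) @ \oo --> l.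
  move=> K0 fK; have [|l lB cl] := @exhausting_cvg _ _ P X
    (fun x => K * cmod (q x) ^+ 2) (K * B) f eX _ fK.
    by move=> N; rewrite -mulr_sumr ler_wpM2l.
  by exists l; [exact: lB | exact: (cl Y eY)].
have c0 : 0 <= c by exact: inv_1B_ge0 (ltW v0) v1.
have /choice[l cl] : forall k, exists l : C,
    (fun N => \sum_(x <- Y N) clog1 (q x ^+ k.+1)) @ \oo --> l.
  move=> [|k].
    have [|l _ cl] := bd (fun x => clog1 (q x) - q x) c c0.
      by move=> x Px; exact (clog1_sub_le v1 (qv Px)).
    exists (l + (Z - SG)).
    have -> : (fun N => \sum_(x <- Y N) clog1 (q x ^+ 1)) = (fun N =>
       \sum_(x <- Y N) (clog1 (q x) - q x) + \sum_(x <- Y N) q x).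
      by apply/funext => N; rewrite sumrB subrK.
    by apply: cvgD; [exact: cl | exact: cq].
  have [|l _ cl] := bd (fun x => clog1 (q x ^+ k.+2)) c c0; last by exists l.
  move=> x Px; apply: le_trans (clog1_le v1 (cmodX_le v1 _ (qv Px))) _.
  rewrite cmodX ler_wpM2l //; apply: ler_wiXn2l => //; first exact: cmod_ge0.
  exact: le_trans (qv Px) (ltW v1).
exists (fun k => cexp (- l k.-1)).
  case=> [|k] k0; first by case: (notF k0).
  rewrite -[k.+1.-1]/k.
  have -> : (fun N => \prod_(x <- Y N) (1 - q x ^+ k.+1)) =
      (fun N => cexp (- \sum_(x <- Y N) clog1 (q x ^+ k.+1))).
    apply/funext => N; rewrite -sumrN cexp_sum big_seq [RHS]big_seq.
    apply: eq_bigr => x xY; rewrite cexpN_clog1 //.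
    apply: le_lt_trans v1; apply: cmodX_le; first exact: v1.
    by apply: qv; case: eY => _ YP _ _; exact: YP xY.
  by apply: cvg_cexp; apply: cvgN; exact: cl.
have -> : (fun K => \prod_(1 <= k < K.+1) cexp (- l k.-1)) =
    (fun K => cexp (- \sum_(k < K) l k)).
  apply/funext => K; rewrite -sumrN cexp_sum big_add1 big_mkord.
  by apply: eq_bigr.
apply: cvg_cexp; apply: cvgN.
(* With K + 1 logarithms removed, each class leaves a power |q|^(K + 2), from which the summable
   |q|^2 splits off and v^K remains. *)
rewrite -(cvg_shiftS (fun K => \sum_(k < K) l k)).
apply/cvg_cmod.
apply: (@squeeze_cvgr _ _ _ _ (fun=> 0) (fun K => c ^+ 2 * B * v ^+ K)).
- apply: nearW => K; rewrite cmod_ge0 /= cmodB.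
  have [||m mB cm] := bd (fun x => geo_sum (q x) - clog_sum K.+1 (q x)) (c ^+ 2 * v ^+ K).
  + by apply: mulr_ge0; apply: exprn_ge0; [exact: c0 | exact: ltW v0].
  + move=> x Px; apply: le_trans (geo_sum_clog (ltW v0) v1 K.+1 (qv Px)) _.
    rewrite -[leRHS]mulrA; apply: ler_wpM2l; first by rewrite exprn_ge0.
    rewrite mulrC -addn2 addnC exprD.
    rewrite ler_wpM2l ?exprn_ge0 ?cmod_ge0 //; apply: lerXn2r.
    * exact: cmod_ge0.
    * by rewrite nnegrE ltW.
    * exact: qv.
  suff -> : Z - \sum_(k < K.+1) l k = m by rewrite mulrAC.
  have cm' : (fun N => \sum_(x <- Y N) (geo_sum (q x) - clog_sum K.+1 (q x))) @ \oo -->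
      Z - \sum_(k < K.+1) l k.
    under eq_fun do rewrite sumrB.
    apply: cvgB; first exact: cG.
    under eq_fun do rewrite /clog_sum exchange_big.
    by apply: cvg_sum_seq => k _; exact: cl.
  by rewrite -(cvg_lim _ cm') // (cvg_lim _ cm).
- exact: cvg_cst.
- rewrite -[X in _ --> X](mulr0 (c ^+ 2 * B)); apply: cvgM; first exact: cvg_cst.
  by apply: cvg_expr; rewrite ger0_norm // ltW.
Qed.

End EulerProduct.

(** By Bernoulli's inequality the powers of a number above 1 are unbounded. *)
Lemma pow_bounded_le1 (R : realType) (x K : R) : 0 <= x ->
  (forall m, x ^+ m <= K) -> x <= 1.
Proof.
move=> x0 xK; rewrite leNgt; apply/negP => x1.
have b m : m%:R * (x - 1) <= x ^+ m.
  elim: m => [|m IH]; first by rewrite mul0r.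
  rewrite -natr1 mulrDl mul1r exprSr.
  apply: le_trans (_ : x ^+ m + x ^+ m * (x - 1) <= _); last first.
    by rewrite mulrBr mulr1 addrC subrK.
  by rewrite lerD // ler_peMl ?subr_ge0 ?(ltW x1) // exprn_ege1 // ltW.
have y0 : 0 < x - 1 by rewrite subr_gt0.
have K0 : 0 <= K by apply: le_trans (xK 0%N); rewrite expr0.
have := archi_boundP (divr_ge0 K0 (ltW y0)); rewrite ltr_pdivrMr // => h.
by have := lt_le_trans h (le_trans (b _) (xK _)); rewrite ltxx.
Qed.

Lemma rev_tuple_inj (T : Type) n : injective (fun s : n.-tuple T => rev_tuple s).
Proof. by move=> s s' /(congr1 val) /(can_inj revK) /val_inj. Qed.

(** * Estimates for the multipliers of the Schottky group and the product formula *)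

Section SchottkyMultipliers.
Variables (R : realType) (g : nat).
Local Notation C := (Cplx R).
Local Notation I := (idx g).
Local Notation sphere := (sphere R).
Variables (w sg rho : I -> C) (t : R).
Hypotheses (t0 : 0 < t) (t1 : t < 1).
Hypothesis sg0 : forall a, sg a != 0.
Hypothesis sgN : forall a, sg (opp_idx a) = sg a.
Hypothesis sep : forall a b, a != b ->
  cmod (sg a) + cmod (sg b) <= t * cmod (w a - w b).
Hypothesis sg2 : forall a, sg a ^+ 2 = rho a.
Variable P : set (sphere -> sphere).
Hypothesis hP : primitive_representatives (schottky_group w rho) P.

Local Notation wd := (word w rho).
Local Notation G := (schottky_group w rho).
Local Notation nc := (@nocancel g).
Local Notation cnj := (conjugate G).
Local Notation len := (rep_len w rho).
Local Notation trA n := (infmx_tr (infmx_exp (Amx w sg) n)).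
Local Notation r := (rate t).

Lemma is_multiplier_conjugate f f' q : cnj f f' -> is_multiplier f q -> is_multiplier f' q.
Proof.
move=> [_ [s _ <-]]; have [H H0 ->] := word_mobius w sg0 sg2 s.
exact: is_multiplier_conj.
Qed.

Lemma multiplier_conj f f' : cnj f f' -> multiplier f = multiplier f'.
Proof.
move=> ff'; have f'f := conj_sym sg0 sgN sg2 ff'.
rewrite /multiplier; congr (xget 0); apply/funext => q; apply/propext.
by split; apply: is_multiplier_conjugate.
Qed.

Lemma cycle_nc_rev s : cycle nc (rev s) = cycle nc s.
Proof. by rewrite rev_cycle; apply: eq_cycle => a b; exact: nocancel_sym. Qed.

Lemma cycle_multiplier s : s != [::] -> cycle nc s ->
  is_multiplier (wd (rev s)) (multiplier (wd (rev s))) /\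
  forall x, path_trace w sg (last x s) s = geo (multiplier (wd (rev s))).
Proof.
case: s => [//|x0 s] s0 cs.
have cs' : path nc (last x0 s) (x0 :: s) by move: cs; rewrite (cycle_path x0).
have [q qm qE] := path_multiplier t0 t1 sg0 sgN sep sg2 s0 cs' (erefl _).
by rewrite (multiplierE qm).
Qed.

Lemma word_multiplier s : s != [::] -> cycle nc s ->
  is_multiplier (wd s) (multiplier (wd s)).
Proof.
move=> s0 cs; have [] := @cycle_multiplier (rev s); last by rewrite revK.
  by rewrite -size_eq0 size_rev size_eq0.
by rewrite cycle_nc_rev.
Qed.

Lemma tr_exp_multiplier n :
  trA n.+1 = \sum_(s : n.+1.-tuple I | cycle nc s) geo (multiplier (wd s)).
Proof.
rewrite (tr_expE t0 t1 sg0 sgN sep).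
rewrite (bigID (fun s : n.+1.-tuple I => cycle nc s)) /= [X in _ + X]big1 ?addr0.
  rewrite (reindex_inj (@rev_tuple_inj _ _)) /=.
  rewrite (eq_bigl (fun s : n.+1.-tuple I => cycle nc s)) => [|s]; last exact: cycle_nc_rev.
  apply: eq_bigr => s cs.
  have s0 : rev s != [::] by rewrite -size_eq0 size_rev size_tuple.
  have [|_ ->] := cycle_multiplier s0; first by rewrite cycle_nc_rev.
  by rewrite revK.
move=> s ncs; apply: path_trace0; move: ncs; case: s => -[|x s] //= sz.
by rewrite rcons_path andbC.
Qed.

(** Each word is one of the paths, started at its own last letter, with trace q / (1 - q); and |q|
    <= 2 |q / (1 - q)| because |1 - q| <= 2, whence the 4. *)
Lemma sum_multiplier_sqr_le n :
  \sum_(s : n.+1.-tuple I | cycle nc s) cmod (multiplier (wd s)) ^+ 2 <=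
  4 * (#|{: I}|%:R * (1 - r)^-1 ^+ 2) * (r ^+ n) ^+ 2.
Proof.
rewrite -[leRHS]mulrA; apply: le_trans (_ : 4 * (\sum_(a : I)
   \sum_(s : n.+1.-tuple I) cmod (path_trace w sg a s) ^+ 2) <= _); last first.
  by rewrite ler_wpM2l //; exact: path_trace_sqr_le.
rewrite exchange_big mulr_sumr big_mkcond.
rewrite [leRHS](reindex_inj (@rev_tuple_inj _ _)) /=.
apply: ler_sum => s _; case: ifPn => [cs|_]; last first.
  by rewrite mulr_ge0 // sumr_ge0 // => a _; exact: sqr_ge0.
have s0 : rev s != [::] by rewrite -size_eq0 size_rev size_tuple.
have s0' : tval s != [::] by rewrite -size_eq0 size_tuple.
have [|_ h] := cycle_multiplier s0; first by rewrite cycle_nc_rev.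
rewrite (bigD1 (last (thead s) (rev s))) //= h revK.
have [qlt _] := word_multiplier s0' cs; rewrite ltr_cmod1 in qlt.
set q := multiplier _ in qlt *.
apply: le_trans (_ : 4 * cmod (geo q) ^+ 2 <= _); last first.
  by rewrite ler_wpM2l // lerDl sumr_ge0 // => a _; exact: sqr_ge0.
have q1 : 1 - q != 0.
  by rewrite subr_eq0; apply: contraTneq qlt => <-; rewrite cmod1 ltxx.
have -> : cmod q ^+ 2 = cmod (geo q) ^+ 2 * cmod (1 - q) ^+ 2.
  by rewrite -exprMn -cmodM /geo divfK.
rewrite mulrC ler_wpM2r ?sqr_ge0 //.
have -> : 4 = 2 ^+ 2 :> R by rewrite -natrX.
apply: lerXn2r; rewrite ?nnegrE ?cmod_ge0 //.
apply: le_trans (cmodD _ _) _; rewrite cmod1 cmodN.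
by rewrite (_ : 2 = 1 + 1) // lerD2l ltW.
Qed.

Lemma rep_multiplier p : P p -> is_multiplier p (multiplier p).
Proof.
move=> Pp; have [cu [u0 _] cup] := rep_wdP sg0 sgN sg2 hP Pp.
rewrite -(multiplier_conj cup).
exact: is_multiplier_conjugate cup (word_multiplier u0 cu).
Qed.

Lemma multiplier_iter p m : P p -> (0 < m)%N ->
  multiplier (iter m p) = multiplier p ^+ m.
Proof.
by move=> /rep_multiplier pq m0; apply: multiplierE; exact: is_multiplier_iter.
Qed.

Lemma mem_length_le N p :
  p \in fset_set (length_le w rho P N) <-> P p /\ (len p <= N)%N.
Proof.
rewrite in_fset_set; last exact: (finite_length_le t0 t1 sg0 sgN sep sg2 hP).
rewrite (length_leE t0 t1 sg0 sgN sep sg2 hP); split => [/set_mem//|h].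
exact: mem_set.
Qed.

Lemma sum_rep (V : nmodType) (Phi : C -> V) N n : (n < N)%N ->
  \sum_(s : n.+1.-tuple I | cycle nc s) Phi (multiplier (wd s)) =
  \sum_(p <- fset_set (length_le w rho P N) | (len p %| n.+1)%N)
     Phi (multiplier p ^+ (n.+1 %/ len p)) *+ len p.
Proof.
move=> nN.
rewrite (sum_cycle_words t0 t1 sg0 sgN sep sg2 hP
  (Phi := fun f => Phi (multiplier f)) (r := fset_set (length_le w rho P N))).
- rewrite big_seq_cond [RHS]big_seq_cond.
  apply: eq_bigr => p /andP[/mem_length_le[Pp _] dn].
  rewrite multiplier_iter // divn_gt0; first exact: dvdn_leq.
  exact: (rep_len_gt0 sg0 sgN sg2 hP).
- by move=> f f' ff'; rewrite (multiplier_conj ff').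
- by [].
- exact: fset_uniq.
- by move=> p /mem_length_le[].
- by move=> p Pp pn; apply/mem_length_le; split => //; exact: leq_trans pn nN.
Qed.

(** The division by r^2 turns r^n, for words of n + 1 letters, into r^(n + 1). *)
Let K := 4 * (#|{: I}|%:R * (1 - r)^-1 ^+ 2) / r ^+ 2 : R.

Let r0 : 0 < r. Proof. exact: rate_gt0. Qed.
Let r1 : r < 1. Proof. exact: rate_lt1. Qed.

Let K0 : 0 <= K.
Proof.
by rewrite divr_ge0 ?exprn_ge0 ?(ltW r0) // mulr_ge0 // mulr_ge0 // exprn_ge0 // invr_ge0 subr_ge0 ltW.
Qed.

Lemma sum_rep_sqr_le N n : (n < N)%N ->
  \sum_(p <- fset_set (length_le w rho P N) | (len p %| n.+1)%N)
     cmod (multiplier p ^+ (n.+1 %/ len p)) ^+ 2 *+ len p <= K * (r ^+ n.+1) ^+ 2.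
Proof.
move=> nN; rewrite -(sum_rep (fun z : C => cmod z ^+ 2) nN).
apply: le_trans (sum_multiplier_sqr_le n) _.
rewrite /K (exprSr r n) exprMn (mulrC ((r ^+ n) ^+ 2)) [leRHS]mulrA divfK //.
by rewrite expf_neq0 // gt_eqF.
Qed.

(** The bound for the words of a given length holds only up to the constant K. Applied to all powers
    of p it bounds every power of (|q| / r^len)^2 by the same constant, which forces that number to
    be at most 1. *)
Lemma rep_multiplier_le p : P p -> cmod (multiplier p) <= r ^+ len p.
Proof.
move=> Pp; have d0 := rep_len_gt0 sg0 sgN sg2 hP Pp.
have rd : 0 < r ^+ len p by rewrite exprn_gt0.
suff : (cmod (multiplier p) / r ^+ len p) ^+ 2 <= 1.
  rewrite -[X in _ <= X](expr1n _ 2) ler_pXn2r ?nnegrE ?divr_ge0 ?cmod_ge0 ?(ltW rd) //.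
  by rewrite ler_pdivrMr // mul1r.
(* The added 1 covers the power 0; all others are at most K. *)
apply: (@pow_bounded_le1 _ _ (K + 1)); first exact: sqr_ge0.
case=> [|m]; first by rewrite expr0 lerDr.
apply: le_trans (_ : K <= _); last by rewrite lerDl.
set n := (len p * m.+1).-1.
have nE : n.+1 = (len p * m.+1)%N by rewrite prednK // muln_gt0 d0.
have := @sum_rep_sqr_le n.+1 n (leqnn _).
have pX : p \in fset_set (length_le w rho P n.+1).
  by apply/mem_length_le; split => //; rewrite nE leq_pmulr.
rewrite big_mkcond (bigD1_seq p) //= ?fset_uniq // nE dvdn_mulr // mulKn //.
move=> h; rewrite -exprM mulnC exprM !expr_div_n -(exprM r).
rewrite ler_pdivrMr ?exprn_gt0 //.
apply: le_trans h; rewrite -(cmodX (multiplier p)).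
apply: le_trans (_ : cmod (multiplier p ^+ m.+1) ^+ 2 *+ len p <= _).
  by rewrite -{1}[cmod _ ^+ 2]mulr1n; apply: ler_wpMn2l => //; exact: sqr_ge0.
rewrite lerDl; apply: sumr_ge0 => i _; case: ifP => // _.
by rewrite mulrn_wge0 // sqr_ge0.
Qed.

(** Among the words of length n + 1 the primitive elements of that length contribute at most K r^(2
    (n + 1)); dividing by r^(n + 1) leaves a geometric series. *)
Lemma rep_sum_le N :
  \sum_(p <- fset_set (length_le w rho P N))
    cmod (multiplier p) ^+ 2 / r ^+ len p <= K / (1 - r).
Proof.
apply: le_trans (_ : \sum_(n < N) K * r ^+ n <= _); last first.
  rewrite -mulr_sumr ler_wpM2l //.
  by have := @sum_geo_le R r N (ltW r0) r1; rewrite big_mkord.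
apply: le_trans (_ : \sum_(n < N) \sum_(p <- fset_set (length_le w rho P N) | len p == n.+1)
    cmod (multiplier p) ^+ 2 / r ^+ len p <= _).
  rewrite (exchange_big_dep xpredT) //= big_seq [leRHS]big_seq.
  apply: ler_sum => p /mem_length_le[Pp pN].
  have d0 := rep_len_gt0 sg0 sgN sg2 hP Pp.
  have h : ((len p).-1 < N)%N by rewrite prednK.
  rewrite (bigD1 (Ordinal h)) /= ?prednK ?eqxx // lerDl.
  apply: sumr_ge0 => i _; apply: divr_ge0; first exact: sqr_ge0.
  by rewrite exprn_ge0 // ltW.
apply: ler_sum => n _.
apply: le_trans (_ : K * (r ^+ n.+1) ^+ 2 / r ^+ n.+1 <= _); last first.
  rewrite expr2 mulrA mulfK ?gt_eqF ?exprn_gt0 // exprS.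
  by rewrite ler_wpM2l // ger_pMl ?exprn_gt0 // ltW.
rewrite ler_pdivlMr ?exprn_gt0 //; apply: le_trans (sum_rep_sqr_le (ltn_ord n)).
rewrite mulr_suml big_mkcond [leRHS]big_mkcond big_seq [leRHS]big_seq.
apply: ler_sum => p /mem_length_le[Pp pN].
have d0 := rep_len_gt0 sg0 sgN sg2 hP Pp.
case: eqP => [<-|_].
  rewrite divfK ?gt_eqF ?exprn_gt0 // dvdnn divnn d0 expr1.
  by rewrite -{1}[cmod _ ^+ 2]mulr1n; apply: ler_wpMn2l => //; exact: sqr_ge0.
by case: ifP => // _; rewrite mulrn_wge0 // sqr_ge0.
Qed.

Lemma exhausting_length_le :
  exhausting P (fun N => fset_set (length_le w rho P N)).
Proof.
split.
- by move=> N; exact: fset_uniq.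
- by move=> N p /mem_length_le[].
- move=> N p /mem_length_le[Pp pN]; apply/mem_length_le; split => //.
  exact: leqW.
- by move=> p Pp; exists (len p); apply/mem_length_le.
Qed.

Let Z := limn (det1B_series (Amx w sg)).
Let u := Num.sqrt r.

Let u0 : 0 < u. Proof. by rewrite sqrtr_gt0. Qed.
Let u1 : u < 1. Proof. by rewrite -sqrtr1 ltr_sqrt. Qed.
Let u2 : u ^+ 2 = r. Proof. by rewrite sqr_sqrtr // ltW. Qed.

Let d0 p : P p -> (0 < len p)%N.
Proof. exact: (rep_len_gt0 sg0 sgN sg2 hP). Qed.

Let q_le p : P p -> cmod (multiplier p) <= (u ^+ 2) ^+ len p.
Proof. by rewrite u2; exact: rep_multiplier_le. Qed.

Let q_sum N : \sum_(p <- fset_set (length_le w rho P N))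
    cmod (multiplier p) ^+ 2 / (u ^+ 2) ^+ len p <= K / (1 - r).
Proof. by rewrite u2; exact: rep_sum_le. Qed.

Lemma schottky_multiplier_sum_cvg (SG : C) :
  (forall Y : nat -> seq (sphere -> sphere), exhausting P Y ->
    (fun N => \sum_(p <- Y N) (geo_sum (multiplier p) - multiplier p))
      @ \oo --> SG) ->
  (fun N => \sum_(p <- fset_set (length_le w rho P N)) multiplier p)
    @ \oo --> Z - SG.
Proof.
move=> cSG.
apply: (multiplier_sum_cvg u0 u1 exhausting_length_le d0 _ q_le q_sum _ _ cSG
  (tr := fun n => trA n)).
- by move=> N p /mem_length_le[].
- by move=> N n nN; rewrite tr_exp_multiplier (sum_rep (@geo R) nN).
- exact: (det1B_series_cvg t0 t1 sg0 sgN sep).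
Qed.

Lemma exhaustion_exhausting (F : nat -> set (sphere -> sphere)) :
  exhaustion F P -> exhausting P (fun N => fset_set (F N)).
Proof.
move=> [finF FS FP]; have memF N p : p \in fset_set (F N) <-> F N p.
  by rewrite in_fset_set //; split => [/set_mem //|h]; exact: mem_set.
split.
- by move=> N; exact: fset_uniq.
- by move=> N p /memF Fp; rewrite -FP; exists N.
- by move=> N p /memF Fp; apply/memF; exact: FS.
- by move=> p; rewrite -FP => -[N _ Fp]; exists N; apply/memF.
Qed.

(** The limit [a] is fixed by the order of length before [F] is chosen; both products of the theorem
    are instances, with [F] either that order or, for summable multipliers, arbitrary. *)
Lemma schottky_euler_product :
  exists2 a : C,
    (fun N => \sum_(p <- fset_set (length_le w rho P N)) multiplier p)
      @ \oo --> a &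
    forall F : nat -> set (sphere -> sphere), exhaustion F P ->
      (fun N => \sum_(p <- fset_set (F N)) multiplier p) @ \oo --> a ->
      iterated_product_cvg F (det1B (Amx w sg)).
Proof.
have [SG cSG] := geo_sum_sub_cvg u0 u1 exhausting_length_le d0 q_le q_sum.
exists (Z - SG); first exact: schottky_multiplier_sum_cvg.
move=> F eF cF; have [finF _ _] := eF.
have [Pi h1 h2] := euler_product u0 u1 exhausting_length_le d0 q_le q_sum cSG
  (exhaustion_exhausting eF) cF.
exists Pi; last exact: h2.
move=> k k0; under eq_fun do rewrite fsbig_finite //.
exact: h1.
Qed.

Lemma exhaustion_length_le : exhaustion (length_le w rho P) P.
Proof.
split.
- by move=> N; exact: (finite_length_le t0 t1 sg0 sgN sep sg2 hP).
- move=> N p [Pp [s sN sp]]; split => //; exists s => //; exact: leqW.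
- apply/seteqP; split => [p [N _ []]//|p Pp].
  exists (len p) => //; rewrite (length_leE t0 t1 sg0 sgN sep sg2 hP).
  by split.
Qed.

(** The sum of the moduli over P bounds every finite partial sum, so the multipliers themselves can
    serve in the principle of absolute convergence. *)
Lemma summable_multiplier_sum_cvg (F : nat -> set (sphere -> sphere)) (a : C) :
  multipliers_summable P -> exhaustion F P ->
  (fun N => \sum_(p <- fset_set (length_le w rho P N)) multiplier p)
    @ \oo --> a ->
  (fun N => \sum_(p <- fset_set (F N)) multiplier p) @ \oo --> a.
Proof.
rewrite /multipliers_summable /summable => sm eF ca.
set E := (\esum_(p in P) _)%E in sm.
have fE : E \is a fin_num.
  by rewrite ge0_fin_numE // esum_ge0.
have hB N : \sum_(p <- fset_set (length_le w rho P N)) cmod (multiplier p) <= fine E.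
  rewrite -lee_fin fineK // /E /esum -sumEFin.
  have fin := finite_length_le t0 t1 sg0 sgN sep sg2 hP N.
  apply: ereal_sup_ubound; exists (length_le w rho P N).
    by split => // p [].
  rewrite fsbig_finite //; apply: eq_bigr => p _.
  by rewrite /= ger0_norm // cmod_ge0.
have [l _ cl] := exhausting_cvg exhausting_length_le hB
  (f := fun p => multiplier p) (fun p _ => lexx _).
have -> : a = l.
  by rewrite -(cvg_lim _ ca) // (cvg_lim _ (cl _ exhausting_length_le)).
exact: cl (exhaustion_exhausting eF).
Qed.

End SchottkyMultipliers.

(** There are only finitely many pairs of discs, so the strict inequalities hold with a common ratio
    t < 1. The default 1/2 of the maximum keeps t positive. *)
Lemma schottky_domain_separation (R : realType) (g : nat)
    (w rho sg : idx g -> Cplx R) :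
  schottky_domain w rho -> (forall a, sg a ^+ 2 = rho a) ->
  exists t : R, [/\ 0 < t, t < 1 & forall a b, a != b ->
    cmod (sg a) + cmod (sg b) <= t * cmod (w a - w b)].
Proof.
move=> [_ _ dom] sg2.
have lt a b : a != b -> cmod (sg a) + cmod (sg b) < cmod (w a - w b).
  move=> /dom; rewrite -!sg2 !normrX !sqrCK ?normr_ge0 // !normE -rtocD.
  by rewrite /rtoc ltcR.
pose f (p : idx g * idx g) : R :=
  (cmod (sg p.1) + cmod (sg p.2)) / cmod (w p.1 - w p.2).
exists (\big[Num.max/2^-1]_(p | p.1 != p.2) f p); split.
- by apply: lt_le_trans (bigmax_ge_id _ _ _ _); rewrite invr_gt0.
- apply/bigmax_ltP; split; first by rewrite invf_lt1 // ltr1n.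
  move=> p ab; rewrite ltr_pdivrMr ?mul1r; first exact: lt.
  by apply: le_lt_trans (lt _ _ ab); rewrite addr_ge0 ?cmod_ge0.
- move=> a b ab; rewrite -ler_pdivrMr; last first.
    by apply: le_lt_trans (lt _ _ ab); rewrite addr_ge0 ?cmod_ge0.
  exact: (@le_bigmax_cond _ _ _ _ (a, b) _ f).
Qed.

Theorem theorem4p3 (R : realType) (g : nat) (hg : (1 <= g)%N)
    (w rho srho : idx g -> Cplx R)
    (hdom : schottky_domain w rho)
    (hsrho : forall a, (srho a ^+ 2 = rho a)%R)
    (hsrhoN : forall a, srho (opp_idx a) = srho a)
    (P : set (sphere R -> sphere R))
    (hP : primitive_representatives (schottky_group w rho) P) :
  [/\ det1B_defined (Amx w srho),
      iterated_product_cvg (length_le w rho P) (det1B (Amx w srho)) &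
      multipliers_summable P ->
        forall F : nat -> set (sphere R -> sphere R), exhaustion F P ->
          iterated_product_cvg F (det1B (Amx w srho))].
Proof.
have [t [t0 t1 sep]] := schottky_domain_separation hdom hsrho.
have sg0 a : srho a != 0.
  by case: hdom => /(_ a); rewrite -hsrho expf_eq0.
have [a ca prod] := schottky_euler_product t0 t1 sg0 hsrhoN sep hsrho hP.
have eX := exhaustion_length_le t0 t1 sg0 hsrhoN sep hsrho hP.
split; last 2 first.
- exact: prod eX ca.
- move=> sm F eF; apply: prod => //.
  exact: (summable_multiplier_sum_cvg t0 t1 sg0 hsrhoN sep hsrho hP).
split.
- move=> n a' b c k l k0 l0; exact: (@exp_product_cvg R g w srho t).
- move=> n a'; exact: (@exp_diag_cvg R g w srho t).
- exact: (@det1B_series_cvg R g w srho t).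
Qed.
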